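(* Let $n\ge 3$ and let $a,b$ be real numbers with $a<n$, $b<n$. Let $\mathbf X$ be an i.i.d. sample of size $n$ from the bivariate normal distribution with parameters $(\mu_1,\mu_2,\sigma_1,\sigma_2,\rho)$, use the prior $\pi_{ab}$, and let $\theta_1=\rho\sigma_2/\sigma_1$. (a) The constructive posterior of $\theta_1$ has the expression $$\theta_1^*=\frac{r\sqrt{s_{22}}}{\sqrt{s_{11}}}-\frac{Z_3^*}{\sqrt{\chi^{2*}_{n-b}}}\,\frac{\sqrt{1-r^2}\sqrt{s_{22}}}{\sqrt{s_{11}}},$$ that is, the posterior distribution of $\theta_1$ given $\mathbf X$ is the distribution of $\theta_1^*$ with the data held fixed. (b) For any $\alpha\in(0,1)$, $\boldsymbol\xi=(\mu_1,\mu_2,\sigma_1,\sigma_2)$ and $\rho\in(-1,1)$, $$P(\theta_1<(\theta_1^* )_{1-\alpha}\mid\boldsymbol\xi,\rho)=P\left(t_{n-2}<\sqrt{\frac{n-2}{n-b}}\,(t^*_{n-b})_{1-\alpha}\right),$$ which does not depend on $\rho$. Furthermore, this probability equals $1-\alpha$ if and only if $b=2$.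
   Context: Model: $\mathbf x_k=(x_{1k},x_{2k})'$, $k=1,\dots,n$, are i.i.d. bivariate normal with mean $(\mu_1,\mu_2)'\in\mathbb R^2$ and covariance matrix $\boldsymbol\Sigma=\begin{pmatrix}\sigma_1^2&\rho\sigma_1\sigma_2\\ \rho\sigma_1\sigma_2&\sigma_2^2\end{pmatrix}$, $\sigma_1,\sigma_2>0$, $|\rho|<1$. Statistics: $\overline x_i=n^{-1}\sum_k x_{ik}$, $s_{ij}=\sum_k(x_{ik}-\overline x_i)(x_{jk}-\overline x_j)$, $r=s_{12}/\sqrt{s_{11}s_{22}}$ (with $|r|<1$ assumed). Prior: $\pi_{ab}$ is the (improper) density, with respect to $d\mu_1\,d\mu_2\,d\sigma_1\,d\sigma_2\,d\rho$, $$\pi_{ab}(\mu_1,\mu_2,\sigma_1,\sigma_2,\rho)=\frac{1}{\sigma_1^{3-a}\sigma_2^{2-b}(1-\rho^2)^{2-b/2}},$$ and the posterior given $\mathbf X$ is the normalized product of likelihood and prior. Random variables: $Z_3^*$ is standard normal and independent of $\chi^{2*}_{n-b}$, a chi-squared variable with $n-b$ degrees of freedom; $t_m$, $t_m^*$ denote Student $t$ variables with $m$ degrees of freedom, i.e. distributed as $Z/\sqrt{\chi^2_m/m}$ with $Z$ standard normal independent of the chi-squared variable $\chi^2_m$ with $m$ degrees of freedom. A star marks a draw from a posterior-type distribution. Quantiles: $(W)_{\beta}$ denotes the $\beta$ quantile of $W$ with respect to the distribution of the starred variables only, all non-starred quantities (in particular the data) being held fixed; so $(\theta_1^* )_{1-\alpha}$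 is a function of $\mathbf X$, the posterior $1-\alpha$ quantile of $\theta_1$, and the left side in (b) is the frequentist coverage of the one-sided credible interval $(-\infty,(\theta_1^* )_{1-\alpha})$. Frequentist coverage: $P(\cdot\mid\boldsymbol\xi,\rho)$ is probability under the sampling distribution of $\mathbf X$ with the parameters fixed.
   Formalization: ''Equals 1−α if and only if b=2'' is proved for each α≠1/2, and as ''equality for all α in (0,1) iff b=2''; at α=1/2 the t quantile is 0 and both sides equal 1/2 for every b, so the single-α equivalence fails there. *)

(* Defs.v *)
From HB Require Import structures.
From mathcomp Require Import all_boot all_order all_algebra.
From mathcomp Require Import all_classical all_reals all_analysis.
From mathcomp Require Import measurable_realfun.

Set Implicit Arguments.
Unset Strict Implicit.
Unset Printing Implicit Defensive.

Import Order.TTheory GRing.Theory Num.Theory.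
Import numFieldNormedType.Exports.

Local Open Scope classical_set_scope.
Local Open Scope ring_scope.

Section bivariate_normal.
Context {R : realType}.

Definition cov_mx (s1 s2 rho : R) : 'M[R]_(1 + 1) :=
  block_mx (s1 ^+ 2)%:M (rho * s1 * s2)%:M
           (rho * s1 * s2)%:M (s2 ^+ 2)%:M.

Definition vec2 (z : R * R) : 'rV[R]_(1 + 1) := row_mx z.1%:M z.2%:M.

Definition bvn_pdf (m : R * R) (S : 'M[R]_(1 + 1)) (z : R * R) : R :=
  expR (- ((vec2 z - vec2 m) *m invmx S *m (vec2 z - vec2 m)^T) 0 0 / 2)
  / (2 * pi * Num.sqrt (\det S)).

Definition bvn_prob (m : R * R) (S : 'M[R]_(1 + 1)) (A : set (R * R)) : \bar R :=
  (\int[lebesgue_measure \x lebesgue_measure]_(z in A) (bvn_pdf m S z)%:E)%E.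

End bivariate_normal.

Definition mutually_independent {R : realType} {d : measure_display}
    {T : measurableType d} (P : probability T R) {d' : measure_display}
    {T' : measurableType d'} (I : finType) (X : I -> {RV P >-> T'}) : Prop :=
  forall (J : {set I}) (B : I -> set T'),
    (forall k, k \in J -> measurable (B k)) ->
    P (\bigcap_(k in [set k | k \in J]) (X k @^-1` B k)) =
    (\prod_(k in J) P (X k @^-1` B k))%E.

Definition iid_bvn {R : realType} {d : measure_display}
    {T : measurableType d} (P : probability T R) (n : nat)
    (X : 'I_n -> {RV P >-> (R * R)%type}) (m : R * R) (S : 'M[R]_(1 + 1)) : Prop :=
  mutually_independent X /\
  forall k (A : set (R * R)), measurable A ->
    distribution P (X k) A = bvn_prob m S A.

Section statistics.
Context {R : realType} {n : nat}.
Implicit Types (u v : 'I_n -> R) (x : 'I_n -> R * R).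

Definition sample_mean u : R := n%:R^-1 * \sum_(k < n) u k.

Definition cross_dev u v : R :=
  \sum_(k < n) (u k - sample_mean u) * (v k - sample_mean v).

Definition s11 x := cross_dev (fst \o x) (fst \o x).
Definition s12 x := cross_dev (fst \o x) (snd \o x).
Definition s22 x := cross_dev (snd \o x) (snd \o x).
Definition corr x : R := s12 x / Num.sqrt (s11 x * s22 x).

End statistics.

(* Parameters are tuples (mu1, mu2, sigma1, sigma2, rho). *)
Section posterior.
Context {R : realType} {n : nat}.
Local Notation params := (R * R * R * R * R)%type.
Local Notation leb := (@lebesgue_measure R).
Implicit Types (p : params) (x : 'I_n -> R * R) (a b : R).

Definition param_space : set params :=
  [set p | let: (_, _, s1, s2, rho) := p in [/\ 0 < s1, 0 < s2 & `|rho| < 1]].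

Definition theta1 p : R := let: (_, _, s1, s2, rho) := p in rho * s2 / s1.

Definition prior a b p : R :=
  let: (_, _, s1, s2, rho) := p in
  (s1 `^ (3 - a) * s2 `^ (2 - b) * (1 - rho ^+ 2) `^ (2 - b / 2))^-1.

Definition likelihood x p : R :=
  let: (m1, m2, s1, s2, rho) := p in
  \prod_(k < n) bvn_pdf (m1, m2) (cov_mx s1 s2 rho) (x k).

Definition unnormalized_posterior a b x (A : set params) : \bar R :=
  (\int[leb \x leb \x leb \x leb \x leb]_(p in A `&` param_space)
     (likelihood x p * prior a b p)%:E)%E.

(* When the normalizing constant is 0 or +oo the quotient is 0 on every set,
   so the posterior is a probability only if it is proper. *)
Definition posterior a b x (A : set params) : \bar R :=
  (unnormalized_posterior a b x A / unnormalized_posterior a b x setT)%E.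

Definition posterior_theta1 a b x (B : set R) : \bar R :=
  posterior a b x (theta1 @^-1` B).

End posterior.

Section chi_squared.
Context {R : realType}.

Definition Gamma_fun (s : R) : R :=
  \int[lebesgue_measure]_(t in `]0, +oo[) (t `^ (s - 1) * expR (- t)).

(* The number m of degrees of freedom is an arbitrary positive real. *)
Definition chi2_pdf (m x : R) : R :=
  ((fun t => t `^ (m / 2 - 1) * expR (- t / 2) / (2 `^ (m / 2) * Gamma_fun (m / 2)))
     \_ `]0, +oo[) x.

Lemma Gamma_fun_ge0 s : 0 <= Gamma_fun s.
Proof.
by apply: Rintegral_ge0 => t _; rewrite mulr_ge0 ?powR_ge0 ?expR_ge0.
Qed.

Lemma chi2_pdf_ge0 m x : 0 <= chi2_pdf m x.
Proof.
apply: restrict_ge0 => {}x _.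
by rewrite divr_ge0 ?mulr_ge0 ?powR_ge0 ?expR_ge0 ?Gamma_fun_ge0.
Qed.

Lemma measurable_chi2_pdf m : measurable_fun [set: R] (chi2_pdf m).
Proof.
apply/measurable_restrict => //; apply: measurable_funTS.
apply: measurable_funM => //; apply: measurable_funM.
  exact: measurable_powR.
apply: measurableT_comp => //; apply: measurable_funM => //.
Qed.

Definition chi2_prob (m : R) (A : set R) : \bar R :=
  (\int[lebesgue_measure]_(x in A) (chi2_pdf m x)%:E)%E.

End chi_squared.

Section chi2_measure.
Context {R : realType}.
Variable m : R.

Let chi2_0 : chi2_prob m set0 = 0%E.
Proof. by rewrite /chi2_prob integral_set0. Qed.

Let chi2_ge0 A : (0 <= chi2_prob m A)%E.
Proof. by apply: integral_ge0 => x _; rewrite lee_fin chi2_pdf_ge0. Qed.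

Let chi2_sigma_additive : semi_sigma_additive (chi2_prob m).
Proof.
move=> /= F mF tF mUF; rewrite /chi2_prob; apply: cvg_toP.
  apply: ereal_nondecreasing_is_cvgn => i j ij.
  apply: lee_sum_nneg_natr => // k _ _; apply: integral_ge0 => /= x Fkx.
  by rewrite lee_fin chi2_pdf_ge0.
rewrite ge0_integral_bigcup//=.
- apply/measurable_funTS/measurableT_comp => //.
  exact: measurable_chi2_pdf.
- by move=> x _; rewrite lee_fin chi2_pdf_ge0.
Qed.

HB.instance Definition _ := isMeasure.Build _ _ _
  (chi2_prob m) chi2_0 chi2_ge0 chi2_sigma_additive.

End chi2_measure.

Section starred_laws.
Context {R : realType}.

(* Joint law of (chi^2_m, Z), Z standard normal and independent of chi^2_m. *)
Definition chi2_normal_prob (m : R) : set (R * R) -> \bar R :=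
  (chi2_prob m \x normal_prob (0 : R) 1)%E.

Definition student_prob (m : R) : set R -> \bar R :=
  pushforward (chi2_normal_prob m) (fun w : R * R => w.2 / Num.sqrt (w.1 / m)).

Definition theta1_star {n : nat} (x : 'I_n -> R * R) (w : R * R) : R :=
  corr x * Num.sqrt (s22 x) / Num.sqrt (s11 x)
  - w.2 / Num.sqrt w.1
    * (Num.sqrt (1 - corr x ^+ 2) * Num.sqrt (s22 x) / Num.sqrt (s11 x)).

Definition theta1_star_prob {n : nat} (b : R) (x : 'I_n -> R * R) : set R -> \bar R :=
  pushforward (chi2_normal_prob (n%:R - b)) (theta1_star x).

Definition quantile (mu : set R -> \bar R) (beta : R) : R :=
  inf [set q : R | (beta%:E <= mu `]-oo, q]%classic)%E].

End starred_laws.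

(* Main.v *)
(* (b) Standardize each observation by X = (m1 + s1 g, m2 + rho s2 g + tau e), tau = s2 sqrt (1 - rho^2).
   Adding the observations one at a time and rotating the running mean against the new point (Helmert)
   shows that the scatter matrix of (g, e) is a sum of n - 1 independent rank-one terms, and Bartlett's
   decomposition writes its entries as (A, sqrt A z, v + z^2) with A, z, v independent chi^2_(n-1),
   N(0, 1), chi^2_(n-2). Since theta1_star is an affine function, with nonnegative slope, of
   Z / sqrt (chi^2_(n-b)) (up to sign), with q the 1 - alpha quantile of that ratio the event
   theta1 < (theta1_star)_(1 - alpha) becomes - z < q sqrt v, whose probability only involves the
   distribution function of Z / sqrt (chi^2_m) for m = n - 2. For q > 0 this function is strictly
   increasing in m, because the chi^2 densities cross exactly once; hence b = 2 unless alpha = 1/2,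
   where the quantile is 0 for every m.
   (a) Integrate the two means out of the likelihood times the prior, substitute tau for sigma_2 and
   theta = rho sigma_2 / sigma_1 for rho: the integrand factors into a function of sigma_1 and one of
   (tau, theta). Given tau, theta is normal around s12 / s11, and 1 / tau^2 is a multiple of
   chi^2_(n-b). *)

Require Import Defs.
From HB Require Import structures.
From mathcomp Require Import all_boot all_order all_algebra.
From mathcomp Require Import all_classical all_reals all_analysis.
From mathcomp Require Import measurable_realfun ring lra.

Set Implicit Arguments.
Unset Strict Implicit.
Unset Printing Implicit Defensive.

Import Order.TTheory GRing.Theory Num.Theory.
Import numFieldNormedType.Exports.

Local Open Scope classical_set_scope.
Local Open Scope ring_scope.

(** In (b), laws are described by the integrals of all nonnegative measurable functions: an identity
    in law is an equality of iterated integrals in the extended reals, and Tonelli's theorem applies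
    without integrability conditions. One-dimensional changes of variables all come from the
    uniqueness of Lebesgue measure, which reduces them to half-open intervals. Normalizing constants
    are not evaluated: when two expressions are proportional with a factor independent of the test
    function or set, the factor is fixed by total mass. Thus neither Gamma(1/2), nor a Beta
    integral, nor the posterior constant is computed; the Gamma integral only has to be positive and
    finite. Since x / 0 and the root of a negative number are 0, [theta1_star] makes sense for
    degenerate samples; its quantile formula is proved for them too, which spares an almost-sure
    argument in (b). In (a) the exponent of 1 - rho^2 in the prior is such that, for every b, the
    powers of sqrt (1 - rho^2) collapse to the Jacobian of rho / sqrt (1 - rho^2). *)

(** * Images of measures with a density *)

Section transport.
Context d1 d2 (X : measurableType d1) (Y : measurableType d2) (R : realType).
Variables (mu : {measure set X -> \bar R}) (h : X -> R) (phi : X -> Y).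
Hypotheses (mh : measurable_fun setT h) (h0 : forall x, 0 <= h x).
Hypothesis mphi : measurable_fun setT phi.
Local Open Scope ereal_scope.

(** The image under [phi] of the measure with density [h] with respect to [mu]. It is packed as a
    measure so that uniqueness theorems for measures apply to it. *)
Definition transport (A : set Y) : \bar R := \int[mu]_x ((h x)%:E * (\1_A (phi x))%:E).

Let mI (A : set Y) : measurable A -> measurable_fun setT (fun x => (\1_A (phi x))%:E : \bar R).
Proof.
move=> mA; apply/measurable_EFinP.
by apply: (measurableT_comp (f := \1_A : Y -> R)) => //; exact: measurable_indic.
Qed.

Let transport0 : transport set0 = 0.
Proof. by apply: integral0_eq => x _; rewrite indic0 mule0. Qed.

Let transport_ge0 A : 0 <= transport A.
Proof. by apply: integral_ge0 => x _; by rewrite mule_ge0// lee_fin. Qed.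

Let transport_sigma_additive : semi_sigma_additive transport.
Proof.
move=> /= F mF tF mUF; rewrite /transport.
apply: cvg_toP.
  apply: ereal_nondecreasing_is_cvgn => i j ij.
  by apply: lee_sum_nneg_natr => // k _ _; exact: transport_ge0.
rewrite -integral_nneseries//; last 2 first.
  by move=> n; apply: emeasurable_funM; first exact/measurable_EFinP; exact: mI.
  by move=> n x _; by rewrite mule_ge0// lee_fin.
apply: eq_integral => x _.
rewrite nneseriesZl//.
congr (_ * _).
have := @measure_semi_bigcup _ _ _ (@dirac _ Y (phi x) R) F mF tF mUF.
by move=> H; exact/esym/H.
Qed.

Let transport_isMeasure := isMeasure.Build _ _ _
  transport transport0 transport_ge0 transport_sigma_additive.

Definition transport_measure : {measure set Y -> \bar R} :=
  HB.pack transport transport_isMeasure.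

Import HBNNSimple.

(** Indicators, then simple functions, then monotone limits. Any measure [nu] with the right values
    on measurable sets is allowed: with [phi] the identity this is the density formula, with [nu]
    the Lebesgue measure a substitution rule. *)
Lemma integral_transport (nu : {measure set Y -> \bar R}) :
  (forall A, measurable A -> nu A = transport A) ->
  forall f : Y -> \bar R, measurable_fun setT f -> (forall y, 0 <= f y) ->
  \int[nu]_y f y = \int[mu]_x ((h x)%:E * f (phi x)).
Proof.
move=> nuE f mf f0.
pose g := nnsfun_approx measurableT mf.
have gE y : f y = limn (fun n => (g n y)%:E).
  by apply/esym/cvg_lim => //; exact: cvg_nnsfun_approx.
have mg n : measurable_fun setT (fun y => (g n y)%:E).
  exact/measurable_EFinP.
have ndg y a b : (a <= b)%N -> (g a y)%:E <= (g b y)%:E.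
  by move=> ab; rewrite lee_fin; exact/lefP/nd_nnsfun_approx.
have step n : \int[nu]_y (g n y)%:E = \int[mu]_x ((h x)%:E * (g n (phi x))%:E).
  under eq_integral do rewrite fimfunE -fsumEFin//.
  rewrite ge0_integral_fsum//; last 2 first.
    - by move=> r; apply/measurable_EFinP/measurableT_comp.
    - by move=> r y _; rewrite EFinM nnfun_muleindic_ge0.
  under [RHS]eq_integral => x _.
    rewrite fimfunE -fsumEFin// ge0_mule_fsumr; last first.
      by move=> r; rewrite EFinM nnfun_muleindic_ge0.
    over.
  rewrite ge0_integral_fsum//; last 2 first.
    - move=> r; apply: emeasurable_funM; first exact/measurable_EFinP.
      under eq_fun do rewrite EFinM.
      by apply: emeasurable_funM; first exact/measurable_EFinP; exact: mI.
    - move=> r x _; apply: mule_ge0; rewrite ?lee_fin//.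
      by rewrite -lee_fin EFinM nnfun_muleindic_ge0.
  apply: eq_fsbigr => r; rewrite inE => -[y _ yr].
  have r0 : (0 <= r)%R by rewrite -yr.
  under eq_integral do rewrite EFinM.
  rewrite ge0_integralZl_EFin//; last exact/measurable_EFinP.
  rewrite integral_indic// setIT nuE//.
  under [RHS]eq_integral do rewrite EFinM muleCA.
  rewrite ge0_integralZl_EFin//; last 2 first.
    - by move=> x _; by rewrite mule_ge0// lee_fin.
    - by apply: emeasurable_funM; first exact/measurable_EFinP; exact: mI.
under eq_integral do rewrite gE.
rewrite monotone_convergence//; last 2 first.
- by move=> n y _; rewrite lee_fin.
- by move=> y _ a b ab; exact: ndg.
under eq_fun do rewrite step.
rewrite -monotone_convergence//; last 3 first.
- by move=> n; apply: emeasurable_funM; first exact/measurable_EFinP; exact: measurableT_comp (mg n) mphi.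
- by move=> n x _; by rewrite mule_ge0// lee_fin.
- by move=> x _ a b ab; apply: lee_wpmul2l; [rewrite lee_fin|exact: ndg].
apply: eq_integral => x _; rewrite gE.
rewrite limeMl//.
apply: ereal_nondecreasing_is_cvgn => a b ab; exact: ndg.
Qed.

End transport.

(** * Measurability and nonnegativity of explicit integrands *)

Section measurability.
Context d (T : measurableType d) (R : realType).
Implicit Types (f g : T -> R) (F G : T -> \bar R).

(** Writing 1/x as x times the power -1 of x^2 avoids both the sign of x and the discontinuity at 0,
    where both sides are 0. *)
Lemma measurable_invr : measurable_fun [set: R] (fun x : R => x^-1).
Proof.
rewrite (_ : (fun _ => _) = fun x : R => x * (x ^+ 2) `^ (-1)); last first.
  apply/funext => x; rewrite powR_inv1 ?sqr_ge0// expr2 invfM mulrA.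
  by have [->|x0] := eqVneq x 0; rewrite ?invr0 ?mul0r// divff// mul1r.
apply: measurable_funM => //.
by apply: (measurableT_comp (f := fun x : R => x `^ (-1))).
Qed.

Lemma measurable_sqrtr : measurable_fun [set: R] (@Num.sqrt R).
Proof. by apply: nondecreasing_measurable => // x y; exact: ler_wsqrtr. Qed.

(** Domains of integration are mostly encoded as 0/1 factors such as [(0 < x)%R%:R], so that
    integrals run over the whole line. *)
Lemma measurable_ltr_natr f g : measurable_fun setT f -> measurable_fun setT g ->
  measurable_fun setT (fun x => (f x < g x)%R%:R : R).
Proof.
move=> mf mg.
apply: (measurableT_comp (f := fun b : bool => b%:R : R)) => //.
exact: measurable_fun_ltr.
Qed.

Lemma measurable_ler_natr f g : measurable_fun setT f -> measurable_fun setT g ->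
  measurable_fun setT (fun x => (f x <= g x)%R%:R : R).
Proof.
move=> mf mg.
apply: (measurableT_comp (f := fun b : bool => b%:R : R)) => //.
exact: measurable_fun_ler.
Qed.

Lemma measurable_indicT (A : set T) : measurable A ->
  measurable_fun setT (\1_A : T -> R).
Proof. exact: measurable_indic. Qed.

Lemma measurable_EFin f : measurable_fun setT f ->
  measurable_fun setT (fun x => (f x)%:E).
Proof. by move=> mf; apply/measurable_EFinP. Qed.

Lemma measurable_app d' (T' : measurableType d') d'' (T'' : measurableType d'')
  (h : T' -> T'') (f : T -> T') :
  measurable_fun setT h -> measurable_fun setT f ->
  measurable_fun setT (fun x => h (f x)).
Proof. exact: measurableT_comp. Qed.

Lemma measurable_integral d' (T' : measurableType d')
    (m : {sigma_finite_measure set T' -> \bar R}) (F : T -> T' -> \bar R) :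
  measurable_fun setT (fun z : T * T' => F z.1 z.2) ->
  (forall z : T * T', (0 <= F z.1 z.2)%E) ->
  measurable_fun setT (fun x => \int[m]_y F x y)%E.
Proof.
by move=> mF F0; exact: (measurable_fun_fubini_tonelli_F (fun z => F z.1 z.2)).
Qed.

End measurability.

Lemma integral_swap d d' (T : measurableType d) (T' : measurableType d')
    (R : realType) (m : {sigma_finite_measure set T -> \bar R})
    (m' : {sigma_finite_measure set T' -> \bar R}) (F : T -> T' -> \bar R) :
  measurable_fun setT (fun z : T * T' => F z.1 z.2) ->
  (forall x y, (0 <= F x y)%E) ->
  (\int[m]_x \int[m']_y F x y = \int[m']_y \int[m]_x F x y)%E.
Proof.
by move=> mF F0; apply: (fubini_tonelli (fun z : T * T' => F z.1 z.2)) => //= z.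
Qed.

Ltac nonneg := repeat match goal with
  | |- is_true (0%R <= EFin _)%E => rewrite lee_fin
  | |- is_true (0%R <= _ * _)%E => apply: mule_ge0
  | |- is_true (0%R <= integral _ _ _)%E => apply: integral_ge0
  | |- is_true (0 <= _ * _)%R => apply: mulr_ge0
  | |- is_true (0 <= _ + _)%R => apply: addr_ge0
  | |- is_true (0 <= _ ^-1)%R => rewrite invr_ge0
  | |- is_true (0 <= expR _)%R => exact: expR_ge0
  | |- is_true (0 <= _ `^ _)%R => exact: powR_ge0
  | |- is_true (0 <= _ ^+ 2)%R => exact: sqr_ge0
  | |- is_true (0 <= `| _ |)%R => exact: normr_ge0
  | |- is_true (0 <= Num.sqrt _)%R => exact: sqrtr_ge0
  | |- is_true (0 <= _%:R)%R => exact: ler0n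
  | |- is_true (0 <= 1)%R => exact: ler01
  | |- is_true (0 <= normal_pdf _ _ _)%R => exact: normal_pdf_ge0
  | |- is_true (0 <= chi2_pdf _ _)%R => exact: chi2_pdf_ge0
  | |- is_true (0 <= Gamma_fun _)%R => exact: Gamma_fun_ge0
  | |- is_true (0 <= normal_peak _)%R => exact: normal_peak_ge0
  | |- is_true (0 <= indic _ _)%R => rewrite indicE; exact: ler0n
  | |- forall _, _ => intro
  | H : forall x, is_true (0%R <= ?f x)%E |- is_true (0%R <= ?f _)%E => exact: H
  | H : forall x, is_true (0 <= ?f x)%R |- is_true (0 <= ?f _)%R => exact: H
  | H : is_true (0 <= ?x)%R |- is_true (0 <= ?x)%R => exact: H
  | H : is_true (0%R <= ?x)%E |- is_true (0%R <= ?x)%E => exact: H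
  end.

Ltac measurability := repeat match goal with
  | H : measurable_fun _ ?h |- measurable_fun _ ?h => exact: H
  | |- measurable_fun _ (fun _ => ?c) => exact: measurable_cst
  | |- measurable_fun _ (fun x => x) => exact: measurable_id
  | |- measurable_fun _ (fun x => EFin _) => apply: measurable_EFin
  | |- measurable_fun _ (fun x => (_ * _)%E) => apply: emeasurable_funM
  | |- measurable_fun _ (fun x => (_ * _)%R) => apply: measurable_funM
  | |- measurable_fun _ (fun x => (_ - _)%R) => apply: measurable_funB
  | |- measurable_fun _ (fun x => (_ + _)%R) => apply: measurable_funD
  | |- measurable_fun _ (fun x => (- _)%R) => apply: (measurableT_comp (@oppr_measurable _ setT))
  | |- measurable_fun _ (fun x => (_ ^+ _)%R) => apply: measurable_funX
  | |- measurable_fun _ (fun x => (_ ^-1)%R) => apply: (measurable_app (@measurable_invr _))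
  | |- measurable_fun _ (fun x => Num.sqrt _) => apply: (measurable_app (@measurable_sqrtr _))
  | |- measurable_fun _ (fun x => expR _) => apply: (measurable_app (@measurable_expR _))
  | |- measurable_fun _ (fun x => ln _) => apply: (measurable_app (@measurable_ln _))
  | |- measurable_fun _ (fun x => _ `^ _) => apply: (measurable_app (@measurable_powR _ _))
  | |- measurable_fun _ (fun x => `| _ |%R) => apply: (measurable_app (@normr_measurable _ setT))
  | |- measurable_fun _ (fun x => normal_pdf _ _ _) => apply: (measurable_app (@measurable_normal_pdf _ _ _))
  | |- measurable_fun _ (fun x => chi2_pdf _ _) => apply: (measurable_app (@measurable_chi2_pdf _ _))
  | |- measurable_fun _ (fun x => indic _ _) => apply: (measurable_app (measurable_indicT _))
  | |- measurable_fun _ (fun x => (nat_of_bool (_ < _)%R)%:R) => apply: measurable_ltr_natr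
  | |- measurable_fun _ (fun x => (nat_of_bool (_ <= _)%R)%:R) => apply: measurable_ler_natr
  | |- measurable_fun _ (fun x => (_, _)) => apply: measurable_fun_pair
  | |- measurable_fun _ (fun x => fst _) => apply: (measurable_app measurable_fst)
  | |- measurable_fun _ (fun x => snd _) => apply: (measurable_app measurable_snd)
  | |- measurable_fun _ (fun x => \int[_]_y _)%E => apply: measurable_integral; last by nonneg
  | |- measurable_fun _ Num.sqrt => exact: measurable_sqrtr
  | |- measurable_fun _ (@GRing.inv _) => exact: measurable_invr
  | |- measurable_fun _ expR => exact: measurable_expR
  | |- measurable_fun _ (@ln _) => exact: measurable_ln
  | |- measurable_fun _ Num.norm => exact: (@normr_measurable _ setT)
  | |- measurable_fun _ (normal_pdf _ _) => exact: measurable_normal_pdf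
  | |- measurable_fun _ (chi2_pdf _) => exact: measurable_chi2_pdf
  | |- measurable_fun _ fst => exact: measurable_fst
  | |- measurable_fun _ snd => exact: measurable_snd
  | H : measurable_fun _ ?h |- measurable_fun _ (fun x => ?h _) => apply: (measurable_app H)
  end.

(** * Changes of variables on the real line *)

Section substitution.
Variable R : realType.
Local Notation leb := (@lebesgue_measure R).

(** The transported measure gives half-open intervals their length, so it is Lebesgue measure. *)
Lemma lebesgue_transport (h phi : R -> R) :
  measurable_fun setT h -> (forall x, 0 <= h x) -> measurable_fun setT phi ->
  (forall c d : R, (c < d)%R -> \int[leb]_x ((h x)%:E * (\1_(`]c, d]%classic) (phi x))%:E) = (d - c)%:E)%E ->
  forall f : R -> \bar R, measurable_fun setT f -> (forall y, (0 <= f y)%E) ->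
  (\int[leb]_y f y = \int[leb]_x ((h x)%:E * f (phi x)))%E.
Proof.
move=> mh h0 mphi H f mf f0.
apply: (@integral_transport _ _ (measurableTypeR R) (measurableTypeR R) R leb h phi mh h0 mphi leb) => // A mA.
pose nu := @transport_measure _ _ (measurableTypeR R) (measurableTypeR R) R leb h phi mh h0 mphi.
apply: (@lebesgue_measure_unique R nu) => // X /ocitvP[->|[[c d] /= cd ->]]; first by rewrite !measure0.
by rewrite /= /transport [RHS]H// lebesgue_measure_itv/= lte_fin cd.
Qed.

Lemma integral_affine (a b : R) (f : R -> \bar R) : a != 0 ->
  measurable_fun setT f -> (forall y, (0 <= f y)%E) ->
  (\int[leb]_y f y =
   `|a|%:E * \int[leb]_x f (a * x + b)%R)%E.
Proof.
move=> a0 mf f0.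
have mab : measurable_fun setT (fun x : R => a * x + b) by measurability.
rewrite (@lebesgue_transport (fun=> `|a|) (fun x => a * x + b))//; last first.
  move=> c d cd.
  rewrite ge0_integralZl_EFin//; last first.
    apply: measurable_EFin; apply: (measurable_app (h := \1_(`]c, d]) : R -> R)) => //.
  transitivity (`|a|%:E * leb ((fun x : R => (a * x + b)%R) @^-1` `]c, d]%classic))%E.
    congr (_ * _)%E; rewrite -[X in lebesgue_measure X]setIT -integral_indic//.
    by rewrite -[X in measurable X]setTI; exact: mab.
  have [a_gt0|a_lt0|] := ltgtP 0 a; last by move=> e; rewrite -e eqxx in a0.
    rewrite (_ : _ @^-1` _ = `](c - b) / a, (d - b) / a]%classic); last first.
      apply/seteqP; split => x /=; rewrite !in_itv/= => /andP[];
        rewrite ltr_pdivrMr// ler_pdivlMr// [x * a]mulrC ?ltrBlDr ?lerBrDr => -> ->//.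
    rewrite lebesgue_measure_itv/= lte_fin ltr_pM2r ?invr_gt0// ltrD2r cd.
    by rewrite -EFinB -EFinM gtr0_norm//; congr EFin; field.
  (* A negative slope reverses the interval and moves its closed end to the left; the length is
     unaffected. *)
  rewrite (_ : _ @^-1` _ = `[(d - b) / a, (c - b) / a[%classic); last first.
    apply/seteqP; split => x /=; rewrite !in_itv/= => /andP[];
      rewrite ltr_ndivlMr// ler_ndivrMr// [x * a]mulrC ?ltrBlDr ?lerBrDr => -> ->//.
  rewrite lebesgue_measure_itv/= lte_fin ltr_nM2r ?invr_lt0// ltrD2r cd.
  by rewrite -EFinB -EFinM ltr0_norm//; congr EFin; field.
rewrite ge0_integralZl_EFin//.
by apply: (measurable_app mf).
Qed.

Lemma integral_oppr (f : R -> \bar R) :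
  measurable_fun setT f -> (forall y, (0 <= f y)%E) ->
  (\int[leb]_y f y = \int[leb]_x f (- x)%R)%E.
Proof.
move=> mf f0; rewrite (@integral_affine (-1) 0)// ?oppr_eq0 ?oner_eq0//.
rewrite normrN1 mul1e; apply: eq_integral => x _.
by rewrite mulN1r addr0.
Qed.

Lemma integral_shift (b : R) (f : R -> \bar R) :
  measurable_fun setT f -> (forall y, (0 <= f y)%E) ->
  (\int[leb]_y f y = \int[leb]_x f (x + b)%R)%E.
Proof.
move=> mf f0; rewrite (@integral_affine 1 b)// ?oner_eq0//.
rewrite normr1 mul1e; apply: eq_integral => x _.
by rewrite mul1r.
Qed.

(** The length of ]c, d] is the integral of 1/x over ]exp c, exp d], because ln is a primitive of
    1/x. *)
Lemma integral_ln (f : R -> \bar R) :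
  measurable_fun setT f -> (forall y, (0 <= f y)%E) ->
  (\int[leb]_y f y =
   \int[leb]_x (((0 < x)%R%:R / x)%:E * f (ln x)))%E.
Proof.
move=> mf f0.
apply: (lebesgue_transport (h := fun x => (0 < x)%R%:R / x)) => //.
- by measurability.
- by move=> x; case: (ltrP 0 x) => x0; rewrite ?mul0r// mul1r invr_ge0 ltW.
move=> c d cd.
transitivity (\int[leb]_(x in `]expR c, expR d]) (x^-1)%:E)%E.
  rewrite [RHS]integral_mkcond; apply: eq_integral => x _.
  rewrite patchE; case: ifPn => xcd.
    move: xcd; rewrite inE/= in_itv/= => /andP[cx xd].
    have x0 : 0 < x by rewrite (lt_trans _ cx)// expR_gt0.
    rewrite x0 mul1r indicE mem_set ?mule1//= in_itv/=.
    by rewrite -ltr_expR -ler_expR lnK ?posrE// cx xd.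
  case: (ltrP 0 x) => x0; last by rewrite mul0r mul0e.
  rewrite mul1r indicE memNset ?mule0//= in_itv/= => /andP[cx xd].
  move/negP: xcd; apply; rewrite inE/= in_itv/=.
  by rewrite -[x]lnK ?posrE// ltr_expR ler_expR cx xd.
rewrite integral_itv_obnd_cbnd; last first.
  apply: measurable_funTS; measurability.
have ecd : expR c < expR d by rewrite ltr_expR.
have pos x : expR c <= x -> 0 < x.
  by move=> cx; rewrite (lt_le_trans _ cx)// expR_gt0.
rewrite (continuous_FTC2 (F := @ln R) ecd)//.
- by rewrite !expRK.
- apply: continuous_in_subspaceT => x; rewrite inE/= in_itv/= => /andP[cx _].
  by apply: inv_continuous; rewrite gt_eqF// pos.
- split.
  + move=> x; rewrite in_itv/= => /andP[cx _].
    have := @is_derive1_ln R x (pos _ (ltW cx)). by case.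
  + by apply: cvg_at_right_filter; apply: continuous_ln; exact: expR_gt0.
  + by apply: cvg_at_left_filter; apply: continuous_ln; exact: expR_gt0.
- move=> x; rewrite in_itv/= => /andP[cx _].
  have := @is_derive1_ln R x (pos _ (ltW cx)). by case => _ ; rewrite derive1E.
Qed.

Lemma integral_exp (f : R -> \bar R) :
  measurable_fun setT f -> (forall y, (0 <= f y)%E) ->
  (\int[leb]_x ((0 < x)%R%:R%:E * f x) = \int[leb]_y ((expR y)%:E * f (expR y)))%E.
Proof.
move=> mf f0; rewrite [RHS]integral_ln; last 2 first.
- by measurability.
- by nonneg.
apply: eq_integral => x _; case: (ltrP 0 x) => x0; last by rewrite mul0r !mul0e.
by rewrite lnK ?posrE// mul1r muleA -EFinM mulVf ?gt_eqF.
Qed.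

(** Conjugating by the exponential turns x^p into the linear map y -> p y. *)
Lemma integral_power (p : R) (f : R -> \bar R) : p != 0 ->
  measurable_fun setT f -> (forall y, (0 <= f y)%E) ->
  (\int[leb]_x ((0 < x)%R%:R%:E * f x) =
   `|p|%:E * \int[leb]_x ((0 < x)%R%:R%:E * ((x `^ (p - 1))%:E * f (x `^ p)%R)))%E.
Proof.
move=> p0 mf f0; rewrite integral_exp// (@integral_affine p 0)//; last 2 first.
- by measurability.
- by nonneg.
congr (_ * _)%E; rewrite [RHS]integral_exp; last 2 first.
- by measurability.
- by nonneg.
apply: eq_integral => x _; rewrite addr0.
have -> : expR x `^ p = expR (p * x) by rewrite /powR gt_eqF ?expR_gt0// expRK.
rewrite muleA -EFinM; congr ((_%:E) * _)%E.
rewrite /powR gt_eqF ?expR_gt0// expRK -expRD; congr expR; ring.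
Qed.

(** This trades a correlation for the variable rho / sqrt (1 - rho^2). The map [phi] is an
    increasing bijection from ]-1, 1[ to the line, with derivative (1 - x^2)^(-3/2) and inverse
    [psi]. *)
Lemma integral_slope (f : R -> \bar R) :
  measurable_fun setT f -> (forall y, (0 <= f y)%E) ->
  (\int[leb]_y f y =
   \int[leb]_x (((`|x| < 1)%R%:R * (Num.sqrt (1 - x ^+ 2) ^+ 3)^-1)%:E
                 * f (x / Num.sqrt (1 - x ^+ 2))%R))%E.
Proof.
move=> mf f0.
pose h x : R := (`|x| < 1)%R%:R * (Num.sqrt (1 - x ^+ 2) ^+ 3)^-1.
pose phi x : R := x / Num.sqrt (1 - x ^+ 2).
pose psi u : R := u / Num.sqrt (1 + u ^+ 2).
have psiK u : phi (psi u) = u.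
  have u0 : 0 < 1 + u ^+ 2 by rewrite ltr_pwDl// sqr_ge0.
  have s0 : Num.sqrt (1 + u ^+ 2) != 0 by rewrite gt_eqF// sqrtr_gt0.
  rewrite /phi /psi.
  have -> : 1 - (u / Num.sqrt (1 + u ^+ 2)) ^+ 2 = (1 + u ^+ 2)^-1.
    by rewrite expr_div_n sqr_sqrtr ?ltW//; field; rewrite gt_eqF.
  by rewrite sqrtrV ?ltW// invrK divfK.
have psi1 u : `|psi u| < 1.
  have u0 : 0 < 1 + u ^+ 2 by rewrite ltr_pwDl// sqr_ge0.
  rewrite /psi normrM normfV (ger0_norm (sqrtr_ge0 _)) ltr_pdivrMr ?sqrtr_gt0// mul1r.
  by rewrite -sqrtr_sqr ltr_sqrt// ltrDr.
have phiP (x : R) : `|x| < 1 -> 0 < 1 - x ^+ 2.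
  by move=> x1; rewrite subr_gt0 -real_normK ?num_real// expr_lt1.
have dphi (x : R) : `|x| < 1 -> is_derive x 1 phi (Num.sqrt (1 - x ^+ 2) ^+ 3)^-1.
  move=> /phiP x1; rewrite /phi.
  have s0 : Num.sqrt (1 - x ^+ 2) != 0 by rewrite gt_eqF// sqrtr_gt0.
  have d1 : is_derive x 1 (fun x : R => 1 - x ^+ 2) (- (2 * x)).
    by apply: is_derive_eq; rewrite ?scaler0 ?add0r/= /GRing.scale/=; ring.
  have d2 := @is_derive1_comp _ Num.sqrt (fun x : R => 1 - x ^+ 2) x _ _ (is_derive1_sqrt x1) d1.
  have d3 := @is_deriveV _ (Num.sqrt \o (fun x : R => 1 - x ^+ 2)) x _ 1 s0 d2.
  have d4 := @is_deriveM _ _ id _ x 1 _ _ (is_derive_id x 1) d3.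
  apply: (is_derive_eq d4); rewrite /GRing.scale/=.
  have e : Num.sqrt (1 - x ^+ 2) ^+ 2 = 1 - x ^+ 2 by rewrite sqr_sqrtr ?ltW.
  transitivity ((Num.sqrt (1 - x ^+ 2) ^+ 2 + x ^+ 2) / Num.sqrt (1 - x ^+ 2) ^+ 3).
    move: s0; set s := Num.sqrt _; move=> s0.
    by field.
  by rewrite e subrK mul1r.
have phiN x : phi (- x) = - phi x by rewrite /phi sqrrN mulNr.
(* For nonnegative arguments the numerator grows and the denominator shrinks; oddness of [phi] gives
   the other signs. *)
have phi_lt_pos x y : 0 <= x -> y < 1 -> x < y -> phi x < phi y.
  move=> x0 y1 xy; have y0 : 0 < y by rewrite (le_lt_trans x0).
  have sy : 0 < 1 - y ^+ 2 by apply: phiP; rewrite gtr0_norm.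
  have sxy : 1 - y ^+ 2 < 1 - x ^+ 2.
    by rewrite ltrD2l ltrN2 ltr_pXn2r ?nnegrE// ltW.
  have sx : 0 < 1 - x ^+ 2 by rewrite (lt_trans sy).
  rewrite /phi ltr_pdivrMr ?sqrtr_gt0// (lt_le_trans xy)// mulrAC.
  by rewrite ler_pdivlMr ?sqrtr_gt0// ler_pM2l// ler_wsqrtr// ltW.
have phi_lt x y : `|x| < 1 -> `|y| < 1 -> x < y -> phi x < phi y.
  rewrite !ltr_norml => /andP[Nx x1] /andP[Ny y1] xy.
  have [x0|x0] := leP 0 x; first exact: phi_lt_pos.
  have [y0|y0] := leP y 0.
    by rewrite -ltrN2 -!phiN; apply: phi_lt_pos; rewrite ?oppr_ge0// ?ltrN2// ltrNl.
  apply: (@lt_trans _ _ 0).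
    have := phi_lt_pos 0 (- x) (lexx _).
    by rewrite phiN {1}/phi mul0r oppr_gt0 oppr_gt0 => ->//; rewrite ltrNl.
  by have := phi_lt_pos 0 y (lexx _); rewrite {1}/phi mul0r => ->.
have phi_le x y : `|x| < 1 -> `|y| < 1 -> (phi x <= phi y) = (x <= y).
  move=> x1 y1; have [xy|yx|->] := ltgtP x y; last by rewrite lexx.
    by rewrite ltW// phi_lt.
  by rewrite leNgt phi_lt.
apply: (lebesgue_transport (h := h) (phi := phi)) => //.
- by rewrite /h; measurability.
- by move=> x; rewrite /h; nonneg.
- by rewrite /phi; measurability.
move=> c d cd.
have pcd : psi c < psi d by rewrite ltNge -phi_le// !psiK -ltNge.
have inI (x : R) : psi c <= x -> x <= psi d -> `|x| < 1.
  move=> cx xd; have := psi1 c; have := psi1 d.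
  rewrite !ltr_norml => /andP[_ d1] /andP[c1 _].
  by rewrite (lt_le_trans c1 cx) (le_lt_trans xd d1).
transitivity (\int[leb]_(x in `]psi c, psi d]) (Num.sqrt (1 - x ^+ 2) ^+ 3)^-1%:E)%E.
  rewrite [RHS]integral_mkcond; apply: eq_integral => x _.
  rewrite patchE; case: ifPn => xcd.
    move: xcd; rewrite inE/= in_itv/= => /andP[cx xd].
    have x1 := inI _ (ltW cx) xd.
    rewrite /h x1 mul1r indicE mem_set ?mule1//= in_itv/=.
    by rewrite -{1}(psiK c) -(psiK d) phi_le// xd andbT ltNge phi_le// -ltNge.
  rewrite /h; case: (ltrP `|x| 1) => x1; last by rewrite mul0r mul0e.
  rewrite indicE memNset ?mule0//= in_itv/= => /andP[cx xd].
  move/negP: xcd; apply; rewrite inE/= in_itv/=.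
  by rewrite -(phi_le _ (psi d))// psiK xd andbT ltNge -phi_le// psiK -ltNge.
have cphi x : `|x| < 1 -> {for x, continuous phi}.
  move=> /dphi[dx _]; apply: differentiable_continuous.
  exact/derivable1_diffP.
rewrite integral_itv_obnd_cbnd; last by apply: measurable_funTS; measurability.
rewrite (continuous_FTC2 (F := phi) pcd)//.
- by rewrite !psiK.
- apply: continuous_in_subspaceT => x; rewrite inE/= in_itv/= => /andP[cx xd].
  have x1 := phiP _ (inI _ cx xd).
  apply: (@continuous_comp _ _ _ (fun x : R => Num.sqrt (1 - x ^+ 2) ^+ 3) (fun x => x^-1)).
    apply: (@continuous_comp _ _ _ (fun x : R => Num.sqrt (1 - x ^+ 2)) (fun x => x ^+ 3)).
      apply: (@continuous_comp _ _ _ (fun x : R => (1 - x ^+ 2)) Num.sqrt).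
        apply: cvgB; first exact: cvg_cst.
        exact: exprn_continuous.
      exact: sqrt_continuous.
    exact: exprn_continuous.
  apply: inv_continuous; rewrite expf_neq0// gt_eqF// sqrtr_gt0//.
- split.
  + move=> x; rewrite in_itv/= => /andP[cx xd].
    by have [] := dphi _ (inI _ (ltW cx) (ltW xd)).
  + by apply: cvg_at_right_filter; exact: cphi.
  + by apply: cvg_at_left_filter; exact: cphi.
- move=> x; rewrite in_itv/= => /andP[cx xd].
  by have [_] := dphi _ (inI _ (ltW cx) (ltW xd)); rewrite derive1E.
Qed.

End substitution.

(** * The Gamma integral and the chi-squared measures *)

Section chi2.
Variable R : realType.
Local Notation leb := (@lebesgue_measure R).
Local Notation N := (@normal_prob R 0 1).

Lemma integral_indic_mul (h : R -> R) (A : set R) :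
  (\int[leb]_(x in A) (h x)%:E = \int[leb]_x ((h x)%:E * (\1_A x)%:E))%E.
Proof.
rewrite integral_mkcond; apply: eq_integral => x _; rewrite patchE indicE.
by case: ifPn => xA; rewrite ?mule1 ?mule0.
Qed.

Lemma integral_normal (f : R -> \bar R) :
  measurable_fun setT f -> (forall x, 0 <= f x)%E ->
  (\int[N]_x f x = \int[leb]_x ((normal_pdf 0 1 x)%:E * f x))%E.
Proof.
move=> mf f0.
apply: (@integral_transport _ _ (measurableTypeR R) (measurableTypeR R) R
  leb (normal_pdf 0 1) id (measurable_normal_pdf _ _) (normal_pdf_ge0 _ _)
  (@measurable_id _ _ setT) N) => // A mA.
exact: integral_indic_mul.
Qed.

Lemma integral_chi2 (m : R) (f : R -> \bar R) :
  measurable_fun setT f -> (forall x, 0 <= f x)%E ->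
  (\int[chi2_prob m]_x f x = \int[leb]_x ((chi2_pdf m x)%:E * f x))%E.
Proof.
move=> mf f0.
apply: (@integral_transport _ _ (measurableTypeR R) R R
  leb (chi2_pdf m) id (measurable_chi2_pdf _) (chi2_pdf_ge0 _)
  (@measurable_id _ _ setT) (chi2_prob m)) => // A mA.
exact: integral_indic_mul.
Qed.

Lemma chi2_pdfE (m x : R) : chi2_pdf m x =
  (0 < x)%R%:R * (x `^ (m / 2 - 1) * expR (- x / 2)) / (2 `^ (m / 2) * Gamma_fun (m / 2)).
Proof.
rewrite /chi2_pdf patchE mem_setE in_itv/= andbT.
by case: ifPn => _; rewrite ?mul1r// !mul0r.
Qed.

(** The extended-real value behind [Gamma_fun]: it keeps divergence visible, whereas [fine] sends an
    infinite value to 0. *)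
Definition Gamma_integral (s : R) : \bar R :=
  (\int[leb]_x ((0 < x)%R%:R%:E * (x `^ (s - 1) * expR (- x))%:E))%E.

Lemma Gamma_funE s : Gamma_fun s = fine (Gamma_integral s).
Proof.
rewrite /Gamma_fun /Rintegral; congr fine.
rewrite integral_mkcond; apply: eq_integral => x _.
rewrite patchE mem_setE in_itv/= andbT.
by case: ifPn => _; rewrite ?mul1e ?mul0e.
Qed.

Lemma Gamma_integral_scale s :
  (\int[leb]_x ((0 < x)%R%:R%:E * (x `^ (s - 1) * expR (- x / 2))%:E) =
   (2 `^ s)%:E * Gamma_integral s)%E.
Proof.
rewrite (@integral_affine R 2 0); [|by rewrite pnatr_eq0|by measurability|by nonneg].
rewrite /Gamma_integral -ge0_integralZl_EFin; [|exact: measurableT|by nonneg|by measurability|by nonneg].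
rewrite -ge0_integralZl_EFin; [|exact: measurableT|by nonneg|by measurability|by nonneg].
apply: eq_integral => x _; rewrite addr0 pmulr_rgt0//.
case: (ltrP 0 x) => x0; last by rewrite !mul0e !mule0.
rewrite !mul1e -!EFinM powRM// ?ltW// ger0_norm//.
rewrite (_ : - (2 * x) / 2 = - x); last by field.
have -> : 2 `^ s = 2 * 2 `^ (s - 1) :> R.
  by rewrite -[in LHS](subrK 1 s) powRD ?pnatr_eq0 ?implybT// powRr1// mulrC.
by congr EFin; ring.
Qed.

(** If [Gamma_fun] is 0 the density vanishes, its denominator being 0; otherwise the Gamma integral
    is finite and the mass is 1. Either way the mass is finite, so [chi2_prob m] is a finite measure
    for every real m and Tonelli applies to it unconditionally. *)
Lemma chi2_prob_setT_ratio m : chi2_prob m setT =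
  (if Gamma_fun (m / 2) == 0%R then 0 else 1 : \bar R)%E.
Proof.
rewrite /chi2_prob; under eq_integral do rewrite chi2_pdfE.
case: ifPn => [/eqP ->|G0].
  by apply: integral0_eq => x _; rewrite mulr0 invr0 mulr0.
have GE : Gamma_integral (m / 2) = (Gamma_fun (m / 2))%:E.
  rewrite Gamma_funE fineK//; move: G0; rewrite Gamma_funE.
  by case: Gamma_integral => //=; rewrite eqxx.
under eq_integral do rewrite mulrC EFinM EFinM.
rewrite ge0_integralZl_EFin; [|exact: measurableT|by nonneg|by measurability|]; last first.
  by rewrite invr_ge0 mulr_ge0 ?powR_ge0// Gamma_fun_ge0.
by rewrite Gamma_integral_scale GE -!EFinM mulVf// mulf_neq0.
Qed.

Lemma chi2_prob_fin_num m : fin_num_fun (chi2_prob m : set R -> \bar R).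
Proof.
move=> A mA; rewrite ge0_fin_numE//.
rewrite (@le_lt_trans _ _ (chi2_prob m setT))//.
  by apply: le_measure; rewrite ?inE.
by rewrite chi2_prob_setT_ratio; case: ifP; rewrite ltry.
Qed.

HB.instance Definition _ m :=
  Measure_isFinite.Build _ _ _ (chi2_prob m) (chi2_prob_fin_num m).

(** A zero integral would make [f] vanish almost everywhere, yet ]c, d[ has positive length. *)
Lemma integral_gt0 (f : R -> \bar R) (c d : R) : c < d ->
  measurable_fun setT f -> (forall x, 0 <= f x)%E ->
  (forall x, (c < x < d)%R -> (0 < f x)%E) -> (0 < \int[leb]_x f x)%E.
Proof.
move=> cd mf f0 fpos; rewrite lt0e integral_ge0// andbT; apply/eqP => I0.
have If0 : (\int[leb]_x `|f x|)%E = 0%E.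
  by under eq_integral do rewrite gee0_abs//.
have [A [mA A0 fA]] := (@ae_eq_integral_abs _ (measurableTypeR R) R leb setT measurableT f mf).1 If0.
have : (leb `]c, d[ <= leb A)%E.
  apply: le_measure; rewrite ?inE// => x; rewrite /= in_itv/= => xcd.
  by apply: fA => /= /(_ I) fx0; have := fpos x xcd; rewrite fx0 ltxx.
by rewrite A0 lebesgue_measure_itv/= lte_fin cd -EFinB lee_fin subr_le0 leNgt cd.
Qed.

Lemma Gamma_integral_gt0 s : (0 < Gamma_integral s)%E.
Proof.
apply: (@integral_gt0 _ 0 1) => //; first by measurability.
  by nonneg.
by move=> x /andP[x0 _]; rewrite x0 mul1e lte_fin mulr_gt0 ?powR_gt0 ?expR_gt0.
Qed.

(** The inequality x / p <= exp (x / p), raised to the power p. *)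
Lemma powR_expR_le (p x : R) : 0 < p -> 0 < x -> x `^ p <= p `^ p * expR x.
Proof.
move=> p0 x0.
have h : x / p <= expR (x / p).
  by rewrite (le_trans _ (expR_ge1Dx _))// lerDr.
have -> : x `^ p = p `^ p * (x / p) `^ p.
  by rewrite -powRM ?divr_ge0 ?ltW// mulrC divfK// gt_eqF.
rewrite ler_pM2l ?powR_gt0//.
have -> : expR x = expR (x / p) `^ p.
  by rewrite /powR gt_eqF ?expR_gt0// expRK mulrC divfK// gt_eqF.
by apply: ge0_ler_powR; rewrite ?nnegrE ?expR_ge0 ?divr_ge0// ltW.
Qed.

(** The integrand is at most x^(s - 1) for x < 1 and C x^(-2) for x >= 1. Both bounds are multiples
    of x^(p - 1), with p = s and p = -1, so the power substitution compares their integrals with the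
    length of ]0, 2[; the end 2 leaves room for x = 1. *)
Lemma Gamma_integral_lty (s : R) : 0 < s -> (Gamma_integral s < +oo :> \bar R)%E.
Proof.
move=> s0.
pose J (p : R) := (\int[leb]_x ((0 < x)%R%:R%:E * ((x `^ (p - 1))%:E * (x `^ p < 2)%R%:R%:E)))%E.
have Jlt (p : R) : p != 0 -> (J p < +oo)%E.
  move=> p0.
  have : (\int[leb]_x ((0 < x)%R%:R%:E * (x < 2)%R%:R%:E) = 2%:E)%E.
    transitivity (leb `]0, 2[%classic).
      rewrite -[X in leb X]setIT -integral_indic//.
      apply: eq_integral => x _; rewrite indicE mem_setE in_itv/=.
      by case: (ltrP 0 x) => _; rewrite ?mul1e ?mul0e.
    by rewrite lebesgue_measure_itv/= lte_fin ltr0n sube0.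
  rewrite (@integral_power _ p); [|exact: p0|by measurability|by nonneg].
  rewrite -/(J p); case: (J p) => [r _| |//]; rewrite ?ltry//.
  by rewrite gt0_muley// lte_fin normr_gt0.
(* The constant of [powR_expR_le] with exponent s + 1, that is x^(s - 1) exp (- x) <= C x^(-2). *)
pose C : R := (s + 1) `^ (s + 1).
have C0 : 0 <= C by exact: powR_ge0.
apply: (@le_lt_trans _ _ (J s + C%:E * J (-1)%R)%E); last first.
  apply: lte_add_pinfty; first by rewrite Jlt// gt_eqF.
  by rewrite lte_mul_pinfty//; last by rewrite Jlt// oppr_eq0 oner_eq0.
rewrite /J -ge0_integralZl_EFin; [|exact: measurableT|by nonneg|by measurability|exact: C0].
rewrite -ge0_integralD; [|exact: measurableT|by nonneg|by measurability|by nonneg|by measurability].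
apply: ge0_le_integral; [exact: measurableT|by nonneg|by measurability| |].
  by apply: emeasurable_funD; measurability.
move=> x _; case: (ltrP 0 x) => x0; last by rewrite !mul0e mule0 adde0.
rewrite !mul1e; have [x1|x1] := leP 1 x.
  rewrite -!EFinM -EFinD lee_fin.
  apply: (@le_trans _ _ (C * (x `^ (-1 - 1) * (x `^ (-1) < 2)%R%:R))); last first.
    by rewrite lerDr; nonneg.
  have -> : x `^ (-1) < 2.
    by rewrite powR_inv1 ?ltW// (@le_lt_trans _ _ 1) ?ltr1n// invf_le1.
  rewrite mulr1 (_ : s - 1 = (s + 1) + (-1 - 1)); last by ring.
  rewrite powRD; last by rewrite (gt_eqF x0) implybT.
  have := powR_expR_le (addr_gt0 s0 ltr01) x0; rewrite -/C => h.
  rewrite mulrAC ler_wpM2r ?powR_ge0//.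
  by rewrite expRN ler_pdivrMr ?expR_gt0.
have -> : x `^ s < 2.
  rewrite (@le_lt_trans _ _ 1) ?ltr1n//.
  have <- : 1 `^ s = 1 by rewrite /powR oner_eq0 ln1 mulr0 expR0.
  by apply: ge0_ler_powR; rewrite ?nnegrE// ltW.
rewrite -!EFinM -EFinD lee_fin mulr1.
apply: (@le_trans _ _ (x `^ (s - 1))); last by rewrite lerDl; nonneg.
by rewrite ler_piMr ?powR_ge0// -expR0 ler_expR oppr_le0 ltW.
Qed.

Lemma Gamma_fun_gt0 (s : R) : 0 < s -> 0 < Gamma_fun s.
Proof.
move=> s0; rewrite Gamma_funE fine_gt0// Gamma_integral_gt0.
exact: Gamma_integral_lty.
Qed.

Lemma chi2_prob_setT (m : R) : 0 < m -> chi2_prob m setT = 1%E.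
Proof.
by move=> m0; rewrite chi2_prob_setT_ratio gt_eqF// Gamma_fun_gt0// divr_gt0.
Qed.

Lemma chi2_pdf_gt0 (m x : R) : 0 < m -> 0 < x -> 0 < chi2_pdf m x.
Proof.
move=> m0 x0; rewrite chi2_pdfE x0 mul1r divr_gt0 ?mulr_gt0 ?expR_gt0 ?powR_gt0//.
by rewrite Gamma_fun_gt0// divr_gt0.
Qed.

Lemma chi2_pdf_le0 (m x : R) : x <= 0 -> chi2_pdf m x = 0.
Proof. by move=> x0; rewrite chi2_pdfE ltNge x0 !mul0r. Qed.

Lemma integral_chi2_pdf (m : R) : 0 < m -> (\int[leb]_x (chi2_pdf m x)%:E = 1)%E.
Proof. by move=> m0; rewrite -[RHS](chi2_prob_setT m0). Qed.

End chi2.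

Local Opaque chi2_prob normal_prob lebesgue_measure.

(** * Rotations of normal pairs and sums of squares *)

Section normal_chi2.
Variable R : realType.
Local Notation leb := (@lebesgue_measure R).
Local Notation N := (@normal_prob R 0 1).

Lemma std_normal_pdfE (x : R) :
  normal_pdf 0 1 x = normal_peak 1 * expR (- x ^+ 2 / 2).
Proof.
rewrite normal_pdfE ?oner_eq0// /normal_fun subr0 expr1n.
by rewrite -mulr_natr mul1r.
Qed.

Lemma std_normal_pdfN (x : R) : normal_pdf 0 1 (- x) = normal_pdf 0 1 x :> R.
Proof. by rewrite !std_normal_pdfE sqrrN. Qed.

Lemma integral_normal_cst (c : \bar R) : (\int[N]_x c = c)%E.
Proof.
rewrite integral_cst//; transitivity (c * 1)%E; last by rewrite mule1.
by congr (_ * _)%E; exact: probability_setT.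
Qed.

Lemma integral_chi2_cst (m : R) (c : \bar R) : 0 < m ->
  (\int[chi2_prob m]_x c = c)%E.
Proof.
move=> m0; rewrite integral_cst//; transitivity (c * 1)%E; last by rewrite mule1.
by congr (_ * _)%E; exact: chi2_prob_setT.
Qed.

Lemma integral_normalN (f : R -> \bar R) :
  measurable_fun setT f -> (forall x, 0 <= f x)%E ->
  (\int[N]_x f (- x)%R = \int[N]_x f x)%E.
Proof.
move=> mf f0; rewrite !integral_normal; [|by []|by []|by measurability|by nonneg].
rewrite [RHS]integral_oppr; [|by measurability|by nonneg].
by apply: eq_integral => x _; rewrite std_normal_pdfN.
Qed.

Lemma integral_normal2 (F : R * R -> \bar R) :
  measurable_fun setT F -> (forall z, 0 <= F z)%E ->
  (\int[N]_x \int[N]_y F (x, y) =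
   \int[leb]_x \int[leb]_y ((normal_pdf 0 1 x * normal_pdf 0 1 y)%:E * F (x, y)))%E.
Proof.
move=> mF F0; rewrite integral_normal; [|by measurability|by nonneg].
apply: eq_integral => x _; rewrite integral_normal; [|by measurability|by nonneg].
rewrite -ge0_integralZl_EFin; [|exact: measurableT|by nonneg|by measurability|by nonneg].
by apply: eq_integral => y _; rewrite EFinM muleA.
Qed.

(** A rotation with c != 0 is a composition of two substitutions, each changing one coordinate with
    the other fixed; their Jacobians |c| and 1/|c| cancel. For c = 0 it is an exchange of the
    coordinates with one sign change. *)
Lemma integral_rotation (c s : R) (G : R * R -> \bar R) : c ^+ 2 + s ^+ 2 = 1 ->
  measurable_fun setT G -> (forall z, 0 <= G z)%E ->
  (\int[leb]_x \int[leb]_y G (c * x + s * y, - s * x + c * y)%R =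
   \int[leb]_x \int[leb]_y G (x, y))%E.
Proof.
move=> cs mG G0; have [c0|c0] := eqVneq c 0.
  have /eqP : s ^+ 2 = 1 by rewrite -cs c0 expr0n add0r.
  rewrite sqrf_eq1 c0 => /orP[] /eqP ->.
    rewrite [RHS]integral_swap; [|by measurability|by nonneg].
    rewrite [RHS]integral_oppr; [|by measurability|by nonneg].
    apply: eq_integral => x _; apply: eq_integral => y _.
    by rewrite !mul0r add0r addr0 mul1r mulN1r.
  rewrite [RHS]integral_swap; [|by measurability|by nonneg].
  apply: eq_integral => x _; rewrite [RHS]integral_oppr; [|by measurability|by nonneg].
  apply: eq_integral => y _.
  by rewrite !mul0r add0r addr0 opprK mul1r mulN1r.
(* With y fixed, the first coordinate becomes the variable, and c^2 + s^2 = 1 rewrites the second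
   one as (y - s x) / c. *)
have H y : (`|c|%:E * \int[leb]_x G (c * x + s * y, - s * x + c * y)%R =
    \int[leb]_x G (x, (y - s * x) / c)%R)%E.
  rewrite [RHS](@integral_affine R c (s * y)); [|by []|by measurability|by nonneg].
  congr (_ * _)%E; apply: eq_integral => x _; congr (G (_, _)).
  have -> : y - s * (c * x + s * y) = (- s * x + c * y) * c + (1 - (c ^+ 2 + s ^+ 2)) * y.
    by ring.
  by rewrite cs subrr mul0r addr0 mulfK.
rewrite integral_swap; [|by measurability|by nonneg].
have H2 : (\int[leb]_x \int[leb]_y G (x, y) = `|c^-1|%:E *
    \int[leb]_x \int[leb]_y G (x, (y - s * x) / c)%R)%E.
  rewrite -ge0_integralZl_EFin; [|exact: measurableT|by nonneg|by measurability|by nonneg].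
  apply: eq_integral => x _.
  rewrite (@integral_affine R c^-1 (- s * x / c)); [|by rewrite invr_eq0|by measurability|by nonneg].
  by congr (_ * _)%E; apply: eq_integral => y _; congr (G (_, _)); ring.
rewrite H2 [X in (_ * X)%E]integral_swap; [|by measurability|by nonneg].
under [X in (_ * X)%E]eq_integral do rewrite -H.
rewrite ge0_integralZl_EFin; [|exact: measurableT|by nonneg|by measurability|by nonneg].
by rewrite muleA -EFinM normfV mulVf ?mul1e// normr_eq0.
Qed.

Lemma integral_normal_rotation (c s : R) (F : R * R -> \bar R) :
  c ^+ 2 + s ^+ 2 = 1 ->
  measurable_fun setT F -> (forall z, 0 <= F z)%E ->
  (\int[N]_x \int[N]_y F (c * x + s * y, - s * x + c * y)%R =
   \int[N]_x \int[N]_y F (x, y))%E.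
Proof.
move=> cs mF F0.
rewrite [RHS]integral_normal2// (@integral_normal2 (fun z => F (c * z.1 + s * z.2, - s * z.1 + c * z.2))); [|by measurability|by nonneg].
pose G (z : R * R) := ((normal_pdf 0 1 z.1 * normal_pdf 0 1 z.2)%:E * F (z.1, z.2))%E.
rewrite -(@integral_rotation c s G cs); [|by rewrite /G; measurability|by rewrite /G; nonneg].
apply: eq_integral => x _; apply: eq_integral => y _; rewrite /G/=.
congr (_%:E * _)%E.
rewrite !std_normal_pdfE mulrACA -expRD [in RHS]mulrACA -expRD; congr (_ * expR _).
rewrite (_ : - x ^+ 2 / 2 + - y ^+ 2 / 2 = (c ^+ 2 + s ^+ 2) * (- x ^+ 2 / 2 + - y ^+ 2 / 2)).
  by field.
by rewrite cs mul1r.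
Qed.

Lemma integral_split (g : R -> \bar R) :
  measurable_fun setT g -> (forall x, 0 <= g x)%E ->
  (\int[leb]_x g x = \int[leb]_x ((0 < x)%R%:R%:E * g x) +
                    \int[leb]_x ((0 < x)%R%:R%:E * g (- x)%R))%E.
Proof.
move=> mg g0.
have posE (h : R -> \bar R) : (\int[leb]_(x in `]0%R, +oo[) h x =
    \int[leb]_x ((0 < x)%R%:R%:E * h x))%E.
  rewrite integral_mkcond; apply: eq_integral => x _; rewrite patchE mem_setE in_itv/= andbT.
  by case: ifP; rewrite ?mul1e ?mul0e.
have posE' (h : R -> \bar R) : (\int[leb]_(x in `[0%R, +oo[) h x =
    \int[leb]_x ((0 <= x)%R%:R%:E * h x))%E.
  rewrite integral_mkcond; apply: eq_integral => x _; rewrite patchE mem_setE in_itv/= andbT.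
  by case: ifP; rewrite ?mul1e ?mul0e.
have -> : (\int[leb]_x ((0 < x)%R%:R%:E * g (- x)%R) =
           \int[leb]_x ((x <= 0)%R%:R%:E * g x))%E.
  rewrite -posE integral_itv_obnd_cbnd; last first.
    by apply: measurable_funTS; measurability.
  rewrite posE' integral_oppr; [|by measurability|by nonneg].
  by apply: eq_integral => x _; rewrite oppr_ge0 opprK.
rewrite -ge0_integralD; [|exact: measurableT|by nonneg|by measurability|by nonneg|by measurability].
by apply: eq_integral => x _; case: (ltrP 0 x); rewrite mul1e mul0e ?adde0 ?add0e.
Qed.

Lemma integral_normal_sqr (f : R -> \bar R) :
  measurable_fun setT f -> (forall x, 0 <= f x)%E ->
  (\int[N]_w f (w ^+ 2)%R = \int[chi2_prob 1]_v f v)%E.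
Proof.
move: f; pose J (f : R -> \bar R) := (\int[leb]_x ((0 < x)%R%:R%:E * ((expR (- x ^+ 2 / 2))%:E * f (x ^+ 2)%R)))%E.
pose cN : R := 2 * normal_peak 1.
pose cC : R := 2 / (2 `^ (1 / 2) * Gamma_fun (1 / 2)).
have HN f : measurable_fun setT f -> (forall x, 0 <= f x)%E ->
    (\int[N]_w f (w ^+ 2)%R = cN%:E * J f)%E.
  move=> mf f0; rewrite integral_normal; [|by measurability|by nonneg].
  rewrite integral_split; [|by measurability|by nonneg].
  under [X in (_ + X)%E]eq_integral do rewrite std_normal_pdfN sqrrN.
  rewrite -ge0_integralZl_EFin; [|exact: measurableT|by nonneg|by measurability|]; last first.
    by rewrite mulr_ge0 ?normal_peak_ge0.
  rewrite -ge0_integralD; [|exact: measurableT|by nonneg|by measurability|by nonneg|by measurability].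
  apply: eq_integral => x _; rewrite std_normal_pdfE.
  rewrite -[X in (X + _)%E]mul1e -[X in (_ + X)%E]mul1e -ge0_muleDl//.
  rewrite -EFinD /cN -(natrD _ 1 1) !muleA; congr (_ * _)%E.
  by rewrite -!EFinM; congr EFin; ring.
have HC f : measurable_fun setT f -> (forall x, 0 <= f x)%E ->
    (\int[chi2_prob 1]_w f w = cC%:E * J f)%E.
  move=> mf f0; rewrite integral_chi2//.
  pose g x := ((x `^ (1 / 2 - 1) * expR (- x / 2) / (2 `^ (1 / 2) * Gamma_fun (1 / 2)))%:E * f x)%E.
  have K0 : 0 <= 2 `^ (1 / 2) * Gamma_fun (1 / 2) :> R by rewrite mulr_ge0 ?powR_ge0 ?Gamma_fun_ge0.
  transitivity (\int[leb]_x ((0 < x)%R%:R%:E * g x))%E.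
    by apply: eq_integral => x _; rewrite chi2_pdfE /g muleA -EFinM !mulrA.
  rewrite (@integral_power _ 2); [|by rewrite pnatr_eq0|by rewrite /g; measurability|]; last first.
    by rewrite /g; nonneg.
  rewrite -!ge0_integralZl_EFin; [|exact: measurableT|by nonneg|by measurability|by rewrite divr_ge0
    |exact: measurableT|by rewrite /g; nonneg|by rewrite /g; measurability|by nonneg].
  apply: eq_integral => x _; case: (ltrP 0 x) => x0; last by rewrite !mul0e !mule0.
  rewrite !mul1e /g !muleA -!EFinM; congr (_%:E * f _)%E; last by rewrite powR_mulrn// ltW.
  rewrite ger0_norm// (_ : 2 - 1 = 1); last by ring.
  rewrite -powRrM (_ : 2 * (1 / 2 - 1) = -1); last by field.
  rewrite powR_inv1 ?powRr1 ?powR_mulrn ?ltW// /cC; field.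
  by rewrite (gt_eqF x0) !gt_eqF ?powR_gt0 ?Gamma_fun_gt0.
move=> f mf f0; rewrite HN// HC//.
(* Evaluation at the function 1; the common factor can be cancelled since it is positive and
   finite. *)
have : (cN%:E * J (cst 1%E) = cC%:E * J (cst 1%E))%E.
  by rewrite -HN// -HC// integral_normal_cst integral_chi2_cst.
have : (0 < J (cst 1%E))%E.
  apply: (@integral_gt0 _ _ 0 1) => //.
  - by rewrite /cst; measurability.
  - by rewrite /cst; nonneg.
  - by move=> x /andP[-> _]; rewrite mul1e mule1 lte_fin expR_gt0.
have : (J (cst 1%E) < +oo)%E.
  have : (cN%:E * J (cst 1%E) < +oo)%E.
    by rewrite -HN// integral_normal_cst ltry.
  case: (J _) => //; first by move=> *; rewrite ltry.
  by rewrite gt0_muley// lte_fin mulr_gt0// normal_peak_gt0 ?oner_eq0.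
case: (J (cst 1%E)) => //= r _; rewrite lte_fin => r0.
by move=> [] /mulIf -> //; rewrite gt_eqF.
Qed.

(** The convolution density at y scales: w = sqrt y t extracts the chi-squared density with m + 1
    degrees of freedom and leaves a Beta integral free of y, whose value is then forced by total
    mass. *)
Lemma integral_chi2_normal (m : R) (f : R -> \bar R) : 0 < m ->
  measurable_fun setT f -> (forall x, 0 <= f x)%E ->
  (\int[chi2_prob m]_v \int[N]_w f (v + w ^+ 2)%R = \int[chi2_prob (m + 1)]_v f v)%E.
Proof.
move=> m0; move: f.
pose k (m : R) : R := (2 `^ (m / 2) * Gamma_fun (m / 2))^-1.
have k0 (m' : R) : 0 < m' -> 0 < k m'.
  by move=> m'0; rewrite invr_gt0 mulr_gt0 ?powR_gt0// Gamma_fun_gt0// divr_gt0.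
have kE (m' x : R) : chi2_pdf m' x = (0 < x)%R%:R * (x `^ (m' / 2 - 1) * expR (- x / 2)) * k m'.
  by rewrite chi2_pdfE.
have m10 : 0 < m + 1 by rewrite addr_gt0.
(* The Beta integral, kept in the extended reals: its finiteness is not known beforehand. *)
pose D : \bar R := (\int[leb]_t ((0 < 1 - t ^+ 2)%R%:R%:E * ((1 - t ^+ 2) `^ (m / 2 - 1))%:E))%E.
have D0 : (0 <= D)%E by rewrite /D; nonneg.
pose C : \bar R := ((normal_peak 1 * k m / k (m + 1))%:E * D)%E.
have np0 : 0 < normal_peak 1 :> R by rewrite normal_peak_gt0 ?oner_eq0.
have C0 : (0 <= C)%E.
  by rewrite mule_ge0// lee_fin divr_ge0 ?mulr_ge0 ?ltW ?k0.
have AE y : (\int[leb]_w (normal_pdf 0 1 w * chi2_pdf m (y - w ^+ 2))%:E = C * (chi2_pdf (m + 1) y)%:E)%E.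
  have [y0|y0] := leP y 0.
    rewrite (chi2_pdf_le0 _ y0) mule0; apply: integral0_eq => w _.
    by rewrite chi2_pdf_le0 ?mulr0// subr_le0 (le_trans y0)// sqr_ge0.
  have sy : 0 < Num.sqrt y by rewrite sqrtr_gt0.
  have sy2 : Num.sqrt y ^+ 2 = y by rewrite sqr_sqrtr// ltW.
  rewrite (@integral_affine _ (Num.sqrt y) 0); [|by rewrite gt_eqF|by measurability|by nonneg].
  rewrite /C muleAC -EFinM /D -ge0_integralZl_EFin; [|exact: measurableT|by nonneg|by measurability|by nonneg].
  have K0 : 0 <= normal_peak 1 * k m / k (m + 1) * chi2_pdf (m + 1) y.
    by rewrite mulr_ge0 ?chi2_pdf_ge0// divr_ge0 ?mulr_ge0// ltW ?k0.
  rewrite -ge0_integralZl_EFin; [|exact: measurableT|by nonneg|by measurability|exact: K0].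
  apply: eq_integral => t _; rewrite addr0 exprMn sy2 -[X in X - y * _]mulr1 -mulrBr.
  rewrite !kE pmulr_rgt0// y0; case: ltrP => t1; last by rewrite !mul0r !mulr0 !mul0e !mule0.
  rewrite -!EFinM !mul1r ger0_norm ?ltW// std_normal_pdfE exprMn sy2 powRM ?ltW//.
  have -> : y `^ ((m + 1) / 2 - 1) = Num.sqrt y * y `^ (m / 2 - 1).
    rewrite -powR12_sqrt ?ltW// -powRD; last by rewrite (gt_eqF y0) implybT.
    by congr (_ `^ _); field.
  have -> : expR (- y / 2) = expR (- (y * t ^+ 2) / 2) * expR (- (y * (1 - t ^+ 2)) / 2).
    by rewrite -expRD; congr expR; field.
  have := k0 _ m10; move: (k (m + 1)) (k m) (normal_peak 1) (expR _) (expR _) => k1 k2 p e1 e2.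
  move: (_ `^ _) (_ `^ _) (Num.sqrt y) => a1 a2 a3 k10.
  by congr EFin; field; rewrite gt_eqF.
have H f : measurable_fun setT f -> (forall x, 0 <= f x)%E ->
  (\int[chi2_prob m]_v \int[N]_w f (v + w ^+ 2)%R = C * \int[chi2_prob (m + 1)]_v f v)%E.
  move=> mf f0; etransitivity.
    by apply: integral_chi2; [measurability|nonneg].
  transitivity (\int[leb]_v \int[leb]_w ((normal_pdf 0 1 w * chi2_pdf m v)%:E * f (v + w ^+ 2)%R))%E.
    apply: eq_integral => v _; rewrite integral_normal; [|by measurability|by nonneg].
    rewrite -ge0_integralZl_EFin; [|exact: measurableT|by nonneg|by measurability|by nonneg].
    by apply: eq_integral => w _; rewrite muleA -EFinM mulrC.
  rewrite integral_swap; [|by measurability|by nonneg].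
  transitivity (\int[leb]_w \int[leb]_y ((normal_pdf 0 1 w * chi2_pdf m (y - w ^+ 2))%:E * f y))%E.
    apply: eq_integral => w _.
    rewrite [RHS](@integral_shift _ (w ^+ 2)); [|by measurability|by nonneg].
    by apply: eq_integral => v _; rewrite addrK.
  rewrite integral_swap; [|by measurability|by nonneg].
  rewrite integral_chi2// -ge0_integralZl//; [|by measurability|by nonneg].
  apply: eq_integral => y _; rewrite muleA -AE.
  by rewrite ge0_integralZr; [|exact: measurableT|by measurability|by nonneg|].
(* Both sides of [H] have mass 1 at the function 1. *)
have C1 : C = 1%E.
  have E1 : (\int[chi2_prob m]_v \int[N]_w (1%E : \bar R) = 1)%E.
    transitivity (\int[chi2_prob m]_v (1%E : \bar R))%E; last exact: integral_chi2_cst.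
    by apply: eq_integral => v _; exact: integral_normal_cst.
  have E2 : (\int[chi2_prob (m + 1)%R]_v (1%E : \bar R) = 1)%E by exact: integral_chi2_cst.
  have E3 := H (cst 1%E) (measurable_cst _) (fun=> lee01).
  exact: (etrans (esym (mule1 C)) (etrans (congr1 (mule C) (esym E2)) (etrans (esym E3) E1))).
move=> f mf f0; apply: (etrans (H f mf f0)).
by rewrite [X in (X * _)%E]C1 mul1e.
Qed.

End normal_chi2.

(** * The standard normal distribution function *)

Section normal_cdf.
Variable R : realType.
Local Notation leb := (@lebesgue_measure R).
Local Notation N := (@normal_prob R 0 1).

Lemma normal_prob_indic (A : set R) :
  N A = (\int[leb]_x ((normal_pdf 0 1 x)%:E * (\1_A x)%:E))%E.
Proof. exact: integral_indic_mul. Qed.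

Lemma normal_prob_itv_open (x : R) : N `]-oo, x[ = N `]-oo, x].
Proof.
apply: integral_itv_bndo_bndc; apply: measurable_funTS.
by apply/measurable_EFinP; exact: measurable_normal_pdf.
Qed.

Local Opaque chi2_prob normal_prob lebesgue_measure.

(* Locked: unfolding it makes failing unification problems very slow. *)
Definition Phi : R -> R := locked (fun x => fine (N `]-oo, x])).

Lemma PhiE x : N `]-oo, x] = (Phi x)%:E.
Proof. by rewrite /Phi -lock fineK// fin_num_measure. Qed.

Lemma PhiE_open x : N `]-oo, x[ = (Phi x)%:E.
Proof.
by rewrite normal_prob_itv_open PhiE.
Qed.

Lemma Phi_ge0 x : 0 <= Phi x.
Proof. by rewrite -lee_fin -PhiE. Qed.

Lemma Phi_le1 x : Phi x <= 1.
Proof. by rewrite -lee_fin -PhiE; exact: probability_le1. Qed.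

Lemma PhiE_ge x : N `[x, +oo[ = (Phi (- x))%:E.
Proof.
rewrite -PhiE !normal_prob_indic [LHS]integral_oppr.
- apply: eq_integral => z _; rewrite std_normal_pdfN; congr (_ * (_%:E))%E.
  by rewrite !indicE !mem_setE !in_itv/= andbT lerNr.
- apply: emeasurable_funM; first by measurability.
  by apply: measurable_EFin; exact: measurable_indic.
- by nonneg.
Qed.

Lemma PhiN x : Phi (- x) = 1 - Phi x.
Proof.
apply/EFin_inj; rewrite EFinB -PhiE_ge -PhiE_open.
have <- := @probability_setC _ _ R N `]-oo, x[%classic (measurable_itv _).
by rewrite setCitvl.
Qed.

Lemma PhiB x y : x <= y -> (Phi y - Phi x)%:E = N `]x, y].
Proof.
move=> xy; rewrite EFinB -!PhiE.
rewrite (_ : `]-oo, y]%classic = `]-oo, x]%classic `|` `]x, y]%classic); last first.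
  by rewrite -itv_bndbnd_setU// bnd_simp.
rewrite measureU//; last first.
  by apply/seteqP; split=> z //=; rewrite !in_itv/= => -[zx /andP[xz _]]; move: zx; rewrite leNgt xz.
by rewrite addeAC subee ?add0e// fin_num_measure.
Qed.

Lemma Phi_lt x y : x < y -> Phi x < Phi y.
Proof.
move=> xy; rewrite -subr_gt0 -lte_fin PhiB ?ltW// normal_prob_indic.
apply: (integral_gt0 xy).
- apply: emeasurable_funM; first by measurability.
  by apply: measurable_EFin; exact: measurable_indic.
- by nonneg.
move=> z /andP[xz zy]; rewrite indicE mem_set/= ?in_itv/= ?xz ?ltW// mule1 lte_fin.
by rewrite std_normal_pdfE mulr_gt0 ?expR_gt0 ?normal_peak_gt0 ?oner_eq0.
Qed.

Lemma Phi_le x y : x <= y -> Phi x <= Phi y.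
Proof. by rewrite le_eqVlt => /predU1P[->//|/Phi_lt/ltW]. Qed.

Lemma measurable_Phi : measurable_fun setT Phi.
Proof. by apply: nondecreasing_measurable => // x y; exact: Phi_le. Qed.

Lemma Phi_lipschitz x y : x <= y -> Phi y - Phi x <= normal_peak 1 * (y - x).
Proof.
move=> xy; rewrite -lee_fin PhiB// normal_prob_indic.
apply: (@le_trans _ _ (\int[leb]_z ((normal_peak 1)%:E * (\1_`]x, y]%classic z)%:E))%E).
  apply: ge0_le_integral; [exact: measurableT|by nonneg| | |].
  - apply: emeasurable_funM; first by measurability.
    by apply: measurable_EFin; exact: measurable_indic.
  - apply: emeasurable_funM; first by measurability.
    by apply: measurable_EFin; exact: measurable_indic.
  - move=> z _; rewrite lee_wpmul2r ?lee_fin//.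
    by apply: normal_pdf_ub; rewrite oner_eq0.
rewrite ge0_integralZl_EFin; [|exact: measurableT|by nonneg| |by nonneg].
  have -> : (\int[leb]_z (\1_`]x, y]%classic z)%:E = leb `]x, y]%classic)%E.
    by rewrite integral_indic// setIT.
  rewrite lebesgue_measure_itv/= lte_fin.
  case: ltP => [_|yx]; first by rewrite -EFinB -EFinM.
  by rewrite mule0 lee_fin mulr_ge0 ?normal_peak_ge0// subr_ge0.
by apply: measurable_EFin; exact: measurable_indic.
Qed.

Lemma Phi_continuous : continuous Phi.
Proof.
have p0 : 0 < normal_peak 1 :> R by rewrite normal_peak_gt0 ?oner_eq0.
have H x y : `|Phi y - Phi x| <= normal_peak 1 * `|y - x|.
  wlog xy : x y / x <= y.
    by move=> W; have [/W//|/ltW/W] := leP x y; rewrite distrC [X in _ <= _ * X]distrC.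
  by rewrite !ger0_norm ?subr_ge0 ?Phi_le// Phi_lipschitz.
move=> x; apply/cvgrPdist_lt => e e0; near=> z.
rewrite (le_lt_trans (H _ _))// -ltr_pdivlMl//.
by near: z; apply: cvgr_dist_lt => //; rewrite mulr_gt0// invr_gt0.
Unshelve. all: by end_near. Qed.

(** The factor c stands for sqrt v with v > 0, as needed in the pointwise limit under the
    chi-squared integral. *)
Lemma Phi_cvg_nat (c : R) : 0 < c -> Phi (k%:R * c) @[k --> \oo] --> (1 : R).
Proof.
move=> c0.
have : N `]-oo, k%:R * c] @[k --> \oo] --> N (\bigcup_k `]-oo, k%:R * c]%classic).
  apply: nondecreasing_cvg_mu => //; first exact: bigcup_measurable.
  move=> i j ij; apply/subsetPset => z /=; rewrite !in_itv/= => /le_trans; apply.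
  by rewrite ler_pM2r// ler_nat.
have -> : \bigcup_k `]-oo, k%:R * c]%classic = setT.
  apply/seteqP; split => // z _; exists (Num.truncn (`|z| / c)).+1 => //=.
  rewrite in_itv/= -ler_pdivrMr//.
  by rewrite (le_trans _ (ltW (truncnS_gt _)))// ler_pM2r ?invr_gt0// ler_norm.
rewrite probability_setT; under eq_fun do rewrite PhiE.
by move=> /fine_cvg.
Qed.

End normal_cdf.

(** * The law of a normal over the root of a chi-squared *)

Section ratio_cdf.
Variable R : realType.
Local Notation leb := (@lebesgue_measure R).
Local Notation N := (@normal_prob R 0 1).

(* The distribution function of Z / sqrt (chi^2_m). *)
Definition ratio_cdf : R -> R -> R :=
  locked (fun m q => \int[leb]_v (chi2_pdf m v * Phi (q * Num.sqrt v))).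

Lemma measurable_ratio_integrand (m q : R) :
  measurable_fun setT (fun v : R => chi2_pdf m v * Phi (q * Num.sqrt v)).
Proof. have mP := @measurable_Phi R. by measurability. Qed.

Lemma integrable_chi2_pdf (m : R) : 0 < m ->
  leb.-integrable setT (EFin \o chi2_pdf m).
Proof.
move=> m0; apply/integrableP; split.
  by apply/measurable_EFinP; exact: measurable_chi2_pdf.
under eq_integral do rewrite /= ger0_norm ?chi2_pdf_ge0//.
by rewrite integral_chi2_pdf// ltry.
Qed.

Lemma integrable_ratio (m q : R) : 0 < m ->
  leb.-integrable setT (EFin \o (fun v => chi2_pdf m v * Phi (q * Num.sqrt v))).
Proof.
move=> m0; apply: (le_integrable measurableT _ _ (integrable_chi2_pdf m0)).
  by apply/measurable_EFinP; exact: measurable_ratio_integrand.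
move=> v _; rewrite lee_fin !ger0_norm ?mulr_ge0 ?chi2_pdf_ge0 ?Phi_ge0//.
by rewrite ler_piMr ?chi2_pdf_ge0 ?Phi_le1.
Qed.

Lemma ratio_cdfE (m q : R) : 0 < m ->
  (\int[leb]_v (chi2_pdf m v * Phi (q * Num.sqrt v))%:E = (ratio_cdf m q)%:E)%E.
Proof.
move=> m0; rewrite /ratio_cdf -lock /Rintegral fineK//.
exact: integrable_fin_num (integrable_ratio q m0).
Qed.

Lemma chi2_normal_probE (m : R) (A : set (R * R)) : measurable A ->
  chi2_normal_prob m A = (\int[leb]_v ((chi2_pdf m v)%:E * N (xsection A v)))%E.
Proof.
move=> mA; rewrite /chi2_normal_prob /product_measure1.
by rewrite integral_chi2//; exact: measurable_fun_xsection.
Qed.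

Lemma measurable_ratio : measurable_fun setT (fun w : R * R => w.2 / Num.sqrt w.1).
Proof. by measurability. Qed.

(** Given the chi-squared value v > 0 the event is Z <= q sqrt v. The values v <= 0, where the
    quotient takes its default value, carry no density. *)
Lemma ratio_prob_le (m q : R) : 0 < m ->
  chi2_normal_prob m [set w | w.2 / Num.sqrt w.1 <= q] = (ratio_cdf m q)%:E.
Proof.
move=> m0; rewrite chi2_normal_probE; last first.
  rewrite (_ : [set w | _] = (fun w : R * R => w.2 / Num.sqrt w.1) @^-1` `]-oo, q]).
    by rewrite -[X in measurable X]setTI; apply: measurable_ratio.
  by apply/seteqP; split=> z /=; rewrite in_itv.
rewrite -ratio_cdfE//; apply: eq_integral => v _.
have [v0|v0] := leP v 0; first by rewrite chi2_pdf_le0// mul0r mul0e.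
rewrite EFinM -PhiE; congr (_ * N _)%E; apply/seteqP.
by split => z; rewrite /xsection/= !inE/= ler_pdivrMr ?sqrtr_gt0.
Qed.

Lemma ratio_prob_lt (m q : R) : 0 < m ->
  chi2_normal_prob m [set w | w.2 / Num.sqrt w.1 < q] = (ratio_cdf m q)%:E.
Proof.
move=> m0; rewrite chi2_normal_probE; last first.
  rewrite (_ : [set w | _] = (fun w : R * R => w.2 / Num.sqrt w.1) @^-1` `]-oo, q[).
    by rewrite -[X in measurable X]setTI; apply: measurable_ratio.
  by apply/seteqP; split=> z /=; rewrite in_itv.
rewrite -ratio_cdfE//; apply: eq_integral => v _.
have [v0|v0] := leP v 0; first by rewrite chi2_pdf_le0// mul0r mul0e.
rewrite EFinM -PhiE_open; congr (_ * N _)%E; apply/seteqP.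
by split => z; rewrite /xsection/= !inE/= ltr_pdivrMr ?sqrtr_gt0.
Qed.

Lemma ratio_prob_ge (m q : R) : 0 < m ->
  chi2_normal_prob m [set w | q <= w.2 / Num.sqrt w.1] = (ratio_cdf m (- q))%:E.
Proof.
move=> m0; rewrite chi2_normal_probE; last first.
  rewrite (_ : [set w | _] = (fun w : R * R => w.2 / Num.sqrt w.1) @^-1` `[q, +oo[).
    by rewrite -[X in measurable X]setTI; apply: measurable_ratio.
  by apply/seteqP; split=> z /=; rewrite in_itv/= andbT.
rewrite -ratio_cdfE//; apply: eq_integral => v _.
have [v0|v0] := leP v 0; first by rewrite chi2_pdf_le0// mul0r mul0e.
rewrite EFinM mulNr -PhiE_ge; congr (_ * N _)%E; apply/seteqP.
by split => z; rewrite /xsection/= in_itv/= andbT inE/= ler_pdivlMr ?sqrtr_gt0.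
Qed.

Lemma chi2_normal_prob_setT (m : R) : 0 < m -> chi2_normal_prob m setT = 1%E.
Proof.
move=> m0; rewrite chi2_normal_probE// -(integral_chi2_pdf m0).
apply: eq_integral => v _; rewrite xsectionE preimage_setT.
by rewrite [X in (_ * X)%E](_ : _ = 1%E) ?mule1//; exact: probability_setT.
Qed.

Lemma ratio_cdfN (m q : R) : 0 < m -> ratio_cdf m (- q) = 1 - ratio_cdf m q.
Proof.
move=> m0; suff : ((ratio_cdf m (- q))%:E + (ratio_cdf m q)%:E = 1)%E.
  by rewrite -EFinD => -[] <-; rewrite addrK.
rewrite -!ratio_cdfE// -ge0_integralD; [|exact: measurableT| | | |].
- rewrite -(integral_chi2_pdf m0); apply: eq_integral => v _.
  by rewrite mulNr PhiN -EFinD mulrBr mulr1 subrK.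
- by move=> v _; rewrite lee_fin mulr_ge0 ?chi2_pdf_ge0 ?Phi_ge0.
- by apply: measurable_EFin; exact: measurable_ratio_integrand.
- by move=> v _; rewrite lee_fin mulr_ge0 ?chi2_pdf_ge0 ?Phi_ge0.
- by apply: measurable_EFin; exact: measurable_ratio_integrand.
Qed.

Lemma ratio_cdf0 (m : R) : 0 < m -> ratio_cdf m 0 = 1 / 2.
Proof. move=> m0; have := ratio_cdfN 0 m0; rewrite oppr0; lra. Qed.

Lemma ratio_cdf_lt (m q q' : R) : 0 < m -> q < q' -> ratio_cdf m q < ratio_cdf m q'.
Proof.
move=> m0 qq'; have mP := @measurable_Phi R.
pose h v := chi2_pdf m v * (Phi (q' * Num.sqrt v) - Phi (q * Num.sqrt v)).
have h0 v : 0 <= h v.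
  by rewrite mulr_ge0 ?chi2_pdf_ge0// subr_ge0 Phi_le// ler_wpM2r// ltW.
have mh : measurable_fun setT (fun v => (h v)%:E) by rewrite /h; measurability.
have hpos : (0 < \int[leb]_v (h v)%:E)%E.
  apply: (@integral_gt0 _ _ 0 1) => // v /andP[v0 _]; rewrite lte_fin mulr_gt0 ?chi2_pdf_gt0//.
  by rewrite subr_gt0 Phi_lt// ltr_pM2r// sqrtr_gt0.
rewrite -lte_fin -!ratio_cdfE//.
have -> : (\int[leb]_v (chi2_pdf m v * Phi (q' * Num.sqrt v))%:E =
   \int[leb]_v (chi2_pdf m v * Phi (q * Num.sqrt v))%:E + \int[leb]_v (h v)%:E)%E.
  rewrite -ge0_integralD; [|exact: measurableT| | | |exact: mh].
  - by apply: eq_integral => v _; rewrite -EFinD /h -mulrDr addrC subrK.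
  - by move=> v _; rewrite lee_fin mulr_ge0 ?chi2_pdf_ge0 ?Phi_ge0.
  - by apply: measurable_EFin; exact: measurable_ratio_integrand.
  - by move=> v _; rewrite lee_fin.
by rewrite ratio_cdfE// lteDl.
Qed.

Lemma ratio_cdf_continuous (m : R) : 0 < m -> continuous (ratio_cdf m).
Proof.
move=> m0 q.
have := @continuity_under_integral R _ (measurableTypeR R) leb (fun q v => chi2_pdf m v * Phi (q * Num.sqrt v))
  setT measurableT (q - 1) (q + 1) (fun x _ => integrable_ratio x m0).
move=> /(_ _ (chi2_pdf m) (integrable_chi2_pdf m0)) H.
rewrite /ratio_cdf -lock; apply: H; last by rewrite inE/= in_itv/= ltrBlDr !ltrDl ltr01.
- apply: aeW => v _ x _; apply: cvgM; first exact: cvg_cst.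
  have cv : continuous (fun y : R => Phi (y * Num.sqrt v)).
    move=> y; apply: (@continuous_comp _ _ _ (fun z : R => z * Num.sqrt v) (@Phi R)).
      by apply: cvgM; [exact: cvg_id|exact: cvg_cst].
    exact: Phi_continuous.
  exact: cv.
- move=> x _; apply: aeW => v _.
  rewrite ger0_norm ?mulr_ge0 ?chi2_pdf_ge0 ?Phi_ge0//.
  by rewrite ler_piMr ?chi2_pdf_ge0 ?Phi_le1.
Qed.

Lemma ratio_cdf_cvg_nat (m : R) : 0 < m -> ratio_cdf m k%:R @[k --> \oo] --> (1 : R).
Proof.
move=> m0.
have H : (\int[leb]_v (chi2_pdf m v * Phi (k%:R * Num.sqrt v))%:E @[k --> \oo] -->
    \int[leb]_v (chi2_pdf m v)%:E)%E.
  apply: (@dominated_cvg _ _ R leb setT measurableT _ _ (EFin \o chi2_pdf m)).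
  - by move=> k; apply: measurable_EFin; exact: measurable_ratio_integrand.
  - move=> v _; apply: cvg_EFin; first by near=> k.
    have [v0|v0] := leP v 0.
      rewrite (_ : fine \o _ = fun=> chi2_pdf m v); first exact: cvg_cst.
      by apply/funext => k /=; rewrite chi2_pdf_le0// mul0r.
    rewrite -[X in _ --> X]mulr1; apply: cvgM; first exact: cvg_cst.
    by apply: Phi_cvg_nat; rewrite sqrtr_gt0.
  - by move=> v _.
  - exact: integrable_chi2_pdf.
  - move=> k v _; rewrite lee_fin ger0_norm ?mulr_ge0 ?chi2_pdf_ge0 ?Phi_ge0//.
    by rewrite ler_piMr ?chi2_pdf_ge0 ?Phi_le1.
move: H; rewrite integral_chi2_pdf//.
under eq_fun do rewrite ratio_cdfE//.
by move=> /fine_cvg; exact.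
Unshelve. all: by end_near. Qed.

(** Intermediate value theorem; symmetry turns the limit at +oo into the bound needed at the lower
    end. *)
Lemma ratio_quantile_exists (m beta : R) : 0 < m -> 0 < beta < 1 ->
  exists q, ratio_cdf m q = beta.
Proof.
move=> m0 /andP[b0 b1].
have large (c : R) : c < 1 -> exists q, c <= ratio_cdf m q /\ 0 <= q.
  move=> c1; have /cvgrPdist_lt/(_ (1 - c)) := ratio_cdf_cvg_nat m0.
  rewrite subr_gt0 => /(_ c1) [k _ /(_ k (leqnn _))]/= H.
  exists k%:R; split => //.
  by move: H; rewrite ltr_norml => /andP[_]; rewrite ltrD2l ltrN2 => /ltW.
have [q1 [h1 q10]] := large _ b1.
have [|q2 [h2 q20]] := large (1 - beta); first by rewrite ltrBlDr ltrDl.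
have h2' : ratio_cdf m (- q2) <= beta by rewrite ratio_cdfN// lerBlDr -lerBlDl.
have q12 : - q2 <= q1 by rewrite (@le_trans _ _ 0)// oppr_le0.
have [||c _ <-] := @IVT R (ratio_cdf m) (- q2) q1 beta q12.
- by apply: continuous_subspaceT => x; exact: ratio_cdf_continuous.
- by rewrite ge_min h2' le_max h1 orbT.
by exists c.
Qed.

(** As [f] and [f'] have equal mass, subtracting the constant [phi v0] from [phi] does not change
    the integral of (f' - f) phi; the integrand becomes nonnegative, and positive on ]0, v0[. *)
Lemma integral_single_crossing (f f' phi : R -> R) (v0 : R) :
  measurable_fun setT f -> measurable_fun setT f' -> measurable_fun setT phi ->
  (forall v, 0 <= f v) -> (forall v, 0 <= f' v) -> (forall v, 0 <= phi v) ->
  (\int[leb]_v (f v)%:E = 1)%E -> (\int[leb]_v (f' v)%:E = 1)%E ->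
  (\int[leb]_v (f v * phi v)%:E < +oo)%E ->
  (forall v, 0 <= (f' v - f v) * (phi v - phi v0)) -> 0 < v0 ->
  (forall v, 0 < v < v0 -> 0 < (f' v - f v) * (phi v - phi v0)) ->
  (\int[leb]_v (f v * phi v)%:E < \int[leb]_v (f' v * phi v)%:E)%E.
Proof.
move=> mf mf' mphi f0 f'0 phi0 f1 f'1 fphi h0 v00 hlt.
pose h v := (f' v - f v) * (phi v - phi v0).
have mh : measurable_fun setT (fun v => (h v)%:E) by rewrite /h; measurability.
have hpos : (0 < \int[leb]_v (h v)%:E)%E.
  by apply: (@integral_gt0 _ _ 0 v0) => // v /hlt.
pose c := phi v0.
have c0 : 0 <= c by exact: phi0.
have cst_int (g : R -> R) : measurable_fun setT g -> (forall v, 0 <= g v) ->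
    (\int[leb]_v (g v)%:E = 1)%E -> (\int[leb]_v (g v * c)%:E = c%:E)%E.
  move=> mg g0 g1; under eq_integral do rewrite EFinM muleC.
  rewrite ge0_integralZl_EFin; [|exact: measurableT|by nonneg|by measurability|exact: c0].
  by rewrite g1 mule1.
(* The additive form involves only nonnegative integrands and no difference of extended reals. *)
have E : (\int[leb]_v (f' v * phi v)%:E + c%:E = \int[leb]_v (f v * phi v)%:E + c%:E + \int[leb]_v (h v)%:E)%E.
  rewrite -{1}(cst_int f)// -{1}(cst_int f')//.
  rewrite -ge0_integralD; [|exact: measurableT|by nonneg|by measurability|by nonneg|by measurability].
  rewrite -ge0_integralD; [|exact: measurableT|by nonneg|by measurability|by nonneg|by measurability].
  rewrite -ge0_integralD; [|exact: measurableT| | | |exact: mh].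
  - by apply: eq_integral => v _; rewrite -!EFinD; congr EFin; rewrite /h -/c; ring.
  - by move=> v _; rewrite -EFinD lee_fin addr_ge0// mulr_ge0.
  - by apply: emeasurable_funD; measurability.
  - by move=> v _; rewrite lee_fin; exact: h0.
have fphi_fin : (\int[leb]_v (f v * phi v)%:E \is a fin_num)%E.
  by rewrite ge0_fin_numE//; nonneg.
rewrite -(@lteD2rE _ c%:E)// E lteDl// fin_numD fphi_fin//.
Qed.

(** The quotient of the two densities is a constant times v^((m' - m) / 2), increasing in v, so they
    cross once; for q > 0, Phi (q sqrt v) increases in v as well. *)
Lemma ratio_cdf_lt_dof (m m' q : R) : 0 < m -> m < m' -> 0 < q ->
  ratio_cdf m q < ratio_cdf m' q.
Proof.
move=> m0 mm' q0; have mP := @measurable_Phi R.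
have m'0 : 0 < m' by exact: lt_trans mm'.
have [k k0 kE] : exists2 k : R -> R, (forall m, 0 < m -> 0 < k m) &
    forall m v, chi2_pdf m v = (0 < v)%R%:R * (v `^ (m / 2 - 1) * expR (- v / 2)) * k m.
  exists (fun m => (2 `^ (m / 2) * Gamma_fun (m / 2))^-1) => [m'' m''0|m'' v].
    by rewrite invr_gt0 mulr_gt0 ?powR_gt0// Gamma_fun_gt0// divr_gt0.
  by rewrite chi2_pdfE.
have p0 : 0 < (m' - m) / 2 by rewrite divr_gt0// subr_gt0.
have km0 := k0 _ m0; have km'0 := k0 _ m'0.
have kk0 : 0 < k m / k m' by exact: divr_gt0.
have kk0' : 0 < k m' / k m by exact: divr_gt0.
(* The crossing point, where the quotient of the densities equals 1. *)
have [v0 v00 v0p] : exists2 v0 : R, 0 < v0 & v0 `^ ((m' - m) / 2) = k m / k m'.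
  exists ((k m / k m') `^ ((m' - m) / 2)^-1); first exact: powR_gt0.
  by rewrite -powRrM mulVf ?gt_eqF// powRr1// ltW.
have ratioE v : 0 < v -> chi2_pdf m' v - chi2_pdf m v =
    chi2_pdf m v * (k m' / k m) * (v `^ ((m' - m) / 2) - v0 `^ ((m' - m) / 2)).
  move=> vp; rewrite v0p (kE m') (kE m) vp !mul1r.
  have -> : v `^ (m' / 2 - 1) = v `^ (m / 2 - 1) * v `^ ((m' - m) / 2).
    rewrite -powRD; last by rewrite (gt_eqF vp) implybT.
    by congr (_ `^ _); field.
  move: km0 km'0; move: (k m) (k m') (expR _) (_ `^ _) (_ `^ _).
  move=> k1 k2 e a1 a2 k10 k20; field.
  by rewrite !gt_eqF.
have f0 : forall m v : R, 0 <= chi2_pdf m v by move=> *; exact: chi2_pdf_ge0.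
have f1 := integral_chi2_pdf m0.
have f'1 := integral_chi2_pdf m'0.
have fpos : forall v : R, 0 < v -> 0 < chi2_pdf m v by move=> v; exact: chi2_pdf_gt0.
have fneg : forall v : R, v <= 0 -> chi2_pdf m' v - chi2_pdf m v = 0.
  by move=> v vn; rewrite (chi2_pdf_le0 _ vn) (chi2_pdf_le0 _ vn) subrr.
have mf : measurable_fun setT (@chi2_pdf R m) by exact: measurable_chi2_pdf.
have mf' : measurable_fun setT (@chi2_pdf R m') by exact: measurable_chi2_pdf.
have fphi : (\int[leb]_v (chi2_pdf m v * Phi (q * Num.sqrt v))%:E < +oo)%E.
  by rewrite ratio_cdfE// ltry.
rewrite -lte_fin -(ratio_cdfE q m0) -(ratio_cdfE q m'0).
move: ratioE (f0 m) (f0 m') f1 f'1 fpos fneg mf mf' fphi.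
move: (chi2_pdf m) (chi2_pdf m') => f f' ratioE {}f0 f'0 f1 f'1 fpos fneg mf mf' fphi.
have hlt (v : R) : 0 < v < v0 -> 0 < (f' v - f v) * (Phi (q * Num.sqrt v) - Phi (q * Num.sqrt v0)).
  move=> /andP[vp vv]; rewrite ratioE// nmulr_rgt0.
    by rewrite subr_lt0 Phi_lt// ltr_pM2l// ltr_sqrt.
  rewrite pmulr_rlt0; last by rewrite mulr_gt0 ?fpos.
  by rewrite subr_lt0 gt0_ltr_powR ?nnegrE// ltW.
apply: (integral_single_crossing (phi := fun v => Phi (q * Num.sqrt v)) (v0 := v0)) => //.
- by measurability.
- by move=> v; exact: Phi_ge0.
move=> v; have [vn|vp] := leP v 0; first by rewrite fneg// mul0r.
have [vv|vv] := ltP v v0; first by rewrite ltW// hlt// vp.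
rewrite ratioE// mulr_ge0//; last by rewrite subr_ge0 Phi_le// ler_pM2l// ler_wsqrtr.
rewrite mulr_ge0//; first by rewrite mulr_ge0// ltW.
by rewrite subr_ge0; apply: ge0_ler_powR; rewrite ?nnegrE// ltW.
Qed.

End ratio_cdf.

(** * Quantiles and the equivalence with b = 2 *)

Section quantiles.
Variable R : realType.
Implicit Types (m beta q t : R).

Lemma ratio_cdf_le m q q' : 0 < m -> (ratio_cdf m q <= ratio_cdf m q') = (q <= q').
Proof.
move=> m0; have [qq'|q'q|->] := ltgtP q q'; last by rewrite lexx.
  by rewrite ltW// ratio_cdf_lt.
by rewrite leNgt ratio_cdf_lt.
Qed.

Lemma quantile_eq (mu : set R -> \bar R) beta q0 :
  (forall q, (beta%:E <= mu `]-oo, q]%classic)%E = (q0 <= q)) ->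
  quantile mu beta = q0.
Proof.
move=> H; rewrite /quantile.
rewrite (_ : [set q | _] = `[q0, +oo[%classic); first exact: inf_itv.
by apply/seteqP; split=> q /=; rewrite in_itv/= andbT H.
Qed.

Lemma student_ratio m (w : R * R) : 0 < m ->
  w.2 / Num.sqrt (w.1 / m) = Num.sqrt m * (w.2 / Num.sqrt w.1).
Proof.
move=> m0; rewrite [w.1 / m]mulrC sqrtrM ?invr_ge0 ?ltW// sqrtrV ?ltW//.
by rewrite invfM invrK; ring.
Qed.

Lemma student_prob_le m t : 0 < m ->
  student_prob m `]-oo, t] = (ratio_cdf m (t / Num.sqrt m))%:E.
Proof.
move=> m0; rewrite -(ratio_prob_le _ m0) /student_prob /pushforward.
congr chi2_normal_prob; apply/seteqP; split=> w /=; rewrite in_itv/= student_ratio//.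
  by rewrite ler_pdivlMr ?sqrtr_gt0// mulrC.
by rewrite ler_pdivlMr ?sqrtr_gt0// mulrC.
Qed.

Lemma student_prob_lt m t : 0 < m ->
  student_prob m [set x | x < t] = (ratio_cdf m (t / Num.sqrt m))%:E.
Proof.
move=> m0; rewrite -(ratio_prob_lt _ m0) /student_prob /pushforward.
congr chi2_normal_prob; apply/seteqP; split=> w /=; rewrite student_ratio//.
  by rewrite ltr_pdivlMr ?sqrtr_gt0// mulrC.
by rewrite ltr_pdivlMr ?sqrtr_gt0// mulrC.
Qed.

(** Writing the level as a value of [ratio_cdf] lets strict monotonicity give the quantile directly,
    without an inverse function. *)
Lemma quantile_student m q : 0 < m ->
  quantile (student_prob m) (ratio_cdf m q) = Num.sqrt m * q.
Proof.
move=> m0; apply: quantile_eq => t.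
by rewrite student_prob_le// lee_fin ratio_cdf_le// ler_pdivlMr ?sqrtr_gt0// mulrC.
Qed.

(** The least-squares slope s12 / s11 when s11 and s22 are positive, kept in the form that it has in
    [theta1_star]. *)
Definition slope_center n (x : 'I_n -> R * R) : R :=
  corr x * Num.sqrt (s22 x) / Num.sqrt (s11 x).

(** The coefficient of the random ratio in [theta1_star]. For a nondegenerate sample, s11 times its
    square is the residual sum of squares s22 (1 - r^2). *)
Definition slope_scale n (x : 'I_n -> R * R) : R :=
  Num.sqrt (1 - corr x ^+ 2) * Num.sqrt (s22 x) / Num.sqrt (s11 x).

Lemma slope_scale_ge0 n (x : 'I_n -> R * R) : 0 <= slope_scale x.
Proof. by rewrite /slope_scale; nonneg. Qed.

(* Holds for degenerate samples too: then [slope_scale x = 0]. *)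
Lemma quantile_theta1_star n b (x : 'I_n -> R * R) q : 0 < n%:R - b ->
  0 < ratio_cdf (n%:R - b) q < 1 ->
  quantile (theta1_star_prob b x) (ratio_cdf (n%:R - b) q) =
  slope_center x + slope_scale x * q.
Proof.
move=> m0 /andP[q0 q1]; apply: quantile_eq => t.
rewrite /theta1_star_prob /pushforward.
have -> : theta1_star x @^-1` `]-oo, t] =
    [set w | slope_center x - w.2 / Num.sqrt w.1 * slope_scale x <= t].
  by apply/seteqP; split=> w /=; rewrite in_itv/=.
(* When the scale is 0, [theta1_star x] is constant and its distribution function takes only the
   values 0 and 1; every level strictly between them has that constant as quantile. *)
have [s0|s0] := eqVneq (slope_scale x) 0.
  rewrite s0 mul0r addr0; under eq_set do rewrite mulr0 subr0.
  have [ct|ct] := leP (slope_center x) t.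
    rewrite (_ : [set _ | _] = setT); last by apply/seteqP; split.
    by rewrite chi2_normal_prob_setT// lee_fin ltW.
  rewrite (_ : [set _ | _] = set0); last by apply/seteqP; split => // w /=.
  by rewrite chi2_normal_probE// integral0_eq ?lee_fin ?leNgt ?q0// => v _; rewrite xsection0 measure0 mule0.
have {}s0 : 0 < slope_scale x by rewrite lt_neqAle eq_sym s0 slope_scale_ge0.
(* The minus sign in [theta1_star] produces an upper tail, which symmetry of the ratio turns back
   into a lower one. *)
rewrite (_ : [set _ | _] = [set w | (slope_center x - t) / slope_scale x <= w.2 / Num.sqrt w.1]).
  rewrite ratio_prob_ge// lee_fin ratio_cdf_le// -mulNr opprB ler_pdivlMr//.
  by rewrite lerBrDl mulrC.
by apply/seteqP; split=> w /=; rewrite ler_pdivrMr// lerBlDr lerBlDl.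
Qed.

Lemma ratio_cdf_inj_dof m m' q : 0 < m -> 0 < m' -> q != 0 ->
  ratio_cdf m q = ratio_cdf m' q -> m = m'.
Proof.
move=> m0 m'0 q0.
wlog qp : q q0 / 0 < q.
  move=> W e; have [/W|qn|/eqP] := ltgtP 0 q; [exact| |by rewrite eq_sym (negPf q0)].
  apply: (W (- q)); rewrite ?oppr_eq0 ?oppr_gt0//.
  by rewrite !ratio_cdfN// e.
move=> e; have [mm|mm|//] := ltgtP m m'.
  by have := ratio_cdf_lt_dof m0 mm qp; rewrite e ltxx.
by have := ratio_cdf_lt_dof m'0 mm qp; rewrite e ltxx.
Qed.

(** This isolates what remains once the sampling distribution is known: [coverage] is any function
    of the level which, at the quantile for n - b degrees of freedom, is the distribution function
    for n - 2. *)
Lemma matching_of_coverage n (b : R) (coverage : R -> \bar R) :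
  (3 <= n)%N -> b < n%:R ->
  (forall alpha q, 0 < alpha < 1 -> ratio_cdf (n%:R - b) q = 1 - alpha ->
     coverage alpha = (ratio_cdf (n%:R - 2) q)%:E) ->
  (forall alpha : R, 0 < alpha < 1 ->
     coverage alpha =
       student_prob (n%:R - 2)
         [set t | t < Num.sqrt ((n%:R - 2) / (n%:R - b))
                      * quantile (student_prob (n%:R - b)) (1 - alpha)]
     /\ (alpha != 1 / 2 -> (coverage alpha = (1 - alpha)%:E <-> b = 2)))
  /\ ((forall alpha : R, 0 < alpha < 1 -> coverage alpha = (1 - alpha)%:E)
      <-> b = 2).
Proof.
move=> n3 bn H.
have mb0 : 0 < n%:R - b by rewrite subr_gt0.
have m20 : 0 < n%:R - 2 :> R by rewrite subr_gt0 (ltr_nat R 2).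
have ex alpha : 0 < alpha < 1 -> exists q, ratio_cdf (n%:R - b) q = 1 - alpha.
  move=> /andP[a0 a1]; apply: ratio_quantile_exists => //.
  by rewrite subr_gt0 a1 ltrBlDr ltrDl.
have iff alpha : 0 < alpha < 1 -> alpha != 1 / 2 ->
    (coverage alpha = (1 - alpha)%:E <-> b = 2).
  move=> a01 a12; have [q qE] := ex _ a01; rewrite (H _ q)// -qE; split.
    have q0 : q != 0.
      apply: contra a12 => /eqP q0; move: qE; rewrite q0 ratio_cdf0// => e.
      by apply/eqP; lra.
    by move=> [] /(ratio_cdf_inj_dof m20 mb0 q0)/addrI/oppr_inj.
  by move=> ->.
split.
  move=> alpha a01; split; last exact: iff.
  have [q qE] := ex _ a01; rewrite (H _ q)// -qE quantile_student// student_prob_lt//.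
  congr (ratio_cdf _ _)%:E; rewrite sqrtrM ?ltW// sqrtrV ?ltW//.
  by field; rewrite !gt_eqF ?sqrtr_gt0.
split => [cov|b2 alpha a01].
  (* Any level in ]0, 1[ other than 1/2 would serve. *)
  apply/(iff (1 / 4)); [lra| |apply: cov; lra].
  by apply/eqP; lra.
have [q qE] := ex _ a01; rewrite (H _ q)// -qE; congr (ratio_cdf _ _)%:E.
by rewrite b2.
Qed.

End quantiles.

(** * Independence of a recursive statistic from later observations *)

Section independence.
Context d (T : measurableType d) (R : realType) (P : probability T R).
Context d' (V : measurableType d') (n : nat) (X : 'I_n -> {RV P >-> V}).
Context dS (S : measurableType dS) (s0 : S) (U : nat -> S * V -> S).
Hypothesis X_indep : mutually_independent X.
Hypothesis mU : forall k, measurable_fun setT (U k).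

(** A state updated by one observation at a time: for k <= n, [running k] depends only on the
    observations of index less than k. Past index n it takes the default value [s0]. *)
Fixpoint running (k : nat) (w : T) : S :=
  if k is k'.+1 then
    oapp (fun i : 'I_n => U k' (running k' w, X i w)) s0 (insub k')
  else s0.

Lemma runningS (i : 'I_n) w : running i.+1 w = U i (running i w, X i w).
Proof. by rewrite /= insubT//= => ilt; congr (U _ (_, X _ _)); exact: val_inj. Qed.

Lemma measurable_running k : measurable_fun setT (running k).
Proof.
elim: k => [|k IH] /=; first exact: measurable_cst.
case: insubP => [i _ _|_] /=; last exact: measurable_cst.
apply: (measurable_app (mU k)); apply: measurable_fun_pair => //.
Qed.

Let E (J : {set 'I_n}) (B : 'I_n -> set V) :=
  \bigcap_(k in [set k | k \in J]) X k @^-1` B k.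

Let mX i (B : set V) : measurable B -> measurable (X i @^-1` B).
Proof. by move=> mB; exact: measurable_funPTI. Qed.

Let mE (J : {set 'I_n}) (B : 'I_n -> set V) : (forall k, k \in J -> measurable (B k)) -> measurable (E J B).
Proof.
move=> mB; apply: fin_bigcap_measurable; first exact: finite_finset.
by move=> k /= kJ; apply: mX; exact: mB.
Qed.

Let PE (J : {set 'I_n}) (B : 'I_n -> set V) : (forall k, k \in J -> measurable (B k)) ->
  P (E J B) = (\prod_(k in J) P (X k @^-1` B k))%E.
Proof. exact: X_indep. Qed.

Let E1 (i : 'I_n) (B : set V) : E [set i]%SET (fun=> B) = X i @^-1` B.
Proof.
apply/seteqP; split => w /=; first by move=> h; apply: h; rewrite /= set11.
by move=> h k /=; rewrite finset.in_set1 => /eqP ->.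
Qed.

Let joint (i : 'I_n) (w : T) := (running i w, X i w).

Let mjoint i : measurable_fun setT (joint i).
Proof. by apply: measurable_fun_pair => //; exact: measurable_running. Qed.

Let mprej i (C : set (S * V)) : measurable C -> measurable (joint i @^-1` C).
Proof. by move=> mC; rewrite -[X in measurable X]setTI; apply: mjoint. Qed.

(* [E J B] is an event on the observations in [J], none of which enters [running k]. *)
Lemma running_indep k : (k <= n)%N ->
  forall (J : {set 'I_n}) B (A : set S), (forall j, j \in J -> (k <= j)%N) ->
  (forall j, j \in J -> measurable (B j)) -> measurable A ->
  P (running k @^-1` A `&` E J B) = (P (running k @^-1` A) * P (E J B))%E.
Proof.
elim: k => [_|k IH kn] J B A kJ mB mA.
  have [As|As] := pselect (A s0).
    rewrite (_ : running 0 @^-1` A = setT) ?setTI ?probability_setT ?mul1e//.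
    by apply/seteqP; split.
  rewrite (_ : running 0 @^-1` A = set0) ?set0I ?measure0 ?mul0e//.
  by apply/seteqP; split.
pose i := Ordinal kn.
have iJ : i \notin J by apply/negP => /kJ /=; rewrite ltnn.
have mEJ := mE mB.
have -> : running k.+1 @^-1` A = joint i @^-1` (U k @^-1` A).
  by apply/seteqP; split => w; rewrite /= -/(running i.+1 w) (runningS i).
have mC : measurable (U k @^-1` A).
  by rewrite -[X in measurable X]setTI; exact: mU.
move: (U k @^-1` A) mC => C mC.
have mh1 : measurable_fun setT (\1_(E J B) : T -> R) by exact: measurable_indic.
have h10 w : 0 <= \1_(E J B) w :> R by nonneg.
have mh2 : measurable_fun setT (fun _ : T => fine (P (E J B))) by exact: measurable_cst.
have h20 (w : T) : 0 <= fine (P (E J B)) by exact: fine_ge0.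
(* [m1] and [m2] send C to the probability of the joint event and to the product of the
   probabilities. They are finite measures on the product space, so agreement on rectangles
   suffices. *)
pose m1 := transport_measure P mh1 h10 (mjoint i).
pose m2 := transport_measure P mh2 h20 (mjoint i).
have m1E C' : measurable C' -> m1 C' = P (joint i @^-1` C' `&` E J B).
  move=> mC'; rewrite /m1 /= /transport.
  rewrite -[X in P X]setIT -integral_indic//; last by apply: measurableI => //; exact: mprej.
  apply: eq_integral => w _; rewrite -EFinM; congr EFin.
  by rewrite setIC indicI.
have m2E C' : measurable C' -> m2 C' = (P (joint i @^-1` C') * P (E J B))%E.
  move=> mC'; rewrite /m2 /= /transport ge0_integralZl_EFin; [|exact: measurableT|by move=> w _; rewrite lee_fin| |exact: fine_ge0]; last first.
    apply: measurable_EFin; apply: (measurable_app (h := \1_C' : _ -> R)); last exact: mjoint.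
    exact: measurable_indic.
  rewrite fineK ?fin_num_measure// muleC; congr (_ * _)%E.
  by rewrite -[X in P X]setIT -integral_indic//; exact: mprej.
suff : m1 C = m2 C by rewrite m1E// m2E.
pose G : set (set (S * V)) :=
  [set D | exists A, measurable A /\ exists B, measurable B /\ D = A `*` B].
apply: (measure_unique G (fun=> setT)) => //.
- rewrite measurable_prod_measurableType//; congr (<<s _ >>).
  rewrite predeqE; split => [[A' mA' [B' mB' <-]]|[A' [mA' [B' [mB' ->]]]]].
    by exists A'; split => //; exists B'.
  by exists A' => //; exists B'.
- move=> _ _ [X1 [mX1 [X2 [mX2 ->]]]] [Y1 [mY1 [Y2 [mY2 ->]]]].
  rewrite -setXI; exists (X1 `&` Y1); split; first exact: measurableI.
  by exists (X2 `&` Y2); split => //; exact: measurableI.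
- by move=> _; exists setT; split => //; exists setT; rewrite setXTT.
- by rewrite bigcup_const.
- move=> _ [A' [mA' [B' [mB' ->]]]].
  have mAB : measurable (A' `*` B') by exact: measurableX.
  rewrite m1E// m2E//.
  have -> : joint i @^-1` (A' `*` B') = running k @^-1` A' `&` X i @^-1` B'.
    by apply/seteqP; split.
  (* On a rectangle, the condition on [X i] is moved into the event on later observations, so that
     the induction hypothesis at k applies to [i |: J]. *)
  pose B2 j := if j == i then B' else B j.
  have EU : E (i |: J) B2 = X i @^-1` B' `&` E J B.
    apply/seteqP; split => w.
      move=> h; split; first by have := h i; rewrite /= /B2 eqxx; apply; rewrite finset.in_setU1 eqxx.
      move=> j jJ; have := h j; rewrite /= /B2; case: eqP => [ji|_]; last by apply; rewrite finset.in_setU1 jJ orbT.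
      by move: iJ; rewrite -ji jJ.
    move=> [h1 h2] j /=; rewrite finset.in_setU1 /B2; case: eqP => [->//|_ /= jJ]; exact: h2.
  have mB2 j : j \in i |: J -> measurable (B2 j).
    by rewrite finset.in_setU1 /B2; case: eqP => //= _; exact: mB.
  rewrite -setIA -EU IH//; last 2 first.
    - exact: ltnW.
    - by move=> j; rewrite finset.in_setU1 => /predU1P[->//|/kJ/ltnW].
  rewrite -(E1 i B') IH//; [| exact: ltnW | by move=> j; rewrite finset.in_set1 => /eqP ->].
  rewrite -muleA; congr (_ * _)%E.
  rewrite PE// big_setU1//= PE// PE// big_set1 /B2 eqxx; congr (_ * _)%E.
  apply: eq_bigr => j jJ; case: eqP => // ji; by move: iJ; rewrite -ji jJ.
- move=> _; apply: (@le_lt_trans _ _ 1%E); last exact: ltry.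
  by rewrite m1E//; apply: probability_le1; rewrite preimage_setT setTI.
Qed.

(** By independence the joint law of the state and the next observation is the product of their
    laws; Tonelli's theorem then separates the integrals. *)
Lemma integral_running (i : 'I_n) (F : S * V -> \bar R) :
  measurable_fun setT F -> (forall z, 0 <= F z)%E ->
  (\int[P]_w F (running i w, X i w) =
   \int[P]_w \int[distribution P (X i)]_x F (running i w, x))%E.
Proof.
move=> mF F0.
pose mi := isMeasurableFun.Build _ _ _ _ (running i) (measurable_running i).
pose Si : {mfun T >-> S} := HB.pack (running i) mi.
pose mj := isMeasurableFun.Build _ _ _ _ (joint i) (mjoint i).
pose Zi : {mfun T >-> (S * V)%type} := HB.pack (joint i) mj.
have PEE : forall C, measurable C -> (distribution P Si \x distribution P (X i))%E C = distribution P Zi C.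
  apply: product_measure_unique => A B mA mB.
  rewrite /distribution /pushforward /=.
  transitivity (P (running i @^-1` A `&` E [set i]%SET (fun=> B))).
    by congr (P _); rewrite E1; apply/seteqP; split.
  rewrite running_indep//; [by rewrite E1|exact: ltnW|].
  by move=> j; rewrite finset.in_set1 => /eqP ->.
have -> : (\int[P]_w F (running i w, X i w) = \int[distribution P Zi]_z F z)%E.
  by rewrite ge0_integral_pushforward// ?preimage_setT//; move=> z _.
have -> : (\int[P]_w \int[distribution P (X i)]_x F (running i w, x) =
    \int[distribution P Si]_s \int[distribution P (X i)]_x F (s, x))%E.
  rewrite ge0_integral_pushforward ?preimage_setT//; last by move=> z _; nonneg.
  exact: (measurable_fun_fubini_tonelli_F F).
rewrite -(fubini_tonelli1 F)//.
apply: eq_measure_integral => C mC _; exact: (esym (PEE C mC)).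
Qed.

End independence.

(** * The bivariate normal density as a regression *)

Section bivariate_normal_law.
Variable R : realType.
Local Notation leb := (@lebesgue_measure R).
Local Notation N := (@normal_prob R 0 1).

(** Elimination of the first column: the lower triangular factor contains the regression slope rho
    s2 / s1. *)
Lemma det_cov_mx (s1 s2 rho : R) : s1 != 0 ->
  \det (cov_mx s1 s2 rho) = s1 ^+ 2 * (s2 ^+ 2 * (1 - rho ^+ 2)).
Proof.
move=> s10.
have -> : cov_mx s1 s2 rho =
   block_mx 1%:M 0 (rho * s2 / s1)%:M 1%:M *m
   block_mx (s1 ^+ 2)%:M (rho * s1 * s2)%:M 0 (s2 ^+ 2 * (1 - rho ^+ 2))%:M :> 'M[R]_(1 + 1).
  rewrite mulmx_block !mul1mx !mul0mx !addr0 -!scalar_mxM -raddfD /cov_mx.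
  by congr (block_mx _ _ _%:M _%:M); field.
by rewrite det_mulmx det_lblock det_ublock !det_scalar1 !mul1r.
Qed.

Lemma invmx_cov_mx (s1 s2 rho : R) : s1 != 0 -> s2 != 0 -> 1 - rho ^+ 2 != 0 ->
  invmx (cov_mx s1 s2 rho) =
  block_mx (s1 ^+ 2 * (1 - rho ^+ 2))^-1%:M (- rho / (s1 * s2 * (1 - rho ^+ 2)))%:M
           (- rho / (s1 * s2 * (1 - rho ^+ 2)))%:M (s2 ^+ 2 * (1 - rho ^+ 2))^-1%:M.
Proof.
move=> s10 s20 r0; set B := block_mx _ _ _ _.
have SB : cov_mx s1 s2 rho *m B = 1%:M.
  rewrite /cov_mx /B mulmx_block -!scalar_mxM -!raddfD (@scalar_mx_block _ 1 1).
  have z : (0 : 'M[R]_1) = 0%:M by rewrite raddf0.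
  by rewrite z; congr (block_mx _%:M _%:M _%:M _%:M); field; rewrite ?s10 ?s20 ?r0.
have [uS _] := mulmx1_unit SB.
by rewrite -[LHS]mulmx1 -SB mulKmx.
Qed.

(** Completing the square: the marginal density of the first coordinate times the conditional
    density of the second, with slope rho s2 / s1 and residual standard deviation [tau]. *)
Lemma bvn_pdfE (m1 m2 s1 s2 rho x y : R) : 0 < s1 -> 0 < s2 -> `|rho| < 1 ->
  let tau := s2 * Num.sqrt (1 - rho ^+ 2) in
  bvn_pdf (m1, m2) (cov_mx s1 s2 rho) (x, y) =
  normal_pdf 0 1 ((x - m1) / s1) *
  normal_pdf 0 1 ((y - m2 - rho * s2 / s1 * (x - m1)) / tau) / (s1 * tau).
Proof.
move=> s10 s20 rho1 tau.
have r0 : 0 < 1 - rho ^+ 2.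
  by rewrite subr_gt0 -real_normK ?num_real// expr_lt1.
have sr0 : 0 < Num.sqrt (1 - rho ^+ 2) by rewrite sqrtr_gt0.
have sr2 : Num.sqrt (1 - rho ^+ 2) ^+ 2 = 1 - rho ^+ 2 by rewrite sqr_sqrtr// ltW.
rewrite /bvn_pdf det_cov_mx ?gt_eqF// invmx_cov_mx ?gt_eqF//.
have -> : Num.sqrt (s1 ^+ 2 * (s2 ^+ 2 * (1 - rho ^+ 2))) = s1 * tau.
  by rewrite (sqrtrM _ (sqr_ge0 s1)) (sqrtrM _ (sqr_ge0 s2)) !sqrtr_sqr !gtr0_norm.
have -> : vec2 (x, y) - vec2 (m1, m2) = row_mx (x - m1)%:M (y - m2)%:M.
  by rewrite /vec2 opp_row_mx add_row_mx -!raddfN -!raddfD.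
have scalarD (a b : R) : a%:M + b%:M = (a + b)%:M :> 'M[R]_1 by rewrite raddfD.
rewrite mul_row_block tr_row_mx !tr_scalar_mx mul_row_col -!scalar_mxM !scalarD.
rewrite -!scalar_mxM scalarD mxE eqxx mulr1n !std_normal_pdfE [in RHS]mulrACA -[in RHS]expRD.
have -> : normal_peak 1 * normal_peak 1 = (2 * pi)^-1 :> R.
  rewrite /normal_peak -invfM -expr2 sqr_sqrtr; last first.
    by rewrite expr1n mul1r mulrn_wge0// pi_ge0.
  by rewrite expr1n mul1r mulr_natl.
suff -> : - (((x - m1) * (s1 ^+ 2 * (1 - rho ^+ 2))^-1 +
      (y - m2) * (- rho / (s1 * s2 * (1 - rho ^+ 2)))) * (x - m1) +
     ((x - m1) * (- rho / (s1 * s2 * (1 - rho ^+ 2))) +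
      (y - m2) * (s2 ^+ 2 * (1 - rho ^+ 2))^-1) * (y - m2)) / 2 =
    - ((x - m1) / s1) ^+ 2 / 2 + - ((y - m2 - rho * s2 / s1 * (x - m1)) / tau) ^+ 2 / 2.
  by rewrite [(2 * pi * _)^-1]invfM mulrA [expR _ * _]mulrC.
rewrite /tau.
transitivity (- ((x - m1) ^+ 2 / s1 ^+ 2 + (y - m2 - rho * s2 / s1 * (x - m1)) ^+ 2 / (s2 ^+ 2 * (1 - rho ^+ 2))) / 2).
  by field; rewrite !gt_eqF.
rewrite -{1}sr2; field.
by rewrite !gt_eqF.
Qed.

(** Two affine substitutions in the factored density, the inner one with a shift depending on g.
    [bvn_prob] is a plain set function, hence the measure [nu] that coincides with it. *)
Lemma integral_bvn_prob (nu : {measure set (R * R) -> \bar R}) (m1 m2 s1 s2 rho : R)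
    (F : R * R -> \bar R) :
  0 < s1 -> 0 < s2 -> `|rho| < 1 ->
  (forall A, measurable A -> nu A = bvn_prob (m1, m2) (cov_mx s1 s2 rho) A) ->
  measurable_fun setT F -> (forall z, 0 <= F z)%E ->
  (\int[nu]_z F z = \int[N]_g \int[N]_e
     F (m1 + s1 * g, m2 + rho * s2 * g + s2 * Num.sqrt (1 - rho ^+ 2) * e)%R)%E.
Proof.
move=> s10 s20 rho1 nuE mF F0.
pose tau := s2 * Num.sqrt (1 - rho ^+ 2).
have tau0 : 0 < tau.
  by rewrite mulr_gt0// sqrtr_gt0 subr_gt0 -real_normK ?num_real// expr_lt1.
pose f (z : R * R) := normal_pdf 0 1 ((z.1 - m1) / s1) *
  normal_pdf 0 1 ((z.2 - m2 - rho * s2 / s1 * (z.1 - m1)) / tau) / (s1 * tau).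
have mf : measurable_fun setT f by rewrite /f; measurability.
have f0 z : 0 <= f z by rewrite /f divr_ge0 ?mulr_ge0 ?normal_pdf_ge0// ltW.
have -> : (\int[nu]_z F z = \int[leb \x leb]_z ((f z)%:E * F z))%E.
  apply: (@integral_transport _ _ (measurableTypeR R * measurableTypeR R)%type (R * R)%type R
    (leb \x leb)%E f id mf f0 (@measurable_id _ _ setT) nu) => // A mA.
  rewrite nuE// /bvn_prob integral_mkcond.
  transitivity (\int[leb \x leb]_z ((f z)%:E * (\1_A z)%:E))%E; last by [].
  apply: eq_integral => -[x y] _; rewrite patchE indicE bvn_pdfE//.
  by case: ifPn => _; rewrite ?mule1 ?mule0.
etransitivity.
  apply: (@fubini_tonelli1 _ _ (measurableTypeR R) (measurableTypeR R) R leb leb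
    (fun z => ((f z)%:E * F z)%E)); [by measurability|by nonneg].
rewrite (@integral_normal2 _ (fun z => F (m1 + s1 * z.1, m2 + rho * s2 * z.1 + tau * z.2)%R)); [|by measurability|by nonneg].
rewrite /fubini_F [LHS](@integral_affine _ s1 m1); [|by rewrite gt_eqF|by measurability|by nonneg].
rewrite -ge0_integralZl_EFin; [|exact: measurableT|by nonneg|by measurability|by nonneg].
apply: eq_integral => g _.
rewrite [X in (_ * X)%E = _](@integral_affine _ tau (m2 + rho * s2 * g)); [|by rewrite gt_eqF|by measurability|by nonneg].
rewrite -ge0_integralZl_EFin; [|exact: measurableT|by nonneg|by measurability|by nonneg].
rewrite -ge0_integralZl_EFin; [|exact: measurableT|by nonneg|by measurability|by nonneg].
apply: eq_integral => e _; rewrite !muleA -!EFinM !gtr0_norm//.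
congr (_%:E * F (_, _))%E => /=; [|by ring|by ring].
rewrite /f/= (_ : (s1 * g + m1 - m1) / s1 = g); last by field; rewrite gt_eqF.
rewrite (_ : (_ - rho * s2 / s1 * _) / tau = e); last by field; rewrite !gt_eqF.
by field; rewrite !gt_eqF.
Qed.

End bivariate_normal_law.

Lemma integral_swap13 d1 d2 d3 (T1 : measurableType d1) (T2 : measurableType d2)
    (T3 : measurableType d3) (R : realType) (m1 : {sigma_finite_measure set T1 -> \bar R})
    (m2 : {sigma_finite_measure set T2 -> \bar R})
    (m3 : {sigma_finite_measure set T3 -> \bar R}) (F : T1 -> T2 -> T3 -> \bar R) :
  measurable_fun setT (fun z : T1 * T2 * T3 => F z.1.1 z.1.2 z.2) ->
  (forall x y z, (0 <= F x y z)%E) ->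
  (\int[m1]_x \int[m2]_y \int[m3]_z F x y z = \int[m3]_z \int[m2]_y \int[m1]_x F x y z)%E.
Proof.
move=> mF F0.
have mF' d (T : measurableType d) (f1 : T -> T1) (f2 : T -> T2) (f3 : T -> T3) :
    measurable_fun setT f1 -> measurable_fun setT f2 -> measurable_fun setT f3 ->
    measurable_fun setT (fun t => F (f1 t) (f2 t) (f3 t)).
  move=> mf1 mf2 mf3.
  apply: (measurable_app (f := fun t => (f1 t, f2 t, f3 t)) mF).
  by apply: measurable_fun_pair => //; exact: measurable_fun_pair.
transitivity (\int[m1]_x \int[m3]_z \int[m2]_y F x y z)%E.
  apply: eq_integral => x _; apply: integral_swap => //.
  by apply: mF'; measurability.
rewrite integral_swap; last 2 first.
- apply: measurable_integral; last by move=> z; exact: F0.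
  by apply: mF'; measurability.
- by move=> x y; apply: integral_ge0 => z _; exact: F0.
apply: eq_integral => z _; apply: integral_swap => //.
by apply: mF'; measurability.
Qed.

(** * Sums of rank-one matrices and Bartlett's decomposition *)

Section wishart.
Variable R : realType.
Local Notation N := (@normal_prob R 0 1).
Local Notation triple := (R * R * R)%type.
Implicit Types (H : triple -> \bar R).

Definition wishart_step H (q : triple) : \bar R :=
  (\int[N]_g \int[N]_e H (q.1.1 + g ^+ 2, q.1.2 + g * e, q.2 + e ^+ 2)%R)%E.

(* Expectation of [H] at the sum of [m] independent matrices [d d^T], [d] standard bivariate normal,
   a symmetric matrix being encoded by its three entries. *)
Definition wishart m H : \bar R := iter m wishart_step H (0, 0, 0)%R.

Lemma wishartS m H : wishart m.+1 H = wishart m (wishart_step H).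
Proof. by rewrite /wishart iterSr. Qed.

Lemma measurable_wishart_step H : measurable_fun setT H -> (forall q, 0 <= H q)%E ->
  measurable_fun setT (wishart_step H).
Proof. by move=> mH H0; rewrite /wishart_step; measurability. Qed.

Lemma wishart_step_ge0 H q : (forall q, 0 <= H q)%E -> (0 <= wishart_step H q)%E.
Proof. by move=> H0; rewrite /wishart_step; nonneg. Qed.

(** Zero degrees of freedom means the point mass at 0; this makes the decomposition meaningful for a
    single rank-one term. *)
Definition chi2_nat (j : nat) : {sigma_finite_measure set R -> \bar R} :=
  if j is j'.+1 then chi2_prob j'.+1%:R else \d_(0 : R).

Lemma integral_chi2_nat0 (f : R -> \bar R) : measurable_fun setT f ->
  (\int[chi2_nat 0]_v f v = f 0%R)%E.
Proof. by move=> mf; rewrite /chi2_nat integral_dirac// diracT mul1e. Qed.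

Lemma integral_chi2_natS j (f : R -> \bar R) :
  measurable_fun setT f -> (forall v, 0 <= f v)%E ->
  (\int[chi2_nat j]_v \int[N]_w f (v + w ^+ 2)%R = \int[chi2_nat j.+1]_v f v)%E.
Proof.
move=> mf f0; case: j => [|j].
  rewrite integral_chi2_nat0; last by measurability.
  under eq_integral do rewrite add0r.
  exact: integral_normal_sqr.
have -> : chi2_nat j.+2 = chi2_prob (j.+1%:R + 1) :> (set R -> \bar R).
  by rewrite /= -(natr1 j.+1).
exact: integral_chi2_normal.
Qed.

Lemma eq_integral_chi2 (m : R) (f g : R -> \bar R) :
  measurable_fun setT f -> (forall v, 0 <= f v)%E ->
  measurable_fun setT g -> (forall v, 0 <= g v)%E ->
  (forall v, (0 < v)%R -> f v = g v) ->
  (\int[chi2_prob m]_v f v = \int[chi2_prob m]_v g v)%E.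
Proof.
move=> mf f0 mg g0 fg; rewrite !integral_chi2//; apply: eq_integral => v _.
by have [v0|v0] := leP v 0; [rewrite chi2_pdf_le0// !mul0e|rewrite fg].
Qed.

(* Bartlett decomposition *)
Lemma wishart_chi2 m H : measurable_fun setT H -> (forall q, 0 <= H q)%E ->
  wishart m.+1 H = (\int[chi2_nat m.+1]_a \int[N]_z \int[chi2_nat m]_v
     H (a, Num.sqrt a * z, v + z ^+ 2)%R)%E.
Proof.
elim: m H => [|m IH] H mH H0.
  pose f a := (\int[N]_z H (a, Num.sqrt a * z, z ^+ 2)%R)%E.
  have mf : measurable_fun setT f by rewrite /f; measurability.
  have f0 a : (0 <= f a)%E by rewrite /f; nonneg.
  transitivity (\int[chi2_nat 1]_a f a)%E; last first.
    apply: eq_integral => a _; apply: eq_integral => z _.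
    by rewrite integral_chi2_nat0 ?add0r//; measurability.
  rewrite -(integral_normal_sqr mf f0) /wishart /= /wishart_step.
  apply: eq_integral => g _; rewrite /f sqrtr_sqr !add0r.
  (* For fixed g, the symmetry of e allows g e to be replaced by |g| e, which is sqrt (g^2) e. *)
  have [g0|g0] := leP 0 g.
    by apply: eq_integral => e _; rewrite !add0r ger0_norm.
  rewrite -(@integral_normalN _ (fun e => H (g ^+ 2, `|g| * e, e ^+ 2)%R)); [|by measurability|by nonneg].
  by apply: eq_integral => e _; rewrite !add0r ltr0_norm// mulrNN sqrrN.
have mK := measurable_wishart_step mH H0.
have K0 q : (0 <= wishart_step H q)%E by exact: wishart_step_ge0.
rewrite wishartS (IH _ mK K0).
have mK2 : measurable_fun setT (fun a : R => \int[N]_z \int[chi2_nat m]_v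
    wishart_step H (a, Num.sqrt a * z, v + z ^+ 2)%R)%E by measurability.
(* The target with its first entry frozen at a and its chi-squared variable with m + 1 degrees of
   freedom split as v + w^2. *)
have [f fE] : exists f : R -> \bar R, forall a, (f a = \int[chi2_nat m]_v \int[N]_z \int[N]_w
    H (a, Num.sqrt a * z, v + w ^+ 2 + z ^+ 2)%R)%E by eexists.
have mf : measurable_fun setT f by rewrite (funext fE); measurability.
have f0 a : (0 <= f a)%E by rewrite fE; nonneg.
transitivity (\int[chi2_nat m.+1]_a \int[N]_g f (a + g ^+ 2)%R)%E.
  apply: eq_integral_chi2 => //; [by nonneg|by measurability|by nonneg|].
  move=> a a0; under [RHS]eq_integral do rewrite fE.
  rewrite /wishart_step /= {f fE mf f0 mK mK2 K0 IH}.
  etransitivity.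
    apply: (@integral_swap13 _ _ _ _ _ _ _ N (chi2_nat m) N (fun z v g => \int[N]_e
      H (a + g ^+ 2, Num.sqrt a * z + g * e, v + z ^+ 2 + e ^+ 2)%R))%E; [by measurability|by nonneg].
  apply: eq_integral => g _.
  apply: eq_integral => v _.
  have ag0 : 0 < a + g ^+ 2 by rewrite ltr_pwDl// sqr_ge0.
  have sag : Num.sqrt (a + g ^+ 2) != 0 by rewrite gt_eqF// sqrtr_gt0.
  have sag2 : Num.sqrt (a + g ^+ 2) ^+ 2 = a + g ^+ 2 by rewrite sqr_sqrtr// ltW.
  have sa2 : Num.sqrt a ^+ 2 = a by rewrite sqr_sqrtr// ltW.
  (* The rotation of (z, e) for which sqrt a z + g e is sqrt (a + g^2) times the first new
     coordinate. The square of the second new coordinate is what v gains. *)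
  pose c := Num.sqrt a / Num.sqrt (a + g ^+ 2).
  pose s := g / Num.sqrt (a + g ^+ 2).
  have cs : c ^+ 2 + s ^+ 2 = 1.
    by rewrite /c /s !expr_div_n sa2 sag2 -mulrDl divff// gt_eqF.
  rewrite -(@integral_normal_rotation _ c s (fun z => H (a + g ^+ 2, Num.sqrt (a + g ^+ 2) * z.1, v + z.2 ^+ 2 + z.1 ^+ 2)%R) cs); [|by measurability|by nonneg].
  apply: eq_integral => z _; apply: eq_integral => e _ /=.
  congr (H (_, _, _)); first by rewrite /c /s; field.
  have -> : v + (- s * z + c * e) ^+ 2 + (c * z + s * e) ^+ 2 = v + (c ^+ 2 + s ^+ 2) * (z ^+ 2 + e ^+ 2).
    by ring.
  by rewrite cs mul1r addrA.
transitivity (\int[chi2_nat m.+2]_a f a)%E; first exact: (integral_chi2_natS m.+1 mf f0).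
apply: eq_integral => a _; rewrite fE {f fE mf f0 mK mK2 K0 IH}.
etransitivity.
  apply: (@integral_swap _ _ _ _ _ (chi2_nat m) N (fun v z => \int[N]_w
    H (a, Num.sqrt a * z, v + w ^+ 2 + z ^+ 2)%R))%E; [by measurability|by nonneg].
apply: eq_integral => z _.
apply: (@integral_chi2_natS m (fun v => H (a, Num.sqrt a * z, v + z ^+ 2)%R)); [by measurability|by nonneg].
Qed.

End wishart.

(** * Algebra of cross deviations *)

Section deviations.
Variables (R : realType) (n : nat).
Implicit Types (u v g e : 'I_n -> R).

Lemma cross_devE u v :
  cross_dev u v = \sum_k u k * v k - n%:R^-1 * (\sum_k u k) * (\sum_k v k).
Proof.
rewrite /cross_dev /sample_mean.
have [n0|n0] := posnP n.
  by move: u v; rewrite n0 => u v; rewrite !big_ord0 !mulr0 subr0.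
set U := \sum_k u k; set V := \sum_k v k.
transitivity (\sum_k (u k * v k - n%:R^-1 * V * u k - n%:R^-1 * U * v k + n%:R^-1 ^+ 2 * U * V)).
  by apply: eq_bigr => k _; ring.
rewrite !big_split/= !sumrN -!mulr_sumr -/U -/V sumr_const card_ord -mulr_natr.
by field; rewrite pnatr_eq0 -lt0n.
Qed.

Lemma cross_dev_affine g e (a b c a' b' c' : R) :
  cross_dev (fun k => a + b * g k + c * e k) (fun k => a' + b' * g k + c' * e k) =
  b * b' * cross_dev g g + (b * c' + c * b') * cross_dev g e + c * c' * cross_dev e e.
Proof.
have meanE (x y z : R) k : x + y * g k + z * e k - sample_mean (fun k => x + y * g k + z * e k) =
    y * (g k - sample_mean g) + z * (e k - sample_mean e).
  have n0 : n%:R != 0 :> R by case: (n) k => [[]//|m _]; rewrite pnatr_eq0.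
  rewrite /sample_mean !big_split/= -!mulr_sumr sumr_const card_ord -mulr_natr.
  by field.
rewrite /cross_dev !mulr_sumr -!big_split/=; apply: eq_bigr => k _.
by rewrite !meanE; ring.
Qed.

End deviations.

(** * The slope estimate as a function of the scatter matrix *)

Section slope.
Variable R : realType.
Local Notation triple := (R * R * R)%type.

(* Entry-wise versions of [slope_center] and [slope_scale]: [t = (s11, s12, s22)]. *)
Definition center_of (t : triple) : R :=
  t.1.2 / Num.sqrt (t.1.1 * t.2) * Num.sqrt t.2 / Num.sqrt t.1.1.

Definition scale_of (t : triple) : R :=
  Num.sqrt (1 - (t.1.2 / Num.sqrt (t.1.1 * t.2)) ^+ 2) * Num.sqrt t.2 / Num.sqrt t.1.1.

Lemma center_ofE t : 0 < t.1.1 -> 0 < t.2 -> center_of t = t.1.2 / t.1.1.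
Proof.
move=> t1 t2; rewrite /center_of sqrtrM ?ltW//.
have a : Num.sqrt t.2 != 0 by rewrite gt_eqF// sqrtr_gt0.
have b : Num.sqrt t.1.1 != 0 by rewrite gt_eqF// sqrtr_gt0.
rewrite -[X in _ = _ / X]sqr_sqrtr ?ltW//.
by field; rewrite a b.
Qed.

Lemma scale_ofE t : 0 < t.1.1 -> 0 < t.2 ->
  scale_of t = Num.sqrt (t.1.1 * t.2 - t.1.2 ^+ 2) / t.1.1.
Proof.
move=> t1 t2; have t12 : 0 < t.1.1 * t.2 by exact: mulr_gt0.
rewrite /scale_of expr_div_n sqr_sqrtr ?ltW//.
have -> : 1 - t.1.2 ^+ 2 / (t.1.1 * t.2) = (t.1.1 * t.2)^-1 * (t.1.1 * t.2 - t.1.2 ^+ 2).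
  by field; rewrite !gt_eqF.
rewrite sqrtrM ?invr_ge0 ?ltW// sqrtrV ?ltW// sqrtrM ?ltW//.
have a : Num.sqrt t.2 != 0 by rewrite gt_eqF// sqrtr_gt0.
have b : Num.sqrt t.1.1 != 0 by rewrite gt_eqF// sqrtr_gt0.
rewrite -[X in _ = _ / X]sqr_sqrtr ?ltW//.
by field; rewrite a b.
Qed.

Lemma measurable_center_of : measurable_fun setT center_of.
Proof. by rewrite /center_of; measurability. Qed.

Lemma measurable_scale_of : measurable_fun setT scale_of.
Proof. by rewrite /scale_of; measurability. Qed.

End slope.

(** * Helmert's recursion for the mean and the scatter matrix *)

Section helmert.
Variable R : realType.
Local Notation N := (@normal_prob R 0 1).
Local Notation state := (R * R * (R * R * R))%type.

(** The pairs (a, g) and (b, e) are rotated by the same angle, one pair at a time, after reordering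
    the integrals. *)
Lemma integral_normal_rotation2 (c s : R) (F : R * R * (R * R) -> \bar R) :
  c ^+ 2 + s ^+ 2 = 1 -> measurable_fun setT F -> (forall z, 0 <= F z)%E ->
  (\int[N]_a \int[N]_b \int[N]_g \int[N]_e
     F ((c * a + s * g, c * b + s * e), (- s * a + c * g, - s * b + c * e))%R =
   \int[N]_g \int[N]_e \int[N]_a \int[N]_b F ((a, b), (g, e)))%E.
Proof.
move=> cs mF F0.
transitivity (\int[N]_a \int[N]_g \int[N]_b \int[N]_e
    F ((c * a + s * g, c * b + s * e), (- s * a + c * g, - s * b + c * e))%R)%E.
  apply: eq_integral => a _.
  apply: (@integral_swap _ _ _ _ _ N N (fun b g => \int[N]_e
    F ((c * a + s * g, c * b + s * e), (- s * a + c * g, - s * b + c * e))%R)%E);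
  [by measurability|by nonneg].
transitivity (\int[N]_a \int[N]_g \int[N]_b \int[N]_e
    F ((c * a + s * g, b), (- s * a + c * g, e))%R)%E.
  apply: eq_integral => a _; apply: eq_integral => g _.
  apply: (@integral_normal_rotation _ c s
    (fun z => F ((c * a + s * g, z.1), (- s * a + c * g, z.2))%R) cs); [by measurability|by nonneg].
transitivity (\int[N]_a \int[N]_g \int[N]_b \int[N]_e F ((a, b), (g, e)))%E.
  apply: (@integral_normal_rotation _ c s
    (fun z => \int[N]_b \int[N]_e F ((z.1, b), (z.2, e)))%E cs); [by measurability|by nonneg].
etransitivity.
  apply: (@integral_swap _ _ _ _ _ N N (fun a g => \int[N]_b \int[N]_e F ((a, b), (g, e)))%E);
  [by measurability|by nonneg].
apply: eq_integral => g _; etransitivity.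
  apply: (@integral_swap13 _ _ _ _ _ _ _ N N N (fun a b e => F ((a, b), (g, e)))%E);
  [by measurability|by nonneg].
apply: eq_integral => e _.
apply: (@integral_swap _ _ _ _ _ N N (fun b a => F ((a, b), (g, e)))%E);
[by measurability|by nonneg].
Qed.

(** Cosine and sine of Helmert's rotation: if M is sqrt k times the mean of k points, then c M + s z
    is sqrt (k + 1) times the mean after adding z. *)
Let c (k : nat) : R := Num.sqrt k%:R / Num.sqrt k.+1%:R.
Let s (k : nat) : R := (Num.sqrt k.+1%:R)^-1.

(* The pair (M, Q) of a sample [z_1, ..., z_k] of points of the plane, where [M] is [sqrt k] times the mean
   and [Q] collects the entries of the scatter matrix. Passing from [k] to [k.+1] rotates (M, z_(k.+1)). *)
Definition helmert (k : nat) (S : state) (z : R * R) : state :=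
  let d1 := - s k * S.1.1 + c k * z.1 in
  let d2 := - s k * S.1.2 + c k * z.2 in
  ((c k * S.1.1 + s k * z.1, c k * S.1.2 + s k * z.2),
   (S.2.1.1 + d1 ^+ 2, S.2.1.2 + d1 * d2, S.2.2 + d2 ^+ 2)).

Lemma helmert_rotation k : c k ^+ 2 + s k ^+ 2 = 1.
Proof.
rewrite /c /s exprVn expr_div_n !sqr_sqrtr ?ler0n// -[X in _ + X]mul1r -mulrDl natr1.
by rewrite divff// pnatr_eq0.
Qed.

Lemma measurable_helmert k : measurable_fun setT (fun z : state * (R * R) => helmert k z.1 z.2).
Proof. by rewrite /helmert/=; measurability. Qed.

(** After rotation the new mean and the increment of the scatter matrix are independent, both built
    from standard normals: the mean keeps its law and the scatter gains one rank-one term. *)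
Lemma integral_helmert k (q : R * R * R) (F : state -> \bar R) :
  measurable_fun setT F -> (forall S, 0 <= F S)%E ->
  (\int[N]_a \int[N]_b \int[N]_g \int[N]_e F (helmert k ((a, b), q) (g, e)) =
   wishart_step (fun q => \int[N]_a \int[N]_b F ((a, b), q)) q)%E.
Proof.
move=> mF F0; rewrite /wishart_step /helmert /=.
apply: (@integral_normal_rotation2 (c k) (s k) (fun z => F (z.1,
  (q.1.1 + z.2.1 ^+ 2, q.1.2 + z.2.1 * z.2.2, q.2 + z.2.2 ^+ 2)%R)) (helmert_rotation k));
[by measurability|by nonneg].
Qed.

(** A rotation preserves M M^T + z z^T, so Q + M M^T is the matrix of raw second moments; this
    identifies Q with the scatter matrix. *)
Lemma helmert_invariant (z : nat -> R * R) k :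
  let S := iteri k (fun j S => helmert j S (z j)) ((0, 0), (0, 0, 0)) in
  [/\ Num.sqrt k%:R * S.1.1 = \sum_(j < k) (z j).1,
      Num.sqrt k%:R * S.1.2 = \sum_(j < k) (z j).2 &
  [/\ S.2.1.1 + S.1.1 ^+ 2 = \sum_(j < k) (z j).1 * (z j).1,
      S.2.1.2 + S.1.1 * S.1.2 = \sum_(j < k) (z j).1 * (z j).2 &
      S.2.2 + S.1.2 ^+ 2 = \sum_(j < k) (z j).2 * (z j).2]].
Proof.
elim: k => [|k]; first by rewrite /= !big_ord0 !mulr0 !expr0n !addr0.
rewrite !big_ord_recr [iteri k.+1 _ _]/=.
set S := iteri _ _ _; move=> /= [<- <-] [<- <- <-].
have rot := helmert_rotation k.
have sk : Num.sqrt k.+1%:R != 0 :> R by rewrite gt_eqF// sqrtr_gt0 ltr0n.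
have ck1 : Num.sqrt k.+1%:R * c k = Num.sqrt k%:R by rewrite /c mulrC divfK.
have sk1 : Num.sqrt k.+1%:R * s k = 1 by rewrite /s divff.
have comb x y : Num.sqrt k.+1%:R * (c k * x + s k * y) = Num.sqrt k%:R * x + y.
  by move: (Num.sqrt _) (Num.sqrt _) ck1 sk1 => t u <- ts; ring: ts.
split; [exact: comb|exact: comb|].
have c2 : c k ^+ 2 = 1 - s k ^+ 2 by rewrite -rot addrK.
by split; ring: c2.
Qed.

End helmert.

Lemma integral_probability_cst d (T : measurableType d) (R : realType) (P : probability T R)
    (c : \bar R) : (\int[P]_x c = c)%E.
Proof.
rewrite integral_cst//; transitivity (c * 1)%E; last by rewrite mule1.
by congr (_ * _)%E; exact: probability_setT.
Qed.

(** In Bartlett's coordinates the event does not involve a. Integrating over z first and using its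
    symmetry leaves Phi (q sqrt v) averaged over v. With k + 2 terms, v has k + 1 degrees of
    freedom. *)
Lemma wishart_ratio (R : realType) (k : nat) (q : R) (H : R * R * R -> \bar R) :
  measurable_fun setT H -> (forall t, 0 <= H t)%E ->
  (forall a z v, (0 < a)%R -> (0 < v)%R ->
     H (a, Num.sqrt a * z, v + z ^+ 2) = (- z < q * Num.sqrt v)%R%:R%:E)%R ->
  wishart k.+2 H = (ratio_cdf k.+1%:R q)%:E.
Proof.
move=> mH H0 HE.
pose h (z v : R) : R := (- z < q * Num.sqrt v)%R%:R.
have mh : measurable_fun setT (fun p : R * R => h p.1 p.2) by rewrite /h; measurability.
have mh2 z : measurable_fun setT (h z) by rewrite /h; measurability.
have h0 z v : 0 <= h z v by rewrite /h.
transitivity (\int[chi2_prob k.+2%:R]_a \int[normal_prob 0 1]_z \int[chi2_prob k.+1%:R]_v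
  H (a, Num.sqrt a * z, v + z ^+ 2)%R)%E; first exact: (wishart_chi2 k.+1 mH H0).
transitivity (\int[chi2_prob k.+2%:R]_a \int[chi2_prob k.+1%:R]_v \int[normal_prob 0 1]_z (h z v)%:E)%E.
  apply: eq_integral_chi2; [by measurability|by nonneg|by measurability|by nonneg|].
  move=> a a0; transitivity (\int[normal_prob 0 1]_z \int[chi2_prob k.+1%:R]_v (h z v)%:E)%E.
    apply: eq_integral => z _; apply: eq_integral_chi2; [by measurability|by nonneg|by measurability|by nonneg|].
    by move=> v v0; rewrite HE.
  apply: (@integral_swap _ _ _ _ _ (normal_prob 0 1) (chi2_prob k.+1%:R) (fun z v => (h z v)%:E)); [by measurability|by nonneg].
rewrite integral_chi2_cst ?ltr0n// -ratio_cdfE ?ltr0n//; etransitivity.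
  apply: (@integral_chi2 _ _ (fun v => \int[normal_prob 0 1]_z (h z v)%:E)%E); last by nonneg.
  by rewrite /h; measurability.
apply: eq_integral => v _; rewrite EFinM; congr (_ * _)%E; rewrite -PhiE_open.
rewrite (@integral_normalN _ (fun z => (z < q * Num.sqrt v)%R%:R%:E)); [|by measurability|by nonneg].
rewrite -[X in _ = (normal_prob 0 1) X]setIT -integral_indic//; apply: eq_integral => z _.
rewrite indicE; congr (_%:R%:E); congr nat_of_bool.
by apply/idP/idP; rewrite inE/= in_itv.
Qed.

(** * The sampling distribution of the slope statistics *)

Section sampling.
Context (R : realType) (d : measure_display) (T : measurableType d) (P : probability T R).
Variables (n : nat) (m1 m2 s1 s2 rho : R) (X : 'I_n -> {RV P >-> (R * R)%type}).
Hypotheses (s1_gt0 : 0 < s1) (s2_gt0 : 0 < s2) (rho_lt1 : `|rho| < 1).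
Hypothesis X_iid : iid_bvn X (m1, m2) (cov_mx s1 s2 rho).
Local Notation N := (@normal_prob R 0 1).
Local Notation triple := (R * R * R)%type.
Local Notation state := (R * R * triple)%type.

Let tau := s2 * Num.sqrt (1 - rho ^+ 2).

Let tau_gt0 : 0 < tau.
Proof.
by rewrite mulr_gt0// sqrtr_gt0 subr_gt0 -real_normK ?num_real// expr_lt1.
Qed.

Definition standardize (x : R * R) : R * R :=
  let g := (x.1 - m1) / s1 in (g, (x.2 - m2 - rho * s2 * g) / tau).

Lemma standardizeK g e :
  standardize (m1 + s1 * g, m2 + rho * s2 * g + tau * e) = (g, e).
Proof.
rewrite /standardize/= [m1 + _]addrC addrK mulrC mulKf ?gt_eqF//.
by congr (_, _); field; rewrite gt_eqF.
Qed.

Lemma destandardizeK x :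
  x = (m1 + s1 * (standardize x).1, m2 + rho * s2 * (standardize x).1 + tau * (standardize x).2).
Proof. by case: x => x y; congr (_, _); rewrite /standardize/=; field; rewrite !gt_eqF. Qed.

Let U (k : nat) (z : state * (R * R)) : state := helmert k z.1 (standardize z.2).

Let mU k : measurable_fun setT (U k).
Proof.
apply: (measurable_app (f := fun z : state * (R * R) => (z.1, standardize z.2)) (@measurable_helmert R k)).
by rewrite /standardize; measurability.
Qed.

Let S0 : state := ((0, 0), (0, 0, 0)).
Let stat := running X S0 U.

(** Of k + 1 observations one is absorbed by the mean, so only k rank-one terms remain. Each
    induction step peels off the last observation by independence and then rotates. *)
Lemma helmert_law k (F : state -> \bar R) : (k < n)%N ->
  measurable_fun setT F -> (forall S, 0 <= F S)%E ->
  (\int[P]_w F (stat k.+1 w) = wishart k (fun q => \int[N]_a \int[N]_b F ((a, b), q)))%E.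
Proof.
have step (i : 'I_n) (G : state -> \bar R) : measurable_fun setT G -> (forall S, 0 <= G S)%E ->
    (\int[P]_w G (stat i.+1 w) = \int[P]_w \int[N]_g \int[N]_e G (helmert i (stat i w) (g, e)))%E.
  move=> mG G0.
  have mGU : measurable_fun setT (fun z => G (U i z)) := measurable_app mG (mU i).
  have GU0 z : (0 <= G (U i z))%E by [].
  transitivity (\int[P]_w G (U i (stat i w, X i w)))%E.
    by apply: eq_integral => w _; rewrite /stat runningS.
  rewrite /stat (integral_running S0 X_iid.1 mU i mGU GU0); apply: eq_integral => w _.
  etransitivity.
    apply: (@integral_bvn_prob _ (distribution P (X i)) m1 m2 s1 s2 rho
      (fun x => G (U i (running X S0 U i w, x))) s1_gt0 s2_gt0 rho_lt1 (X_iid.2 i)).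
      by apply: (measurable_app (f := fun x => (running X S0 U i w, x)) mGU); measurability.
    by move=> z; exact: GU0.
  by apply: eq_integral => g _; apply: eq_integral => e _; rewrite /U standardizeK.
elim: k F => [|k IH] F kn mF F0; rewrite (step (Ordinal kn) F mF F0) {step} /=.
  rewrite integral_probability_cst /wishart /=.
  apply: eq_integral => g _; apply: eq_integral => e _; congr F.
  (* At index 0 the rotation is a quarter turn, c = 0 and s = 1: the first point becomes the mean
     and the scatter matrix stays 0. *)
  rewrite /helmert /= sqrtr0 sqrtr1 mul0r invr1 !mul1r !mul0r !mulr0 !addr0 !add0r.
  by rewrite expr0n.
have mFh : measurable_fun setT (fun z : state * (R * R) => F (helmert k.+1 z.1 z.2)).
  exact: (measurable_app mF (@measurable_helmert R k.+1)).
pose G (S : state) := (\int[N]_g \int[N]_e F (helmert k.+1 S (g, e)))%E.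
have mG : measurable_fun setT G.
  rewrite /G; apply: measurable_integral; last by nonneg.
  apply: measurable_integral; last by nonneg.
  by apply: (measurable_app (f := fun z : state * R * R => (z.1.1, (z.1.2, z.2))) mFh); measurability.
have G0 S : (0 <= G S)%E by rewrite /G; nonneg.
transitivity (\int[P]_w G (stat k.+1 w))%E; first by [].
rewrite {}(IH G (ltnW kn) mG G0) (wishartS k); apply: (congr1 (wishart k)).
by apply/funext => q; exact: (integral_helmert k.+1 q mF F0).
Qed.

(** The entries of L Q L^T, where L is the lower triangular matrix with rows (s1, 0) and (rho s2,
    tau). *)
Let affine_scatter (q : triple) : triple :=
  (s1 ^+ 2 * q.1.1,
   s1 * (rho * s2 * q.1.1 + tau * q.1.2),
   (rho * s2) ^+ 2 * q.1.1 + 2 * (rho * s2 * tau) * q.1.2 + tau ^+ 2 * q.2).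

Lemma scatter_stat w : (0 < n)%N ->
  (s11 (fun k => X k w), s12 (fun k => X k w), s22 (fun k => X k w)) = affine_scatter (stat n w).2.
Proof.
move=> n0.
(* [helmert_invariant] is about sequences indexed by all naturals; the default (0, 0) past n is
   never reached in sums over j < n. *)
pose z j := oapp (fun i : 'I_n => standardize (X i w)) (0, 0) (insub j).
have statE k : (k <= n)%N -> stat k w = iteri k (fun j S => helmert j S (z j)) S0.
  elim: k => [//|k IH] kn; rewrite /stat (runningS X S0 U (Ordinal kn)) /U /= -IH 1?ltnW//.
  by rewrite /z insubT /=; congr (helmert _ _ (standardize (X _ _))); exact: val_inj.
have zE (f : R * R -> R) : \sum_(j < n) f (z j) = \sum_(j < n) f (standardize (X j w)).
  by apply: eq_bigr => j _; rewrite /z valK.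
have := helmert_invariant z n; rewrite -statE//; set S := stat n w.
set g := fun j => (standardize (X j w)).1; set e := fun j => (standardize (X j w)).2.
move=> [/= M1 M2 [Q11 Q12 Q22]].
have sn : Num.sqrt n%:R ^+ 2 = n%:R :> R by rewrite sqr_sqrtr ?ler0n.
have dev (u v : 'I_n -> R) p q r : Num.sqrt n%:R * p = \sum_j u j -> Num.sqrt n%:R * q = \sum_j v j ->
    r + p * q = \sum_j u j * v j -> cross_dev u v = r.
  move=> pu qv ruv; rewrite cross_devE -ruv -pu -qv.
  have -> : n%:R^-1 * (Num.sqrt n%:R * p) * (Num.sqrt n%:R * q) = n%:R^-1 * Num.sqrt n%:R ^+ 2 * (p * q) by ring.
  by rewrite sn mulVf ?pnatr_eq0 -?lt0n// mul1r addrK.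
have gg : cross_dev g g = S.2.1.1.
  by apply: (dev _ _ S.1.1 S.1.1); rewrite -?expr2 ?M1 ?Q11 (zE fst, zE (fun t => t.1 * t.1)).
have ge : cross_dev g e = S.2.1.2.
  by apply: (dev _ _ S.1.1 S.1.2); rewrite ?M1 ?M2 ?Q12 (zE fst, zE snd, zE (fun t => t.1 * t.2)).
have ee : cross_dev e e = S.2.2.
  by apply: (dev _ _ S.1.2 S.1.2); rewrite -?expr2 ?M2 ?Q22 (zE snd, zE (fun t => t.2 * t.2)).
have X1 : fst \o (fun k => X k w) = fun k => m1 + s1 * g k + 0 * e k.
  by apply/funext => k /=; rewrite [X in X.1 = _]destandardizeK/= mul0r addr0.
have X2 : snd \o (fun k => X k w) = fun k => m2 + rho * s2 * g k + tau * e k.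
  by apply/funext => k /=; rewrite [X in X.2 = _]destandardizeK.
rewrite /s11 /s12 /s22 X1 X2 !cross_dev_affine gg ge ee /affine_scatter.
by congr (_, _, _); ring.
Qed.

Lemma slope_coverage q : (3 <= n)%N ->
  P [set w | theta1 (m1, m2, s1, s2, rho) <
             slope_center (fun k => X k w) + slope_scale (fun k => X k w) * q] =
  (ratio_cdf (n%:R - 2) q)%:E.
Proof.
move=> n3; have n0 : (0 < n)%N by exact: leq_trans n3.
pose f (t : triple) : R := (rho * s2 / s1 < center_of t + scale_of t * q)%R%:R.
have mf : measurable_fun setT f.
  rewrite /f; apply: measurable_ltr_natr => //; apply: measurable_funD; first exact: measurable_center_of.
  by apply: measurable_funM => //; exact: measurable_scale_of.
have f0 t : 0 <= f t by rewrite /f.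
pose F (S : state) : \bar R := (f (affine_scatter S.2))%:E.
have mH : measurable_fun setT (fun q : triple => (f (affine_scatter q))%:E).
  by apply: measurable_EFin; apply: (measurable_app mf); rewrite /affine_scatter; measurability.
have mF : measurable_fun setT F.
  by apply: (measurable_app mH); exact: measurable_snd.
have F0 S : (0 <= F S)%E by rewrite lee_fin.
have fE w : f (affine_scatter (stat n w).2) =
    (rho * s2 / s1 < slope_center (fun k => X k w) + slope_scale (fun k => X k w) * q)%R%:R.
  by rewrite -scatter_stat.
set A := [set w | _]; have mA : measurable A.
  have : measurable_fun setT (fun w => f (affine_scatter (stat n w).2)).
    apply/measurable_EFinP; apply: (measurable_app mF); exact: measurable_running.
  move=> /(_ measurableT [set 1%R] (measurable_set1 _)); rewrite setTI.
  congr measurable; apply/seteqP; split => w; rewrite /A /= fE /theta1.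
    by case: ltP => // _ /esym/eqP; rewrite oner_eq0.
  by move=> ->.
transitivity (\int[P]_w F (stat n w))%E.
  rewrite -[X in P X]setIT -integral_indic//; apply: eq_integral => w _.
  rewrite /F fE indicE; congr (_%:R%:E); congr nat_of_bool.
  by apply/idP/idP; rewrite inE.
have [k nE] : exists k, n = k.+3 by case: (n) n3 => [|[|[|k]]] // _; exists k.
pose H (t : triple) : \bar R := (f (affine_scatter t))%:E.
have H0 t : (0 <= H t)%E by rewrite lee_fin.
etransitivity.
  have kn : (k.+2 < n)%N by rewrite nE.
  have := helmert_law kn mF F0; rewrite -nE => ->.
  have -> : (fun q => \int[N]_a \int[N]_b F ((a, b), q))%E = H.
    apply/funext => t; transitivity (\int[N]_a \int[N]_b H t)%E; first by [].
    by rewrite !integral_normal_cst.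
  by [].
have -> : n%:R - 2 = k.+1%:R :> R by rewrite nE -(addn2 k.+1) natrD addrK.
apply: wishart_ratio => // a z v a0 v0.
rewrite /H /f; congr (_%:R%:E); congr nat_of_bool.
set t := affine_scatter _.
have sa : 0 < Num.sqrt a by rewrite sqrtr_gt0.
have sa2 : Num.sqrt a ^+ 2 = a by rewrite sqr_sqrtr// ltW.
(* In these coordinates the determinant loses z. The error of the center and the scale share the
   positive factor tau / (s1 sqrt a), which cancels from the event. *)
have tE : t = ((s1 * Num.sqrt a) ^+ 2, s1 * Num.sqrt a * (rho * s2 * Num.sqrt a + tau * z),
    (rho * s2 * Num.sqrt a + tau * z) ^+ 2 + tau ^+ 2 * v).
  by rewrite /t /affine_scatter /=; congr (_, _, _); ring: sa2.
have t1 : 0 < t.1.1 by rewrite tE exprn_gt0// mulr_gt0.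
have t2 : 0 < t.2 by rewrite tE ltr_wpDl ?sqr_ge0// mulr_gt0// exprn_gt0.
have disc : t.1.1 * t.2 - t.1.2 ^+ 2 = (s1 * Num.sqrt a * tau) ^+ 2 * v.
  by rewrite tE /=; ring.
have ca : center_of t = rho * s2 / s1 + tau / (s1 * Num.sqrt a) * z.
  by rewrite center_ofE// tE /=; field; rewrite !gt_eqF.
have sca : scale_of t = tau / (s1 * Num.sqrt a) * Num.sqrt v.
  rewrite scale_ofE// disc sqrtrM ?sqr_ge0// sqrtr_sqr ger0_norm; last by rewrite !mulr_ge0// ltW.
  by rewrite tE /=; field; rewrite !gt_eqF.
have w0 : 0 < tau / (s1 * Num.sqrt a) by rewrite divr_gt0// mulr_gt0.
rewrite ca sca -addrA ltrDl -[_ * _ * q]mulrA -mulrDr pmulr_rgt0//.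
by rewrite [Num.sqrt v * q]mulrC addrC -ltrBlDr sub0r.
Qed.

End sampling.

(* The library only declares the product of two subprobabilities as canonically sigma-finite. *)
Definition sigma_finite_product d1 d2 (T1 : measurableType d1) (T2 : measurableType d2)
    (R : realType) (m1 : {sigma_finite_measure set T1 -> \bar R})
    (m2 : {sigma_finite_measure set T2 -> \bar R}) :
  {sigma_finite_measure set (T1 * T2)%type -> \bar R} :=
  HB.pack (m1 \x m2)%E (Measure_isSigmaFinite.Build _ _ _ (m1 \x m2)%E
    (lebesgue_integral_fubini.product_measure_sigma_finite_subproof m1 m2)).

(** The chosen order puts the two means innermost, ready to be integrated out. *)
Lemma tonelli5 d1 d2 d3 d4 d5 (T1 : measurableType d1) (T2 : measurableType d2)
    (T3 : measurableType d3) (T4 : measurableType d4) (T5 : measurableType d5) (R : realType)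
    (m1 : {sigma_finite_measure set T1 -> \bar R}) (m2 : {sigma_finite_measure set T2 -> \bar R})
    (m3 : {sigma_finite_measure set T3 -> \bar R}) (m4 : {sigma_finite_measure set T4 -> \bar R})
    (m5 : {sigma_finite_measure set T5 -> \bar R})
    (G : T1 * T2 * T3 * T4 * T5 -> \bar R) :
  measurable_fun setT G -> (forall p, 0 <= G p)%E ->
  (\int[m1 \x m2 \x m3 \x m4 \x m5]_p G p =
   \int[m5]_r \int[m4]_t \int[m3]_s \int[m1]_x \int[m2]_y G (x, y, s, t, r))%E.
Proof.
move=> mG G0.
pose m12 := sigma_finite_product m1 m2; pose m123 := sigma_finite_product m12 m3.
pose m1234 := sigma_finite_product m123 m4.
etransitivity; first exact: (@fubini_tonelli2 _ _ _ _ _ m1234 m5 G mG G0).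
apply: eq_integral => r _; rewrite /fubini_G.
have mG1 : measurable_fun setT (fun p => G (p, r)).
  by apply: (measurable_app mG); measurability.
etransitivity; first exact: (@fubini_tonelli2 _ _ _ _ _ m123 m4 _ mG1).
apply: eq_integral => t _; rewrite /fubini_G.
have mG2 : measurable_fun setT (fun p => G (p, t, r)).
  by apply: (measurable_app mG1); measurability.
etransitivity; first exact: (@fubini_tonelli2 _ _ _ _ _ m12 m3 _ mG2).
apply: eq_integral => s _; rewrite /fubini_G.
apply: (@fubini_tonelli1 _ _ _ _ _ m1 m2 (fun p => G (p, s, t, r))) => //.
by apply: (measurable_app mG2); measurability.
Qed.

(** * Integrating the means out of the likelihood *)

Section posterior_integrals.
Variable R : realType.
Local Notation leb := (@lebesgue_measure R).
Local Notation N := (@normal_prob R 0 1).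

Lemma integral_params (G : R * R * R * R * R -> \bar R) :
  measurable_fun setT G -> (forall p, 0 <= G p)%E ->
  (\int[leb \x leb \x leb \x leb \x leb]_p G p =
   \int[leb]_r \int[leb]_t \int[leb]_s \int[leb]_m1 \int[leb]_m2 G (m1, m2, s, t, r))%E.
Proof.
pose L := measurableTypeR R; move=> mG G0.
exact: (@tonelli5 _ _ _ _ _ L L L L L R leb leb leb leb leb G).
Qed.

Lemma integral_normal_density (mu sigma : R) : 0 < sigma ->
  (\int[leb]_m (expR (- (m - mu) ^+ 2 / (2 * sigma ^+ 2)))%:E = (sigma / normal_peak 1)%:E)%E.
Proof.
move=> sigma0; rewrite (@integral_affine _ sigma mu); [|by rewrite gt_eqF|by measurability|by nonneg].
have p0 : normal_peak 1 != 0 :> R by rewrite gt_eqF// normal_peak_gt0// oner_eq0.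
transitivity (`|sigma|%:E * \int[leb]_x ((normal_peak 1)^-1%:E * (normal_pdf 0 1 x)%:E))%E.
  congr (_ * _)%E; apply: eq_integral => x _; rewrite std_normal_pdfE -EFinM mulKf//.
  by congr (expR _)%:E; field; rewrite gt_eqF.
rewrite ge0_integralZl_EFin; [|exact: measurableT|by nonneg|by measurability|by rewrite invr_ge0 normal_peak_ge0].
by rewrite integral_normal_pdf mule1 -EFinM gtr0_norm.
Qed.

(** The n normal peaks divided by sqrt n and by one more peak, the latter from the Gaussian integral
    over the mean. Only its positivity matters. *)
Definition location_const n : R := normal_peak 1 ^+ n / (Num.sqrt n%:R * normal_peak 1).

Lemma location_const_gt0 n : (0 < n)%N -> 0 < location_const n.
Proof.
move=> n0; have p0 : 0 < normal_peak 1 :> R by rewrite normal_peak_gt0// oner_eq0.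
by rewrite divr_gt0 ?exprn_gt0 ?mulr_gt0// sqrtr_gt0 ltr0n.
Qed.

Lemma prod_expR n (u : 'I_n -> R) : \prod_k expR (u k) = expR (\sum_k u k).
Proof. by rewrite (big_morph expR (@expRD _) (@expR0 _)). Qed.

(** The sum of squares about m is [cross_dev u u] plus n times the squared distance from m to the
    sample mean; the last term is a Gaussian kernel with standard deviation sigma / sqrt n. *)
Lemma integral_location n (u : 'I_n -> R) (sigma : R) : (0 < n)%N -> 0 < sigma ->
  (\int[leb]_m (\prod_k normal_pdf 0 1 ((u k - m) / sigma))%:E =
   (location_const n * (sigma * expR (- cross_dev u u / (2 * sigma ^+ 2))))%:E)%E.
Proof.
move=> n0 sigma0.
have nR : 0 < n%:R :> R by rewrite ltr0n.
have sn : 0 < Num.sqrt n%:R :> R by rewrite sqrtr_gt0.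
have sn2 : Num.sqrt n%:R ^+ 2 = n%:R :> R by rewrite sqr_sqrtr// ltW.
have sq (t : R) : \sum_k (u k - t) ^+ 2 = \sum_k u k * u k - 2 * t * (\sum_k u k) + n%:R * t ^+ 2.
  transitivity (\sum_k (u k * u k - 2 * t * u k + t ^+ 2)); first by apply: eq_bigr => k _; ring.
  by rewrite !big_split/= sumrN -mulr_sumr sumr_const card_ord [n%:R * _]mulr_natl.
pose c := normal_peak 1 ^+ n * expR (- cross_dev u u / (2 * sigma ^+ 2)).
transitivity (\int[leb]_m (c%:E * (expR (- (m - sample_mean u) ^+ 2 / (2 * (sigma / Num.sqrt n%:R) ^+ 2)))%:E))%E.
  apply: eq_integral => m _; rewrite -EFinM /c -mulrA -expRD; congr EFin.
  under eq_bigr do rewrite std_normal_pdfE.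
  rewrite big_split/= prodr_const card_ord prod_expR; congr (_ * expR _).
  rewrite -mulr_suml sumrN cross_devE expr_div_n sn2 /sample_mean.
  under eq_bigr do rewrite expr_div_n.
  rewrite -mulr_suml.
  rewrite sq.
  by field; rewrite !gt_eqF.
rewrite ge0_integralZl_EFin; [|exact: measurableT|by nonneg|by measurability|]; last first.
  by rewrite mulr_ge0 ?expR_ge0// exprn_ge0 ?normal_peak_ge0.
rewrite integral_normal_density ?divr_gt0// -EFinM; congr EFin; rewrite /c /location_const.
by field; rewrite !gt_eqF// normal_peak_gt0// oner_eq0.
Qed.

(** Under the kernel on the left, k / s^2 is chi-squared up to a constant, which is left existential
    because only its independence of F matters. Used for sigma_1 with n - a degrees of freedom and
    for tau with n - b. *)
Lemma integral_inverse_chi (m k : R) : 0 < m -> 0 < k ->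
  exists2 C, 0 < C & forall F : R -> \bar R, measurable_fun setT F -> (forall v, 0 <= F v)%E ->
    (\int[leb]_s ((0 < s)%R%:R%:E * ((s `^ (- m - 1) * expR (- (k / s ^+ 2) / 2))%:E *
      F (k / s ^+ 2)%R)) = C%:E * \int[leb]_v ((chi2_pdf m v)%:E * F v))%E.
Proof.
move=> m0 k0.
pose D : R := 2 `^ (m / 2) * Gamma_fun (m / 2).
have D0 : 0 < D by rewrite mulr_gt0 ?powR_gt0// Gamma_fun_gt0// divr_gt0.
(* The factor 2 k comes from v = k s^(-2), the rest from the chi-squared density. *)
pose E := 2 * k * (k `^ (m / 2 - 1) / D).
have E0 : 0 < E by rewrite mulr_gt0 ?divr_gt0 ?powR_gt0// mulr_gt0.
exists E^-1; first by rewrite invr_gt0.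
move=> F mF F0.
have Er : E != 0 by rewrite gt_eqF.
suff -> : (\int[leb]_v ((chi2_pdf m v)%:E * F v) = E%:E *
    \int[leb]_s ((0 < s)%R%:R%:E * ((s `^ (- m - 1) * expR (- (k / s ^+ 2) / 2))%:E *
      F (k / s ^+ 2)%R)))%E.
  by rewrite muleA -EFinM mulVf// mul1e.
rewrite (@integral_affine _ k 0); [|by rewrite gt_eqF|by measurability|by nonneg].
transitivity (`|k|%:E * \int[leb]_x ((0 < x)%R%:R%:E * ((chi2_pdf m (k * x))%:E * F (k * x)%R)))%E.
  congr (_ * _)%E; apply: eq_integral => x _; rewrite addr0.
  have [x0|x0] := ltP 0 x; first by rewrite mul1e.
  by rewrite chi2_pdf_le0 ?mul0e// pmulr_rle0.
rewrite (@integral_power _ (- 2) (fun x => (chi2_pdf m (k * x))%:E * F (k * x)%R)%E); [|by rewrite oppr_eq0|by measurability|by nonneg].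
rewrite muleA -EFinM normrN -!ge0_integralZl_EFin;
  [|exact: measurableT|by nonneg|by measurability|exact: ltW|exact: measurableT|by nonneg|by measurability|by nonneg].
apply: eq_integral => s _; have [s0|s0] := ltP 0 s; last by rewrite !mul0e !mule0.
rewrite !mul1e !muleA -!EFinM; have -> : k * s `^ (-2) = k / s ^+ 2.
  by rewrite powRN powR_mulrn// ltW.
congr (_%:E * _)%E.
have ks : 0 < k / s ^+ 2 by rewrite divr_gt0// exprn_gt0.
rewrite chi2_pdfE ks mul1r -/D /E !gtr0_norm//.
have -> : (k / s ^+ 2) `^ (m / 2 - 1) = k `^ (m / 2 - 1) * s `^ (2 - m).
  rewrite -powR_mulrn ?ltW// -powRN powRM ?powR_ge0 ?ltW// -powRrM; congr (_ * _ `^ _).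
  by field.
have -> : s `^ (- m - 1) = s `^ (- 2 - 1) * s `^ (2 - m).
  by rewrite -powRD; [congr (_ `^ _); ring|rewrite (gt_eqF s0) implybT].
by field; rewrite gt_eqF.
Qed.

Let sqrB1_gt0 (r : R) : `|r| < 1 -> 0 < 1 - r ^+ 2.
Proof. by move=> r1; rewrite subr_gt0 -real_normK ?num_real// expr_lt1. Qed.

(** Completing the square in t: the minimum is at the least-squares slope, and the shift by m drops
    out. *)
Lemma cross_dev_residual n (x : 'I_n -> R * R) (t m : R) : 0 < s11 x -> 0 < s22 x -> `|corr x| < 1 ->
  cross_dev (fun k => (x k).2 - t * ((x k).1 - m)) (fun k => (x k).2 - t * ((x k).1 - m)) =
  s11 x * ((t - slope_center x) ^+ 2 + slope_scale x ^+ 2).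
Proof.
move=> S1 S2 /sqrB1_gt0 r0.
have -> : (fun k => (x k).2 - t * ((x k).1 - m)) = fun k => t * m + (- t) * (fst \o x) k + 1 * (snd \o x) k.
  by apply/funext => k /=; ring.
rewrite cross_dev_affine -/(s11 x) -/(s12 x) -/(s22 x).
have -> : slope_center x = s12 x / s11 x by exact: (@center_ofE _ (s11 x, s12 x, s22 x)).
have S12 : 0 < s11 x * s22 x by rewrite mulr_gt0.
rewrite /slope_scale !expr_div_n !exprMn !sqr_sqrtr ?ltW//.
  by field; rewrite !gt_eqF.
by move: r0; rewrite /corr expr_div_n sqr_sqrtr ?ltW.
Qed.

Lemma likelihoodE n (x : 'I_n -> R * R) (m1 m2 s1 s2 rho : R) : 0 < s1 -> 0 < s2 -> `|rho| < 1 ->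
  let tau := s2 * Num.sqrt (1 - rho ^+ 2) in
  likelihood x (m1, m2, s1, s2, rho) =
  \prod_k normal_pdf 0 1 (((x k).1 - m1) / s1) *
  \prod_k normal_pdf 0 1 (((x k).2 - rho * s2 / s1 * ((x k).1 - m1) - m2) / tau) / (s1 * tau) ^+ n.
Proof.
move=> s10 s20 r1 tau; rewrite /likelihood -big_split/=.
have -> : ((s1 * tau) ^+ n)^-1 = \prod_(k < n) (s1 * tau)^-1 by rewrite prodr_const card_ord exprVn.
rewrite -big_split/=; apply: eq_bigr => k _; case: (x k) => y z /=.
by rewrite bvn_pdfE// -/tau addrAC.
Qed.

Lemma measurable_prodr d (T : measurableType d) n (f : 'I_n -> T -> R) :
  (forall k, measurable_fun setT (f k)) -> measurable_fun setT (fun t => \prod_k f k t).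
Proof. by move=> mf; apply: measurable_prod => k _; exact: mf. Qed.

Section marginal.
Variables (n : nat) (x : 'I_n -> R * R).
Hypothesis n_gt0 : (0 < n)%N.
Hypotheses (s11_gt0 : 0 < s11 x) (s22_gt0 : 0 < s22 x) (corr_lt1 : `|corr x| < 1).
Let c := slope_center x.
Let s := slope_scale x.
Let K : R := location_const n.

Let s_gt0 : 0 < s.
Proof. by rewrite divr_gt0 ?mulr_gt0 ?sqrtr_gt0// sqrB1_gt0. Qed.

(** Integrating over the second mean leaves deviations of residuals, in which the first mean only
    enters as a shift; so the integral over the first mean decouples. The weight w carries the
    prior. *)
Lemma integral_likelihood_means (w s1 s2 rho : R) : 0 <= w -> 0 < s1 -> 0 < s2 -> `|rho| < 1 ->
  let tau := s2 * Num.sqrt (1 - rho ^+ 2) in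
  (\int[leb]_m1 \int[leb]_m2 (w * likelihood x (m1, m2, s1, s2, rho))%:E =
   (w * (K ^+ 2 * ((s1 * tau) / (s1 * tau) ^+ n * (expR (- s11 x / (2 * s1 ^+ 2)) *
     expR (- (s11 x * ((rho * s2 / s1 - c) ^+ 2 + s ^+ 2)) / (2 * tau ^+ 2))))))%:E)%E.
Proof.
move=> w0 s10 s20 r1 tau.
have tau0 : 0 < tau by rewrite mulr_gt0 ?sqrtr_gt0 ?sqrB1_gt0.
pose p m1 := \prod_k normal_pdf 0 1 (((x k).1 - m1) / s1).
pose q m1 m2 := \prod_k normal_pdf 0 1 (((x k).2 - rho * s2 / s1 * ((x k).1 - m1) - m2) / tau).
have p0 m1 : 0 <= p m1 by apply: prodr_ge0 => k _; exact: normal_pdf_ge0.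
have q0 m1 m2 : 0 <= q m1 m2 by apply: prodr_ge0 => k _; exact: normal_pdf_ge0.
have mp : measurable_fun setT p by apply: measurable_prodr => k; measurability.
have mq m1 : measurable_fun setT (q m1) by apply: measurable_prodr => k; measurability.
pose e := tau * expR (- (s11 x * ((rho * s2 / s1 - c) ^+ 2 + s ^+ 2)) / (2 * tau ^+ 2)).
pose E := w * ((s1 * tau) ^+ n)^-1 * (K * e).
have E0 : 0 <= E.
  have K0 : 0 < K by exact: location_const_gt0.
  have e0 : 0 <= e by rewrite mulr_ge0 ?expR_ge0// ltW.
  by rewrite /E mulr_ge0 ?(mulr_ge0 (ltW K0) e0)// mulr_ge0// invr_ge0 exprn_ge0// mulr_ge0// ltW.
transitivity (\int[leb]_m1 (E%:E * (p m1)%:E))%E.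
  apply: eq_integral => m1 _.
  transitivity (\int[leb]_m2 ((w * p m1 / (s1 * tau) ^+ n)%:E * (q m1 m2)%:E))%E.
    by apply: eq_integral => m2 _; rewrite likelihoodE// -EFinM /p /q; congr EFin; ring.
  rewrite ge0_integralZl_EFin; [|exact: measurableT|by nonneg|by apply: measurable_EFin; exact: mq|]; last first.
    by rewrite mulr_ge0 ?mulr_ge0// invr_ge0 exprn_ge0// mulr_ge0 ?ltW.
  rewrite integral_location// cross_dev_residual// -/c -/s -!EFinM /E /e /K; congr EFin; ring.
rewrite ge0_integralZl_EFin; [|exact: measurableT|by nonneg|exact: measurable_EFin|exact: E0].
by rewrite integral_location// -EFinM -/(s11 x) /E /e /K; congr EFin; ring.
Qed.

End marginal.
End posterior_integrals.

(** * The posterior distribution of the slope *)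

Section posterior_slope.
Variable R : realType.
Local Notation leb := (@lebesgue_measure R).
Local Notation N := (@normal_prob R 0 1).
Variables (n : nat) (a b : R) (x : 'I_n -> R * R).
Hypotheses (n_gt0 : (0 < n)%N) (a_lt_n : a < n%:R) (b_lt_n : b < n%:R).
Hypotheses (s11_gt0 : 0 < s11 x) (s22_gt0 : 0 < s22 x) (corr_lt1 : `|corr x| < 1).
Local Notation c := (slope_center x).
Local Notation s := (slope_scale x).
Local Notation S := (s11 x).

Let s_gt0 : 0 < s.
Proof.
rewrite divr_gt0 ?mulr_gt0 ?sqrtr_gt0// subr_gt0 -real_normK ?num_real//.
by rewrite expr_lt1.
Qed.

(** This and the next two definitions are the factors of the integrand in the variables sigma_1, tau
    and theta, the last one restricted to B; the exponents are those found in [prior_scaling]. *)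
Definition kernel_s1 (u : R) : R := (0 < u)%R%:R * (u `^ (a - 2 - n%:R) * expR (- S / (2 * u ^+ 2))).

Definition kernel_tau (t : R) : R :=
  (0 < t)%R%:R * (t `^ (b - 1 - n%:R) * expR (- (S * s ^+ 2) / (2 * t ^+ 2))).

Definition kernel_theta (B : set R) (t th : R) : R :=
  expR (- (S * (th - c) ^+ 2) / (2 * t ^+ 2)) * \1_B th.

Lemma kernel_s1_ge0 u : 0 <= kernel_s1 u.
Proof. by rewrite /kernel_s1; nonneg. Qed.

Lemma kernel_tau_ge0 t : 0 <= kernel_tau t.
Proof. by rewrite /kernel_tau; nonneg. Qed.

Lemma kernel_theta_ge0 B t th : 0 <= kernel_theta B t th.
Proof. by rewrite /kernel_theta; nonneg. Qed.

Lemma measurable_kernel_s1 : measurable_fun setT kernel_s1.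
Proof. by rewrite /kernel_s1; measurability. Qed.

Lemma measurable_kernel_tau : measurable_fun setT kernel_tau.
Proof. by rewrite /kernel_tau; measurability. Qed.

Lemma measurable_kernel_theta B : measurable B ->
  measurable_fun setT (fun z : R * R => kernel_theta B z.1 z.2).
Proof.
move=> mB; rewrite /kernel_theta; by measurability.
Qed.

Lemma integral_kernel_s1 :
  exists2 C, 0 < C & (\int[leb]_u (kernel_s1 u * u)%:E = C%:E)%E.
Proof.
have m0 : 0 < n%:R - a by rewrite subr_gt0.
have [C C0 CE] := integral_inverse_chi m0 s11_gt0.
exists C => //; have := CE (cst 1%E) (@measurable_cst _ _ _ _ _ _) (fun=> lee01).
have -> : (\int[leb]_v ((chi2_pdf (n%:R - a) v)%:E * cst 1%E v) = 1)%E.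
  transitivity (\int[leb]_v (chi2_pdf (n%:R - a) v)%:E)%E; last exact: integral_chi2_pdf.
  by apply: eq_integral => v _; rewrite /cst mule1.
rewrite mule1 => <-; apply: eq_integral => u _.
rewrite /cst mule1 -EFinM /kernel_s1; have [u0|u0] := ltP 0 u; last by rewrite !mul0r.
rewrite !mul1r mulrAC -{2}(powRr1 (ltW u0)) -powRD ?(gt_eqF u0) ?implybT//.
by congr (_ `^ _ * expR _)%:E; [ring|field; rewrite gt_eqF].
Qed.

Lemma measurable_theta1_star B : measurable B -> measurable (theta1_star x @^-1` B).
Proof.
move=> mB; rewrite -[X in measurable X]setTI; apply: (_ : measurable_fun setT (theta1_star x)) => //.
by rewrite /theta1_star; measurability.
Qed.

(** Given t, theta is normal with center c and standard deviation t / sqrt S. With v = S s^2 / t^2,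
    t z / sqrt S is s z / sqrt v, the random term of [theta1_star]. *)
Lemma integral_kernel_theta B t : measurable B -> 0 < t ->
  (\int[leb]_th (kernel_theta B t th)%:E =
   (t / (Num.sqrt S * normal_peak 1))%:E *
   N (xsection (theta1_star x @^-1` B) (S * s ^+ 2 / t ^+ 2)%R))%E.
Proof.
move=> mB t0.
have mk : measurable_fun setT (fun th => (kernel_theta B t th)%:E).
  apply: measurable_EFin.
  by apply: (measurable_app (f := fun th => (t, th)) (measurable_kernel_theta mB)); measurability.
have k0 th : (0 <= (kernel_theta B t th)%:E)%E by rewrite lee_fin kernel_theta_ge0.
have p0 : 0 < normal_peak 1 :> R by rewrite normal_peak_gt0// oner_eq0.
have sS : 0 < Num.sqrt S by rewrite sqrtr_gt0.
have sS2 : Num.sqrt S ^+ 2 = S by rewrite sqr_sqrtr// ltW.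
(* A negative slope, to reproduce the minus sign in [theta1_star]. *)
have a0 : - (t / Num.sqrt S) != 0 by rewrite oppr_eq0 gt_eqF// divr_gt0.
rewrite (integral_affine c a0 mk k0) normrN gtr0_norm ?divr_gt0// normal_prob_indic.
set A := xsection _ _; have mA : measurable A.
  by apply: measurable_xsection; exact: measurable_theta1_star.
have mI : measurable_fun setT (fun z => (\1_A z)%:E : \bar R).
  by apply: measurable_EFin; exact: measurable_indicT.
rewrite (_ : t / (_ * _) = t / Num.sqrt S * (normal_peak 1)^-1); last by rewrite invfM mulrA.
rewrite [in RHS](EFinM (t / Num.sqrt S)) -[in RHS]muleA; congr (_ * _)%E.
rewrite -ge0_integralZl_EFin; [|exact: measurableT|by nonneg|by apply: emeasurable_funM; [by measurability|exact: mI]|by rewrite invr_ge0 ltW].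
apply: eq_integral => z _; rewrite -!EFinM std_normal_pdfE /kernel_theta; congr EFin.
rewrite -mulrA mulKf ?gt_eqF//; congr (expR _ * _).
  by rewrite addrK; field: sS2; rewrite gt_eqF// gt_eqF.
have sv : Num.sqrt (S * s ^+ 2 / t ^+ 2) = Num.sqrt S * s / t.
  rewrite -{1}sS2 -exprMn -expr_div_n sqrtr_sqr gtr0_norm// divr_gt0// mulr_gt0//.
rewrite !indicE; congr (_%:R); congr nat_of_bool.
have -> : (z \in A) = (theta1_star x (S * s ^+ 2 / t ^+ 2, z) \in B).
  by rewrite /A; apply/idP/idP; rewrite !inE /xsection/= ?inE.
rewrite /theta1_star /= sv -/(slope_scale x) -/(slope_center x).
congr (_ \in B); field.
by rewrite !gt_eqF.
Qed.

Lemma measurable_chi2_section B : measurable B ->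
  measurable_fun setT (fun v => N (xsection (theta1_star x @^-1` B) v)).
Proof. by move=> mB; apply: measurable_fun_xsection; exact: measurable_theta1_star. Qed.

(** The factor t from the integral over theta cancels 1 / t; what remains is an inverse chi kernel
    with k = S s^2, and the constant is the same for all B. *)
Lemma integral_kernel_tau : exists2 C, 0 < C & forall B, measurable B ->
  (\int[leb]_t ((kernel_tau t / t)%:E * \int[leb]_th (kernel_theta B t th)%:E) =
   C%:E * theta1_star_prob b x B)%E.
Proof.
have m0 : 0 < n%:R - b by rewrite subr_gt0.
have k0 : 0 < S * s ^+ 2 by rewrite mulr_gt0// exprn_gt0.
have [C C0 CE] := integral_inverse_chi m0 k0.
have p0 : 0 < Num.sqrt S * normal_peak 1.
  by rewrite mulr_gt0 ?sqrtr_gt0// normal_peak_gt0// oner_eq0.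
exists ((Num.sqrt S * normal_peak 1)^-1 * C); first by rewrite mulr_gt0// invr_gt0.
move=> B mB; pose F v := N (xsection (theta1_star x @^-1` B) v).
have mF : measurable_fun setT F by exact: measurable_chi2_section.
have F0 v : (0 <= F v)%E by exact: measure_ge0.
have -> : theta1_star_prob b x B = (\int[leb]_v ((chi2_pdf (n%:R - b) v)%:E * F v))%E.
  by rewrite /theta1_star_prob /pushforward chi2_normal_probE//; exact: measurable_theta1_star.
rewrite EFinM -muleA -(CE F mF F0) -ge0_integralZl_EFin;
  [|exact: measurableT|by nonneg|by measurability|by rewrite invr_ge0 ltW].
apply: eq_integral => t _; rewrite /kernel_tau.
have [t0|t0] := ltP 0 t; last by rewrite !mul0r !mul0e mule0.
rewrite integral_kernel_theta// -/(F _) !mul1r mul1e !muleA -!EFinM; congr (_%:E * _)%E.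
have -> : b - 1 - n%:R = - (n%:R - b) - 1 by ring.
have -> : - (S * s ^+ 2) / (2 * t ^+ 2) = - (S * s ^+ 2 / t ^+ 2) / 2 by field; rewrite gt_eqF.
by move: (Num.sqrt S * _) p0 => p p0; field; rewrite !gt_eqF.
Qed.

Lemma powR_expR (y z : R) : expR y `^ z = expR (z * y).
Proof. by rewrite /powR gt_eqF ?expR_gt0// expRK. Qed.

(** With w = sqrt (1 - rho^2) and sigma_2 = t / w, the exponents of w involving b cancel: only
    w^(-3) is left. Logarithms turn the identity into a linear one between exponents. *)
Lemma prior_scaling (u t w : R) : 0 < u -> 0 < t -> 0 < w ->
  w^-1 * ((u `^ (3 - a) * (w^-1 * t) `^ (2 - b) * (w ^+ 2) `^ (2 - b / 2))^-1 *
    ((u * t) / (u * t) ^+ n)) =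
  (w ^+ 3)^-1 * (u `^ (a - 2 - n%:R) * t `^ (b - 1 - n%:R)).
Proof.
have expP (y : R) : 0 < y -> exists z, y = expR z by move=> y0; exists (ln y); rewrite lnK.
move=> /expP[{}u ->] /expP[{}t ->] /expP[{}w ->].
rewrite -?expRM_natl -?expRN -?expRD -?expRM_natl !powR_expR -?expRN -?expRD -?expRN -?expRD; congr expR.
by field.
Qed.

Local Notation K := (location_const R n).

(** The prior with the parameter space and the condition on theta encoded as 0/1 factors; the means
    are set to 0 because the prior does not depend on them. *)
Definition weight (B : set R) (u t r : R) : R :=
  (0 < u)%R%:R * (0 < t)%R%:R * (`|r| < 1)%R%:R *
  (\1_B (r * t / u) * prior a b (0, 0, u, t, r)).

Lemma weight_ge0 B u t r : 0 <= weight B u t r.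
Proof.
rewrite /weight /prior mulr_ge0//.
by rewrite mulr_ge0// invr_ge0 !mulr_ge0 ?powR_ge0.
Qed.

Lemma measurable_weight B : measurable B ->
  measurable_fun setT (fun p : R * R * R => weight B p.1.1 p.1.2 p.2).
Proof. by move=> mB; rewrite /weight /prior; measurability. Qed.

Definition marginal B (u t r : R) : R :=
  let tau := t * Num.sqrt (1 - r ^+ 2) in
  weight B u t r * (K ^+ 2 * (u * tau / (u * tau) ^+ n * (expR (- S / (2 * u ^+ 2)) *
    expR (- (S * ((r * t / u - c) ^+ 2 + s ^+ 2)) / (2 * tau ^+ 2))))).

Lemma unnormalized_posterior_marginal B : measurable B ->
  (unnormalized_posterior a b x (theta1 @^-1` B) =
   \int[leb]_r \int[leb]_t \int[leb]_u (marginal B u t r)%:E)%E.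
Proof.
move=> mB.
(* An explicit formula agreeing with [likelihood] on the parameter space, on which measurability can
   be read; elsewhere [weight] vanishes. *)
pose lik (p : R * R * R * R * R) :=
  \prod_k normal_pdf 0 1 (((x k).1 - p.1.1.1.1) / p.1.1.2) *
  \prod_k normal_pdf 0 1 (((x k).2 - p.2 * p.1.2 / p.1.1.2 * ((x k).1 - p.1.1.1.1) - p.1.1.1.2) /
    (p.1.2 * Num.sqrt (1 - p.2 ^+ 2))) / (p.1.1.2 * (p.1.2 * Num.sqrt (1 - p.2 ^+ 2))) ^+ n.
pose G p := weight B p.1.1.2 p.1.2 p.2 * lik p.
have mlik : measurable_fun setT lik.
  apply: measurable_funM; last by measurability.
  by apply: measurable_funM; apply: measurable_prodr => k; measurability.
have mG : measurable_fun setT G.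
  apply: measurable_funM => //.
  by apply: (measurable_app (f := fun p : R * R * R * R * R => (p.1.1.2, p.1.2, p.2)) (measurable_weight mB)); measurability.
have lik0 p : 0 < p.1.1.2 -> 0 < p.1.2 -> 0 <= lik p.
  move=> u0 t0; rewrite /lik !mulr_ge0 ?invr_ge0 ?exprn_ge0 ?mulr_ge0 ?sqrtr_ge0 ?(ltW u0) ?(ltW t0)//.
    by apply: prodr_ge0 => k _; exact: normal_pdf_ge0.
  by apply: prodr_ge0 => k _; exact: normal_pdf_ge0.
have G0 p : 0 <= G p.
  rewrite /G; have [u0|u0] := ltP 0 p.1.1.2; last by rewrite /weight ltNge u0 !mul0r.
  have [t0|t0] := ltP 0 p.1.2; last by rewrite /weight (ltNge 0 p.1.2) t0 mulr0 !mul0r.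
  by rewrite mulr_ge0 ?weight_ge0// lik0.
transitivity (\int[leb \x leb \x leb \x leb \x leb]_p (G p)%:E)%E.
  rewrite /unnormalized_posterior integral_mkcond; apply: eq_integral => -[[[[m1 m2] u] t] r] _.
  rewrite patchE; case: ifPn; rewrite ?inE ?notin_setE.
    move=> [Br [u0 t0 r1]]; rewrite likelihoodE// /G /weight /= u0 t0 r1 !mul1r indicE mem_set// mul1r.
    by congr EFin; rewrite [RHS]mulrC.
  move=> ND; rewrite /G /weight /=; have [u0|u0] := ltP 0 u; last by rewrite !mul0r.
  have [t0|t0] := ltP 0 t; last by rewrite mulr0 !mul0r.
  have [r1|r1] := ltP `|r| 1; last by rewrite mulr0 !mul0r.
  rewrite indicE memNset ?mul0r ?mulr0 ?mul0r// => Br; apply: ND; by split.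
rewrite integral_params; [|exact: measurable_EFin|by move=> p; rewrite lee_fin].
apply: eq_integral => r _; apply: eq_integral => t _; apply: eq_integral => u _.
have w0 : weight B u t r = 0 -> (\int[leb]_m1 \int[leb]_m2 (G (m1, m2, u, t, r))%:E = (marginal B u t r)%:E)%E.
  move=> w0; rewrite /marginal w0 mul0r.
  by apply: integral0_eq => m1 _; apply: integral0_eq => m2 _; rewrite /G /= w0 mul0r.
have [u0|u0] := ltP 0 u; last by apply: w0; rewrite /weight ltNge u0 !mul0r.
have [t0|t0] := ltP 0 t; last by apply: w0; rewrite /weight (ltNge 0 t) t0 mulr0 !mul0r.
have [r1|r1] := ltP `|r| 1; last by apply: w0; rewrite /weight (ltNge `|r|) r1 mulr0 !mul0r.
rewrite -(integral_likelihood_means n_gt0 s11_gt0 s22_gt0 corr_lt1 (weight_ge0 B u t r) u0 t0 r1).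
apply: eq_integral => m1 _; apply: eq_integral => m2 _.
by rewrite likelihoodE.
Qed.

(** After sigma_2 = t / w, t is the residual standard deviation, and rho enters only through r / w
    and the factor w^(-3). *)
Lemma marginal_scaling B (u t r : R) : 0 < u -> 0 < t -> `|r| < 1 ->
  let w := Num.sqrt (1 - r ^+ 2) in
  w^-1 * marginal B u (w^-1 * t) r =
  (w ^+ 3)^-1 * (K ^+ 2 * (kernel_s1 u * kernel_tau t * kernel_theta B t (t / u * (r / w)))).
Proof.
move=> u0 t0 r1 w.
have r0 : 0 < 1 - r ^+ 2 by rewrite subr_gt0 -real_normK ?num_real// expr_lt1.
have w0 : 0 < w by rewrite sqrtr_gt0.
have w2 : w ^+ 2 = 1 - r ^+ 2 by rewrite sqr_sqrtr// ltW.
have wt0 : 0 < w^-1 * t by rewrite mulr_gt0 ?invr_gt0.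
rewrite /marginal /weight /prior -/w -w2 u0 wt0 r1 /kernel_s1 /kernel_tau /kernel_theta u0 t0 !mul1r.
have -> : w^-1 * t * w = t by rewrite mulrAC mulVf ?mul1r// gt_eqF.
have -> : r * (w^-1 * t) / u = t / u * (r / w) by ring.
have -> : expR (- (S * ((t / u * (r / w) - c) ^+ 2 + s ^+ 2)) / (2 * t ^+ 2)) =
    expR (- (S * s ^+ 2) / (2 * t ^+ 2)) * expR (- (S * (t / u * (r / w) - c) ^+ 2) / (2 * t ^+ 2)).
  by rewrite -expRD; congr expR; rewrite -mulrDl; congr (_ / _); ring.
have := prior_scaling u0 t0 w0.
set p := (_ * _)^-1; set q := u * t / _; set e1 := expR _; set e2 := expR _; set e3 := expR _.
set A := u `^ (a - 2 - _) ; set D := t `^ (b - 1 - _) => H.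
transitivity (\1_B (t / u * (r / w)) * K ^+ 2 * e1 * e2 * e3 * (w^-1 * (p * q))); first by ring.
by rewrite H; ring.
Qed.

Lemma marginal_eq0 B (u t r : R) : (0 < u) && (0 < t) && (`|r| < 1) = false -> marginal B u t r = 0.
Proof.
rewrite /marginal /weight; have [_|_] := ltP 0 u; last by rewrite !mul0r.
have [_|_] := ltP 0 t; last by rewrite mulr0 !mul0r.
by have [//|_ _] := ltP `|r| 1; rewrite mulr0 !mul0r.
Qed.

Lemma marginal_ge0 B (u t r : R) : 0 <= marginal B u t r.
Proof.
have [/andP[/andP[u0 t0] r1]|/negbTE h] := boolP ((0 < u) && (0 < t) && (`|r| < 1)); last by rewrite marginal_eq0.
have ut : 0 <= u * (t * Num.sqrt (1 - r ^+ 2)) by rewrite !mulr_ge0 ?sqrtr_ge0 ?ltW.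
apply: mulr_ge0; first exact: weight_ge0.
apply: mulr_ge0; first exact: sqr_ge0.
by apply: mulr_ge0; apply: mulr_ge0; rewrite ?expR_ge0// invr_ge0 exprn_ge0.
Qed.

Lemma measurable_marginal B : measurable B ->
  measurable_fun setT (fun p : R * R * R => marginal B p.1.1 p.1.2 p.2).
Proof.
by move=> mB; have mw := measurable_weight mB; apply: measurable_funM => //; measurability.
Qed.

Lemma integral_scale (k : R) (f : R -> \bar R) : 0 < k ->
  measurable_fun setT f -> (forall y, 0 <= f y)%E ->
  (\int[leb]_y f y = k%:E * \int[leb]_y f (k * y)%R)%E.
Proof.
move=> k0 mf f0; rewrite (@integral_affine _ k 0 f)// ?gt_eqF// gtr0_norm//.
by congr (_ * _)%E; apply: eq_integral => y _; rewrite addr0.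
Qed.

Lemma integral2Zl (k : R) (f : R -> R -> R) : 0 <= k ->
  measurable_fun setT (fun p : R * R => f p.1 p.2) -> (forall t u, 0 <= f t u) ->
  (k%:E * \int[leb]_t \int[leb]_u (f t u)%:E = \int[leb]_t \int[leb]_u (k * f t u)%:E)%E.
Proof.
move=> k0 mf f0; rewrite -ge0_integralZl_EFin//; last 2 first.
- by move=> t _; apply: integral_ge0 => u _; rewrite lee_fin.
- by apply: measurable_integral; [exact: measurable_EFin|move=> z; rewrite lee_fin].
apply: eq_integral => t _; rewrite -ge0_integralZl_EFin//.
- by move=> u _; rewrite lee_fin.
- by apply: measurable_EFin; apply: (measurable_app (f := fun u => (t, u)) mf); measurability.
Qed.

(** Here y stands for rho / sqrt (1 - rho^2), so that theta is t y / u. *)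
Definition slope_integrand B (y t u : R) : R :=
  K ^+ 2 * (kernel_s1 u * kernel_tau t * kernel_theta B t (t / u * y)).

Lemma slope_integrand_ge0 B y t u : 0 <= slope_integrand B y t u.
Proof.
rewrite /slope_integrand mulr_ge0 ?sqr_ge0// mulr_ge0 ?kernel_theta_ge0//.
by rewrite mulr_ge0 ?kernel_s1_ge0 ?kernel_tau_ge0.
Qed.

Lemma measurable_slope_integrand B : measurable B ->
  measurable_fun setT (fun p : R * R * R => slope_integrand B p.1.1 p.1.2 p.2).
Proof.
move=> mB; have mks := measurable_kernel_s1; have mkt := measurable_kernel_tau.
apply: measurable_funM => //; apply: measurable_funM; first by measurability.
by apply: (measurable_app (f := fun p : R * R * R => (p.1.2, p.1.2 / p.2 * p.1.1))
  (measurable_kernel_theta mB)); measurability.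
Qed.

Lemma integral_marginal_slice B (r : R) : measurable B -> `|r| < 1 ->
  let w := Num.sqrt (1 - r ^+ 2) in
  (\int[leb]_t \int[leb]_u (marginal B u t r)%:E =
   (w ^+ 3)^-1%:E * \int[leb]_t \int[leb]_u (slope_integrand B (r / w) t u)%:E)%E.
Proof.
move=> mB r1 w.
have w0 : 0 < w by rewrite sqrtr_gt0 subr_gt0 -real_normK ?num_real// expr_lt1.
have mm := measurable_marginal mB; have mg := measurable_slope_integrand mB.
have mm1 : measurable_fun setT (fun t => \int[leb]_u (marginal B u t r)%:E)%E.
  apply: measurable_integral; last by move=> z; rewrite lee_fin marginal_ge0.
  apply: measurable_EFin.
  by apply: (measurable_app (f := fun p : R * R => (p.2, p.1, r)) mm); measurability.
etransitivity.
  have w1 : 0 < w^-1 by rewrite invr_gt0.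
  apply: (integral_scale w1 mm1) => t; apply: integral_ge0 => u _.
  by rewrite lee_fin marginal_ge0.
etransitivity.
  apply: (@integral2Zl w^-1 (fun t u => marginal B u (w^-1 * t) r)).
  - by rewrite invr_ge0 ltW.
  - by apply: (measurable_app (f := fun p : R * R => (p.2, w^-1 * p.1, r)) mm); measurability.
  - by move=> t u; exact: marginal_ge0.
symmetry; etransitivity.
  apply: (@integral2Zl (w ^+ 3)^-1 (slope_integrand B (r / w))).
  - by rewrite invr_ge0 exprn_ge0// ltW.
  - by apply: (measurable_app (f := fun p : R * R => (r / w, p.1, p.2)) mg); measurability.
  - by move=> t u; exact: slope_integrand_ge0.
apply: eq_integral => t _; apply: eq_integral => u _; congr EFin.
have [u0|u0] := ltP 0 u; last first.
  by rewrite marginal_eq0 ?(ltNge 0 u) ?u0// /slope_integrand /kernel_s1 ltNge u0 !(mul0r, mulr0).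
have [t0|t0] := ltP 0 t; last first.
  rewrite marginal_eq0 ?pmulr_rgt0 ?invr_gt0// ?(ltNge 0 t) ?t0 ?andbF//.
  by rewrite /slope_integrand /kernel_tau ltNge t0 !(mul0r, mulr0).
by rewrite marginal_scaling.
Qed.

(** The factor w^(-3) left in each slice is exactly the derivative of r / sqrt (1 - r^2), so rho is
    exchanged for y on the whole line. *)
Lemma integral_marginal B : measurable B ->
  (\int[leb]_r \int[leb]_t \int[leb]_u (marginal B u t r)%:E =
   \int[leb]_y \int[leb]_t \int[leb]_u (slope_integrand B y t u)%:E)%E.
Proof.
move=> mB; symmetry; etransitivity.
  apply: (@integral_slope _ (fun y => \int[leb]_t \int[leb]_u (slope_integrand B y t u)%:E)%E).
    have mg := measurable_slope_integrand mB.
    apply: measurable_integral; last by move=> z; apply: integral_ge0 => u _; rewrite lee_fin slope_integrand_ge0.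
    by apply: measurable_integral; [exact: measurable_EFin|move=> z; rewrite lee_fin slope_integrand_ge0].
  by move=> y; apply: integral_ge0 => t _; apply: integral_ge0 => u _; rewrite lee_fin slope_integrand_ge0.
apply: eq_integral => r _; have [r1|r1] := ltP `|r| 1.
  by rewrite (integral_marginal_slice mB r1) div1r.
rewrite mul0r mul0e; symmetry; apply: integral0_eq => t _; apply: integral0_eq => u _.
by rewrite marginal_eq0// (ltNge `|r|) r1 andbF.
Qed.

(** With y innermost, theta = (t / u) y brings the Jacobian u / t, shared between the sigma_1 and
    tau kernels. The integral over sigma_1 then contributes only a constant, and C does not depend
    on B. *)
Lemma unnormalized_posteriorE : exists2 C, 0 < C & forall B, measurable B ->
  (unnormalized_posterior a b x (theta1 @^-1` B) = C%:E * theta1_star_prob b x B)%E.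
Proof.
have [C1 C10 C1E] := integral_kernel_s1.
have [C2 C20 C2E] := integral_kernel_tau.
have K0 : 0 < K by exact: location_const_gt0.
exists (K ^+ 2 * (C1 * C2)); first by rewrite mulr_gt0 ?exprn_gt0// mulr_gt0.
move=> B mB; rewrite unnormalized_posterior_marginal// integral_marginal//.
have mk := measurable_kernel_theta mB.
have mks := measurable_kernel_s1; have mkt := measurable_kernel_tau.
have ks0 := kernel_s1_ge0; have kt0 := kernel_tau_ge0; have kB0 := kernel_theta_ge0 B.
have mkt1 t : measurable_fun setT (fun th => (kernel_theta B t th)%:E).
  apply: measurable_EFin.
  by apply: (measurable_app (f := fun th => (t, th)) mk); measurability.
have mI : measurable_fun setT (fun t => \int[leb]_th (kernel_theta B t th)%:E)%E.
  by apply: measurable_integral; [exact: measurable_EFin|move=> z; rewrite lee_fin].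
etransitivity.
  apply: (@integral_swap13 _ _ _ (measurableTypeR R) (measurableTypeR R) (measurableTypeR R) R leb leb leb
    (fun y t u => (slope_integrand B y t u)%:E)).
    by apply: measurable_EFin; exact: measurable_slope_integrand.
  by move=> y t u; rewrite lee_fin slope_integrand_ge0.
rewrite /slope_integrand.
transitivity (\int[leb]_u \int[leb]_t ((K ^+ 2 * (kernel_s1 u * u))%:E *
    ((kernel_tau t / t)%:E * \int[leb]_th (kernel_theta B t th)%:E)))%E.
  apply: eq_integral => u _; apply: eq_integral => t _.
  have [u0|u0] := ltP 0 u; last first.
    have -> : kernel_s1 u = 0 by rewrite /kernel_s1 ltNge u0 mul0r.
    transitivity (0%E : \bar R); last by rewrite mul0r mulr0 mul0e.
    by apply: integral0_eq => y _; rewrite !mul0r mulr0.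
  have [t0|t0] := ltP 0 t; last first.
    have -> : kernel_tau t = 0 by rewrite /kernel_tau ltNge t0 mul0r.
    transitivity (0%E : \bar R); last by rewrite mul0r mul0e mule0.
    by apply: integral0_eq => y _; rewrite mulr0 mul0r mulr0.
  have tu0 : 0 < t / u by rewrite divr_gt0.
  rewrite (integral_scale tu0 (mkt1 t)); last by move=> y; rewrite lee_fin.
  rewrite !muleA -!EFinM.
  have -> : K ^+ 2 * (kernel_s1 u * u) * (kernel_tau t / t) * (t / u) = K ^+ 2 * (kernel_s1 u * kernel_tau t).
    by field; rewrite !gt_eqF.
  rewrite -ge0_integralZl_EFin; last 4 first.
  - exact: measurableT.
  - by move=> y _; rewrite lee_fin.
  - by apply: (measurable_app (mkt1 t)); measurability.
  - by rewrite mulr_ge0 ?sqr_ge0// mulr_ge0.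
  by apply: eq_integral => y _; rewrite -EFinM mulrA.
transitivity (\int[leb]_u ((K ^+ 2 * (kernel_s1 u * u))%:E * (C2%:E * theta1_star_prob b x B)))%E.
  apply: eq_integral => u _; have [u0|u0] := ltP 0 u; last first.
    have -> : kernel_s1 u = 0 by rewrite /kernel_s1 ltNge u0 mul0r.
    by rewrite mul0r mulr0 mul0e; apply: integral0_eq => y _; rewrite mul0e.
  have ku : 0 <= K ^+ 2 * (kernel_s1 u * u) by rewrite mulr_ge0 ?sqr_ge0// mulr_ge0// ltW.
  rewrite ge0_integralZl_EFin; last 4 first.
  - exact: measurableT.
  - move=> t _; have [t0|t0] := ltP 0 t; last by rewrite /kernel_tau ltNge t0 !mul0r mul0e.
    by rewrite mule_ge0// ?integral_ge0// => [|y _]; rewrite lee_fin// mulr_ge0// invr_ge0 ltW.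
  - by apply: emeasurable_funM => //; apply: measurable_EFin; measurability.
  - by [].
  by rewrite C2E.
have pB0 : (0 <= C2%:E * theta1_star_prob b x B)%E.
  apply: mule_ge0; first by rewrite lee_fin ltW.
  rewrite /theta1_star_prob /pushforward chi2_normal_probE; last exact: measurable_theta1_star.
  by apply: integral_ge0 => v _; rewrite mule_ge0 ?lee_fin ?chi2_pdf_ge0.
transitivity (\int[leb]_u ((K ^+ 2)%:E * (kernel_s1 u * u)%:E) * (C2%:E * theta1_star_prob b x B))%E.
  rewrite -ge0_integralZr; last 4 first.
  - exact: measurableT.
  - by apply: emeasurable_funM; [by measurability|apply: measurable_EFin; measurability].
  - move=> u _; have [u0|u0] := ltP 0 u; last by rewrite /kernel_s1 ltNge u0 !mul0r mule0.
    by rewrite -EFinM lee_fin mulr_ge0 ?sqr_ge0// mulr_ge0// ltW.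
  - by [].
  by apply: eq_integral => u _; rewrite EFinM.
rewrite ge0_integralZl_EFin; last 4 first.
- exact: measurableT.
- move=> u _; have [u0|u0] := ltP 0 u; last by rewrite /kernel_s1 ltNge u0 !mul0r.
  by rewrite lee_fin mulr_ge0// ltW.
- by apply: measurable_EFin; measurability.
- exact: sqr_ge0.
by rewrite C1E !muleA -!EFinM mulrA.
Qed.

(** The normalizing constant is the case of the whole line, hence equal to C, positive and finite:
    the posterior is proper and C cancels. *)
Lemma posterior_theta1E B : measurable B -> posterior_theta1 a b x B = theta1_star_prob b x B.
Proof.
move=> mB; have [C C0 CE] := unnormalized_posteriorE.
rewrite /posterior_theta1 /posterior CE//.
have -> : [set: R * R * R * R * R] = theta1 @^-1` [set: R] by rewrite preimage_setT.
rewrite CE//; have -> : theta1_star_prob b x setT = 1%E.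
  rewrite /theta1_star_prob /pushforward preimage_setT chi2_normal_prob_setT//.
  by rewrite subr_gt0.
by rewrite mule1 muleAC inver gt_eqF// -EFinM divff ?gt_eqF// mul1e.
Qed.

End posterior_slope.

Theorem theorem4 (R : realType) (n : nat) (a b : R) (n_ge3 : (3 <= n)%N)
    (a_lt_n : a < n%:R) (b_lt_n : b < n%:R) :
  (forall x : 'I_n -> R * R,
     0 < s11 x -> 0 < s22 x -> `|corr x| < 1 ->
     forall B : set R, measurable B ->
       posterior_theta1 a b x B = theta1_star_prob b x B)
  /\
  (forall (d : measure_display) (T : measurableType d) (P : probability T R)
      (mu1 mu2 sigma1 sigma2 rho : R) (X : 'I_n -> {RV P >-> (R * R)%type}),
     0 < sigma1 -> 0 < sigma2 -> -1 < rho < 1 ->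
     iid_bvn X (mu1, mu2) (cov_mx sigma1 sigma2 rho) ->
     let coverage (alpha : R) : \bar R :=
       P [set w | theta1 (mu1, mu2, sigma1, sigma2, rho) <
                  quantile (theta1_star_prob b (fun k => X k w)) (1 - alpha)] in
     (forall alpha : R, 0 < alpha < 1 ->
        coverage alpha =
          student_prob (n%:R - 2)
            [set t | t < Num.sqrt ((n%:R - 2) / (n%:R - b))
                         * quantile (student_prob (n%:R - b)) (1 - alpha)]
        /\ (alpha != 1 / 2 -> (coverage alpha = (1 - alpha)%:E <-> b = 2)))
     /\ ((forall alpha : R, 0 < alpha < 1 -> coverage alpha = (1 - alpha)%:E)
         <-> b = 2)).
Proof.
split=> [x S11 S22 r1 B mB|d T P mu1 mu2 sigma1 sigma2 rho X s10 s20 rho1 X_iid coverage].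
  by apply: posterior_theta1E => //; exact: leq_trans n_ge3.
apply: matching_of_coverage => // alpha q /andP[alpha0 alpha1] qE.
have rho_lt1 : `|rho| < 1 by rewrite ltr_norml.
have m0 : 0 < n%:R - b by rewrite subr_gt0.
rewrite /coverage -(slope_coverage s10 s20 rho_lt1 X_iid q n_ge3) -qE.
(* The two events coincide at every outcome, degenerate samples included, so no null set has to be
   discarded. *)
congr (P _); apply/seteqP; split=> w /=; rewrite quantile_theta1_star// qE; lra.
Qed.
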